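(* Let $\mathfrak T$ be a triangulated category in which idempotent morphisms split, let $\mathfrak I\subseteq\mathfrak T$ be a homological ideal such that there are enough $\mathfrak I$-projective objects, and let $F\colon\mathfrak T\to\mathfrak C$ be the universal $\mathfrak I$-exact stable homological functor, $\ker F=\mathfrak I$ (equivalently: $F$ is a stable homological functor into a stable Abelian category with $\ker F=\mathfrak I$ such that $\mathfrak C$ has enough projective objects, the partially defined left adjoint $F^{\vdash}$ of $F$ is defined on the class $\mathfrak P\mathfrak C$ of projective objects of $\mathfrak C$, and $F\circ F^{\vdash}(A)\cong A$ naturally for all $A\in\mathfrak P\mathfrak C$). Let $\mathfrak P_{\mathfrak I}$ be the class of $\mathfrak I$-projective objects of $\mathfrak T$. Then: (a) The domain of $F^{\vdash}$ is equal to $\mathfrak P\mathfrak C$, and its essential range is $\mathfrak P_{\mathfrak I}$. The functors $F$ and $F^{\vdash}$ restrict to equivalences of categories $\mathfrak P_{\mathfrak I}\cong\mathfrak P\mathfrak C$ inverse to each other. (b) An object $A\in\mathfrak T$ is $\mathfrak I$-projective if and only if $F(A)$ is projective and $F$ induces isomorphisms $\mathfrak T(A,B)\cong\mathfrak C(F(A),F(B))$ for all $B\in\mathfrak T$. (c) For $A\in\mathfrak T$, $F(A)$ is projective in $\mathfrak C$ if and only if there is an $\mathfrak I$-equivalence $P\to A$ with $P\in\mathfrak P_{\mathfrak I}$. (d) For every $A\in\mathfrak T$, the functors $F$ and $F^{\vdash}$ induce bijections between isomorphism classes of projective resolutions of $F(A)$ in $\mathfrak C$ and isomorphism classes of $\mathfrak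 I$-projective resolutions of $A$ in $\mathfrak T$. (e) If $G\colon\mathfrak T\to\mathfrak C'$ is any (stable) homological functor, then there is a (up to natural isomorphism) unique right-exact (stable) functor $\bar G\colon\mathfrak C\to\mathfrak C'$ such that $\bar G\circ F(P)=G(P)$ for all $P\in\mathfrak P_{\mathfrak I}$. The left derived functors of $G$ with respect to $\mathfrak I$ and of $\bar G$ are related by natural isomorphisms $(\mathbb L_n\bar G)(F(A))\cong\mathbb L_nG(A)$ for all $A\in\mathfrak T$, $n\in\mathbb N$. (f) Similarly, if $G\colon\mathfrak T^{\mathrm{op}}\to\mathfrak C'$ is any (stable) cohomological functor, then there is a unique left-exact (stable) functor $\bar G\colon\mathfrak C^{\mathrm{op}}\to\mathfrak C'$ with $\bar G\circ F(P)=G(P)$ for all $P\in\mathfrak P_{\mathfrak I}$, and $(\mathbb R^n\bar G)(F(A))\cong\mathbb R^nG(A)$ naturally for all $A\in\mathfrak T$, $n\in\mathbb N$. In particular, there are natural isomorphisms $\mathrm{Ext}^n_{\mathfrak T,\mathfrak I}(A,B)\cong\mathrm{Ext}^n_{\mathfrak C}(F(A),F(B))$ for all $A,B\in\mathfrak T$, $n\in\mathbb N$.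
   Context: $\mathfrak T(A,B)$ denotes the group of morphisms $A\to B$; $\Sigma$ is the suspension of $\mathfrak T$. An ideal $\mathfrak I$ is a family of subgroups $\mathfrak I(A,B)\subseteq\mathfrak T(A,B)$ closed under composition with arbitrary morphisms on both sides. A stable Abelian category is an Abelian category with an additive automorphism $\Sigma$. A covariant additive functor $F\colon\mathfrak T\to\mathfrak C$ into an Abelian category is homological if $F(A)\to F(B)\to F(C)$ is exact at $F(B)$ for every exact triangle $A\to B\to C\to\Sigma A$ (cohomological: the analogous property for contravariant functors); it is stable homological if moreover $\mathfrak C$ is stable and there are natural isomorphisms $F(\Sigma A)\cong\Sigma F(A)$. $\ker F(A,B)=\{f\in\mathfrak T(A,B)\mid F(f)=0\}$. A homological ideal is the kernel of some stable homological functor. A homological functor $G$ is $\mathfrak I$-exact if $\mathfrak I\subseteq\ker G$. An $\mathfrak I$-exact stable homological functor $F\colon\mathfrak T\to\mathfrak C$ into a stable Abelian category is universal if every $\mathfrak I$-exact stable homological functor $G\colon\mathfrak T\to\mathfrak C'$ into a stable Abelian category factors as $G=\bar G\circ F$ for a stable exact functor $\bar G$ that is unique up to natural isomorphism. An object $A$ is $\mathfrak I$-projective if $\mathfrak T(A,\cdot)$ is $\mathfrak I$-exact. For a morphism $f$ embedded in an exact triangle $A\xrightarrow{f}B\xrightarrow{g}C\xrightarrow{h}\Sigma A$, $f$ is $\mathfrak I$-epic if $g\in\mathfrak I$, and an $\mathfrak I$-equivalence if $g,h\in\mathfrak I$. There are enough $\mathfrak I$-projective objects if each $A$ admits an $\mathfrak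 I$-epic morphism $P\to A$ with $P$ $\mathfrak I$-projective. Exact chain complexes: for a chain complex $C_\bullet=(C_n,d_n)$ over $\mathfrak T$, embed each $d_n$ in an exact triangle $C_n\xrightarrow{d_n}C_{n-1}\xrightarrow{f_n}X_n\xrightarrow{g_n}\Sigma C_n$; $C_\bullet$ is $\mathfrak I$-exact in degree $n$ if $\Sigma f_{n+1}\circ g_n\in\mathfrak I(X_n,\Sigma X_{n+1})$, and $\mathfrak I$-exact if this holds for all $n$. An $\mathfrak I$-projective resolution of $A$ is an $\mathfrak I$-exact chain complex $\cdots\to P_1\to P_0\to A\to0$ with all $P_n$ $\mathfrak I$-projective; such resolutions are functorial and unique up to chain homotopy. For an additive functor $G\colon\mathfrak T\to\mathfrak C'$ into an Abelian category, $\mathbb L_nG(A)$ is the $n$th homology of $G(P_\bullet)$ (complex $\cdots\to G(P_1)\to G(P_0)\to0$); for contravariant $G$, $\mathbb R^nG(A)$ is the $n$th cohomology of $G(P_\bullet)$. $\mathrm{Ext}^n_{\mathfrak T,\mathfrak I}(\cdot,B)$ is the $n$th right derived functor of $A\mapsto\mathfrak T(A,B)$. Partially defined left adjoint: for $A\in\mathfrak C$, $F^{\vdash}(A)$ is defined if $B\mapsto\mathfrak C(A,F(B))$ on $\mathfrak T$ is representable, and then $F^{\vdash}(A)$ is a representing object: $\mathfrak T(F^{\vdash}(A),B)\cong\mathfrak C(A,F(B))$ naturally in $B$. *)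

(* Defs.v *)
From HB Require Import structures.
From mathcomp Require Import all_boot all_order all_algebra.
From mathcomp Require Import boolp.

Set Implicit Arguments.
Unset Strict Implicit.
Unset Printing Implicit Defensive.

Import GRing.Theory.

Local Open Scope ring_scope.

#[local] Obligation Tactic := idtac.

(* Every category here is preadditive and every functor is additive.  The     *)
(* universes are monomorphic: "every Abelian category" ranges over those with *)
(* objects and morphisms in two fixed universes; Ab below is one of them.     *)

Record preaddcat := Preaddcat {
  ob :> Type;
  hom : ob -> ob -> zmodType;
  idm : forall A, hom A A;
  comp : forall A B C, hom B C -> hom A B -> hom A C;
  comp_idl : forall A B (f : hom A B), comp (idm B) f = f;
  comp_idr : forall A B (f : hom A B), comp f (idm A) = f;
  compA : forall A B C D (h : hom C D) (g : hom B C) (f : hom A B),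
    comp h (comp g f) = comp (comp h g) f;
  compDl : forall A B C (g g' : hom B C) (f : hom A B),
    comp (g + g') f = comp g f + comp g' f;
  compDr : forall A B C (g : hom B C) (f f' : hom A B),
    comp g (f + f') = comp g f + comp g f'
}.

Arguments hom {p} A B.
Arguments idm {p} A.
Arguments comp {p A B C} g f.

Declare Scope cat_scope.
Delimit Scope cat_scope with cat.
Open Scope cat_scope.

Notation "A ~> B" := (hom A B) (at level 90, right associativity) : cat_scope.
Notation "g ∘ f" := (comp g f) (at level 40, left associativity) : cat_scope.

Definition is_iso (C : preaddcat) (A B : C) (f : A ~> B) :=
  exists g : B ~> A, g ∘ f = idm A /\ f ∘ g = idm B.

Definition isomorphic (C : preaddcat) (A B : C) :=
  exists f : A ~> B, is_iso f.

Definition mono (C : preaddcat) (A B : C) (f : A ~> B) :=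
  forall (X : C) (g h : X ~> A), f ∘ g = f ∘ h -> g = h.

Definition epi (C : preaddcat) (A B : C) (f : A ~> B) :=
  forall (X : C) (g h : B ~> X), g ∘ f = h ∘ f -> g = h.

Definition is_zero (C : preaddcat) (Z : C) := idm Z = 0.

Definition is_kernel (C : preaddcat) (K A B : C) (f : A ~> B) (k : K ~> A) :=
  f ∘ k = 0 /\
  forall (X : C) (x : X ~> A), f ∘ x = 0 -> exists! y : X ~> K, k ∘ y = x.

Definition is_cokernel (C : preaddcat) (A B Q : C) (f : A ~> B) (q : B ~> Q) :=
  q ∘ f = 0 /\
  forall (X : C) (x : B ~> X), x ∘ f = 0 -> exists! y : Q ~> X, y ∘ q = x.

Definition opcat (C : preaddcat) : preaddcat :=
  {| ob := ob C;
     hom := fun A B => @hom C B A;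
     idm := fun A => @idm C A;
     comp := fun A B D g f => @comp C D B A f g;
     comp_idl := fun A B f => comp_idr f;
     comp_idr := fun A B f => comp_idl f;
     compA := fun A B D E h g f => esym (compA f g h);
     compDl := fun A B D g g' f => compDr f g g';
     compDr := fun A B D g f f' => compDl f f' g |}.

Definition fullsub (C : preaddcat) (P : C -> Prop) : preaddcat :=
  {| ob := {A : C | P A};
     hom := fun A B => sval A ~> sval B;
     idm := fun A => idm (sval A);
     comp := fun A B D g f => g ∘ f;
     comp_idl := fun A B f => comp_idl f;
     comp_idr := fun A B f => comp_idr f;
     compA := fun A B D E h g f => compA h g f;
     compDl := fun A B D g g' f => compDl g g' f;
     compDr := fun A B D g f f' => compDr g f f' |}.

Record functor (C D : preaddcat) := Functor {
  fob :> C -> D;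
  fmap : forall A B : C, (A ~> B) -> (fob A ~> fob B);
  fmap_id : forall A, fmap (idm A) = idm (fob A);
  fmap_comp : forall (A B E : C) (g : B ~> E) (f : A ~> B),
    fmap (g ∘ f) = fmap g ∘ fmap f;
  fmapD : forall (A B : C) (f g : A ~> B), fmap (f + g) = fmap f + fmap g
}.

Arguments fmap {C D} F {A B} f : rename.

Lemma comp0l (C : preaddcat) (A B D : C) (f : A ~> B) : (0 : B ~> D) ∘ f = 0.
Proof. by apply: (addrI (0 ∘ f)); rewrite -compDl !addr0. Qed.

Lemma fmap0 (C D : preaddcat) (F : functor C D) (A B : C) :
  fmap F (0 : A ~> B) = 0.
Proof. by apply: (addrI (fmap F 0)); rewrite -fmapD !addr0. Qed.

Program Definition fcomp (C D E : preaddcat) (G : functor D E) (F : functor C D)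
  : functor C E :=
  {| fob := fun A => G (F A); fmap := fun A B f => fmap G (fmap F f) |}.
Next Obligation. by move=> *; rewrite /= !fmap_id. Qed.
Next Obligation. by move=> *; rewrite /= !fmap_comp. Qed.
Next Obligation. by move=> *; rewrite /= !fmapD. Qed.

Notation "G ⊚ F" := (fcomp G F) (at level 40, left associativity) : cat_scope.

Definition fid (C : preaddcat) : functor C C :=
  {| fob := id; fmap := fun A B f => f; fmap_id := fun A => erefl;
     fmap_comp := fun A B D g f => erefl; fmapD := fun A B f g => erefl |}.

Definition fop (C D : preaddcat) (F : functor C D) : functor (opcat C) (opcat D) :=
  @Functor (opcat C) (opcat D) F (fun A B f => @fmap C D F B A f)
    (fmap_id F) (fun A B E g f => fmap_comp F f g)
    (fun A B f g => fmapD F f g).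

Definition femb (C : preaddcat) (P : C -> Prop) : functor (fullsub P) C :=
  @Functor (fullsub P) C (fun A => sval A) (fun A B f => f) (fun A => erefl)
    (fun A B E g f => erefl) (fun A B f g => erefl).

Definition fcorestr (C D : preaddcat) (F : functor C D) (Q : D -> Prop)
    (FQ : forall A, Q (F A)) : functor C (fullsub Q) :=
  @Functor C (fullsub Q) (fun A => exist Q (F A) (FQ A))
    (fun A B f => fmap F f) (fmap_id F)
    (fun A B E g f => fmap_comp F g f) (fun A B f g => fmapD F f g).

Definition nat_iso (C D : preaddcat) (F G : functor C D) :=
  exists a : forall A : C, F A ~> G A,
    (forall A, is_iso (a A)) /\
    (forall (A B : C) (f : A ~> B), a B ∘ fmap F f = fmap G f ∘ a A).

Definition inverse_equivalences (C D : preaddcat)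
    (F : functor C D) (G : functor D C) :=
  nat_iso (G ⊚ F) (fid C) /\ nat_iso (F ⊚ G) (fid D).

Definition unique_upto_iso (C D : preaddcat) (P : functor C D -> Prop) :=
  exists F : functor C D, P F /\ forall F' : functor C D, P F' -> nat_iso F' F.

Definition addhom (U V : zmodType) := {additive U -> V}.

Lemma addhomP (U V : zmodType) (f g : addhom U V) :
  (forall x, (f : {additive U -> V}) x = (g : {additive U -> V}) x) -> f = g.
Proof.
move=> /funext; case: f => f [[f1]]; case: g => g [[g1]] /= efg.
by subst g; rewrite (Prop_irrelevance f1 g1).
Qed.

HB.instance Definition _ (U V : zmodType) := gen_eqMixin (addhom U V).
HB.instance Definition _ (U V : zmodType) := gen_choiceMixin (addhom U V).

Section AddhomZmod.
Context (U V : zmodType).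
Implicit Types f g h : addhom U V.

Let ev f : {additive U -> V} := f.
Let zeroh : addhom U V := (\0 : U -> V) : {additive U -> V}.
Let addh f g : addhom U V := (ev f \+ ev g) : {additive U -> V}.
Let opph f : addhom U V := (\- ev f) : {additive U -> V}.

Let addhA : associative addh.
Proof. by move=> f g h; apply: addhomP => x; exact: addrA. Qed.
Let addhC : commutative addh.
Proof. by move=> f g; apply: addhomP => x; exact: addrC. Qed.
Let add0h : left_id zeroh addh.
Proof. by move=> f; apply: addhomP => x; exact: add0r. Qed.
Let addNh : left_inverse zeroh opph addh.
Proof. by move=> f; apply: addhomP => x; exact: addNr. Qed.

HB.instance Definition _ :=
  GRing.isZmodule.Build (addhom U V) addhA addhC add0h addNh.
End AddhomZmod.

Definition addcomp (U V W : zmodType) (g : addhom V W) (f : addhom U V) :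
    addhom U W :=
  ((g : {additive V -> W}) \o (f : {additive U -> V})) : {additive U -> W}.

Program Definition Ab : preaddcat :=
  {| ob := zmodType; hom := fun U V => addhom U V : zmodType;
     idm := fun U => (idfun : {additive U -> U});
     comp := addcomp |}.
Next Obligation. by move=> *; apply: addhomP. Qed.
Next Obligation. by move=> *; apply: addhomP. Qed.
Next Obligation. by move=> *; apply: addhomP. Qed.
Next Obligation. by move=> *; apply: addhomP. Qed.
Next Obligation.
move=> U V W g f f'; apply: addhomP => x.
exact: (raddfD (g : {additive V -> W})).
Qed.

Lemma comp_zmod_morphism (C : preaddcat) (A B D : C) (g : B ~> D) :
  zmod_morphism (fun f : A ~> B => g ∘ f).
Proof.
move=> x y; apply: (addIr (g ∘ y)).
by rewrite -compDr !subrK.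
Qed.

Definition postcomp (C : preaddcat) (A B D : C) (g : B ~> D) :
    @hom Ab (A ~> B) (A ~> D) :=
  HB.pack_for {additive (A ~> B) -> (A ~> D)} (fun f : A ~> B => g ∘ f)
    (GRing.isZmodMorphism.Build _ _ _ (@comp_zmod_morphism C A B D g)).

Program Definition homfun (C : preaddcat) (A : C) : functor C Ab :=
  {| fob := fun B => (A ~> B) : Ab; fmap := fun B D g => postcomp A g |}.
Next Obligation. by move=> C A B; apply: addhomP => x; exact: comp_idl. Qed.
Next Obligation.
by move=> C A B D E g f; apply: addhomP => x /=; rewrite -compA.
Qed.
Next Obligation.
by move=> C A B D f g; apply: addhomP => x; exact: compDl.
Qed.

(** The contravariant functor A |-> Hom(A, B). *)
Definition cohomfun (C : preaddcat) (B : C) : functor (opcat C) Ab :=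
  @homfun (opcat C) B.

Definition is_biproduct (C : preaddcat) (A B S : C) :=
  exists (i1 : A ~> S) (i2 : B ~> S) (p1 : S ~> A) (p2 : S ~> B),
    [/\ p1 ∘ i1 = idm A, p2 ∘ i2 = idm B, p1 ∘ i2 = 0, p2 ∘ i1 = 0 &
        i1 ∘ p1 + i2 ∘ p2 = idm S].

Record is_additive (C : preaddcat) : Prop := IsAdditive {
  has_zero : exists Z : C, is_zero Z;
  has_biproduct : forall A B : C, exists S : C, is_biproduct A B S
}.

Record is_abelian (C : preaddcat) : Prop := IsAbelian {
  abelian_additive : is_additive C;
  has_kernel : forall (A B : C) (f : A ~> B),
    exists (K : C) (k : K ~> A), is_kernel f k;
  has_cokernel : forall (A B : C) (f : A ~> B),
    exists (Q : C) (q : B ~> Q), is_cokernel f q;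
  mono_normal : forall (A B : C) (f : A ~> B), mono f ->
    exists (D : C) (g : B ~> D), is_kernel g f;
  epi_normal : forall (A B : C) (f : A ~> B), epi f ->
    exists (D : C) (g : D ~> A), is_cokernel g f
}.

Record abcat := Abcat {
  abcat_cat :> preaddcat;
  abcatP : is_abelian abcat_cat
}.

(** An automorphism of a category, i.e. an invertible (not merely
    quasi-invertible) endofunctor. *)
Definition is_automorphism (C : preaddcat) (S : functor C C) :=
  bijective (fob S) /\ forall A B : C, bijective (@fmap C C S A B).

Record stablecat := Stablecat {
  stablecat_cat :> preaddcat;
  susp : functor stablecat_cat stablecat_cat;
  suspP : is_automorphism susp
}.

Arguments susp {s}.

Record stabcat := Stabcat {
  stabcat_stable :> stablecat;
  stabcatP : is_abelian stabcat_stable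
}.

Coercion stabcat_abcat (C : stabcat) : abcat := Abcat (@stabcatP C).

Record triangulated := Triangulated {
  tri_stable :> stablecat;
  tri_additive : is_additive tri_stable;
  exact_tri : forall A B C : tri_stable,
    (A ~> B) -> (B ~> C) -> (C ~> susp A) -> Prop;
  tri_isoP : forall (A B C A' B' C' : tri_stable)
      (f : A ~> B) (g : B ~> C) (h : C ~> susp A)
      (f' : A' ~> B') (g' : B' ~> C') (h' : C' ~> susp A')
      (a : A ~> A') (b : B ~> B') (c : C ~> C'),
    is_iso a -> is_iso b -> is_iso c ->
    b ∘ f = f' ∘ a -> c ∘ g = g' ∘ b -> fmap susp a ∘ h = h' ∘ c ->
    exact_tri f g h -> exact_tri f' g' h';
  tri_id : forall A Z : tri_stable, is_zero Z ->
    exact_tri (idm A) (0 : A ~> Z) (0 : Z ~> susp A);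
  tri_complete : forall (A B : tri_stable) (f : A ~> B),
    exists (C : tri_stable) (g : B ~> C) (h : C ~> susp A), exact_tri f g h;
  tri_rotate : forall (A B C : tri_stable)
      (f : A ~> B) (g : B ~> C) (h : C ~> susp A),
    exact_tri f g h <-> exact_tri g h (- fmap susp f);
  tri_morph : forall (A B C A' B' C' : tri_stable)
      (f : A ~> B) (g : B ~> C) (h : C ~> susp A)
      (f' : A' ~> B') (g' : B' ~> C') (h' : C' ~> susp A')
      (a : A ~> A') (b : B ~> B'),
    exact_tri f g h -> exact_tri f' g' h' -> b ∘ f = f' ∘ a ->
    exists c : C ~> C', c ∘ g = g' ∘ b /\ fmap susp a ∘ h = h' ∘ c;
  tri_octahedral : forall (X Y Z U V W : tri_stable)
      (f : X ~> Y) (f1 : Y ~> U) (f2 : U ~> susp X)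
      (g : Y ~> Z) (g1 : Z ~> V) (g2 : V ~> susp Y)
      (h1 : Z ~> W) (h2 : W ~> susp X),
    exact_tri f f1 f2 -> exact_tri g g1 g2 -> exact_tri (g ∘ f) h1 h2 ->
    exists (u : U ~> W) (v : W ~> V),
      [/\ exact_tri u v (fmap susp f1 ∘ g2),
          u ∘ f1 = h1 ∘ g, h2 ∘ u = f2, v ∘ h1 = g1 &
          g2 ∘ v = fmap susp f ∘ h2]
}.

Definition idempotents_split (C : preaddcat) :=
  forall (A : C) (e : A ~> A), e ∘ e = e ->
  exists (B : C) (r : A ~> B) (s : B ~> A), r ∘ s = idm B /\ s ∘ r = e.

(** Exactness of A -> B -> C at B: the kernel of g is the image of f, that is,
    f is an epimorphism followed by a (mono)morphism that is a kernel of g. *)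
Definition exact_at (C : preaddcat) (X Y Z : C) (f : X ~> Y) (g : Y ~> Z) :=
  exists (K : C) (k : K ~> Y) (e : X ~> K),
    [/\ is_kernel g k, epi e & f = k ∘ e].

(** 0 -> X -> Y -> Z is exact iff X -> Y is a kernel of Y -> Z. *)
Definition left_exact (C D : preaddcat) (F : functor C D) :=
  forall (X Y Z : C) (f : X ~> Y) (g : Y ~> Z),
    is_kernel g f -> is_kernel (fmap F g) (fmap F f).

Definition right_exact (C D : preaddcat) (F : functor C D) :=
  forall (X Y Z : C) (f : X ~> Y) (g : Y ~> Z),
    is_cokernel f g -> is_cokernel (fmap F f) (fmap F g).

Definition exact_functor (C D : preaddcat) (F : functor C D) :=
  left_exact F /\ right_exact F.

Definition projective (C : preaddcat) (P : C) :=
  forall (X Y : C) (e : X ~> Y) (f : P ~> Y), epi e ->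
  exists g : P ~> X, e ∘ g = f.

Definition enough_projectives (C : preaddcat) :=
  forall X : C, exists (P : C) (e : P ~> X), projective P /\ epi e.

Definition homological (T : triangulated) (C : abcat) (F : functor T C) :=
  forall (A B D : T) (f : A ~> B) (g : B ~> D) (h : D ~> susp A),
    exact_tri f g h -> exact_at (fmap F f) (fmap F g).

Definition cohomological (T : triangulated) (C : abcat)
    (F : functor (opcat T) C) :=
  forall (A B D : T) (f : A ~> B) (g : B ~> D) (h : D ~> susp A),
    exact_tri f g h ->
    exact_at (@fmap (opcat T) C F D B g) (@fmap (opcat T) C F B A f).

Definition stable_functor (C D : stablecat) (F : functor C D) :=
  nat_iso (F ⊚ susp) (susp ⊚ F).

(** The suspension of the opposite category is the inverse of [susp], so that
    a contravariant F is stable if F(susp^-1 A) and susp F(A) are naturally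
    isomorphic, equivalently F(A) and susp F(susp A). *)
Definition stable_cofunctor (C D : stablecat) (F : functor (opcat C) D) :=
  nat_iso F (susp ⊚ F ⊚ fop susp).

Definition stable_homological (T : triangulated) (C : stabcat)
    (F : functor T C) :=
  @homological T C F /\ stable_functor F.

Definition stable_cohomological (T : triangulated) (C : stabcat)
    (F : functor (opcat T) C) :=
  @cohomological T C F /\ stable_cofunctor F.

Record ideal (C : preaddcat) := Ideal {
  ideal_mem :> forall A B : C, (A ~> B) -> Prop;
  ideal0 : forall A B : C, ideal_mem (0 : A ~> B);
  idealB : forall (A B : C) (f g : A ~> B),
    ideal_mem f -> ideal_mem g -> ideal_mem (f - g);
  ideal_compl : forall (A B D : C) (g : B ~> D) (f : A ~> B),
    ideal_mem f -> ideal_mem (g ∘ f);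
  ideal_compr : forall (A B D : C) (g : B ~> D) (f : A ~> B),
    ideal_mem g -> ideal_mem (g ∘ f)
}.

Arguments ideal_mem {C} i {A B} f.

Definition kernel_is (C D : preaddcat) (F : functor C D) (I : ideal C) :=
  forall (A B : C) (f : A ~> B), fmap F f = 0 <-> ideal_mem I f.

Definition homological_ideal (T : triangulated) (I : ideal T) :=
  exists (C : stabcat) (F : functor T C), stable_homological F /\ kernel_is F I.

Definition ideal_exact (C D : preaddcat) (I : ideal C) (F : functor C D) :=
  forall (A B : C) (f : A ~> B), ideal_mem I f -> fmap F f = 0.

Definition universal_exact (T : triangulated) (I : ideal T) (C : stabcat)
    (F : functor T C) :=
  [/\ stable_homological F, ideal_exact I F &
      forall (C' : stabcat) (G : functor T C'),
        stable_homological G -> ideal_exact I G ->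
        unique_upto_iso (fun Gb : functor C C' =>
          [/\ exact_functor Gb, stable_functor Gb & nat_iso (Gb ⊚ F) G])].

Definition ideal_projective (T : triangulated) (I : ideal T) (A : T) :=
  ideal_exact I (homfun A).

Definition ideal_epic (T : triangulated) (I : ideal T) (A B : T) (f : A ~> B) :=
  exists (C : T) (g : B ~> C) (h : C ~> susp A),
    exact_tri f g h /\ ideal_mem I g.

Definition ideal_equivalence (T : triangulated) (I : ideal T) (A B : T)
    (f : A ~> B) :=
  exists (C : T) (g : B ~> C) (h : C ~> susp A),
    [/\ exact_tri f g h, ideal_mem I g & ideal_mem I h].

Definition enough_ideal_projectives (T : triangulated) (I : ideal T) :=
  forall A : T, exists (P : T) (f : P ~> A),
    ideal_projective I P /\ ideal_epic I f.

(** A complex ... -> P_1 -> P_0 -> A -> 0, with P_n = [cxob n]. *)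
Record augcx (C : preaddcat) (A : C) := Augcx {
  cxob :> nat -> C;
  cxd : forall n, cxob n.+1 ~> cxob n;
  cxe : cxob 0 ~> A;
  cxdd : forall n, cxd n ∘ cxd n.+1 = 0;
  cxed : cxe ∘ cxd 0 = 0
}.

Arguments cxd {C A} P n : rename.
Arguments cxe {C A} P : rename.

Definition chain_map_over (C : preaddcat) (A B : C) (P : augcx A) (Q : augcx B)
    (f : A ~> B) (phi : forall n, P n ~> Q n) :=
  (forall n, phi n ∘ cxd P n = cxd Q n ∘ phi n.+1) /\
  f ∘ cxe P = cxe Q ∘ phi 0%N.

Definition augcx_iso (C : preaddcat) (A : C) (P Q : augcx A) :=
  exists phi : forall n, P n ~> Q n,
    chain_map_over (idm A) phi /\ forall n, is_iso (phi n).

(** I-exactness of X -> Y -> Z at Y, where f = d_{n+1} and g = d_n. *)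
Definition ideal_exact_at (T : triangulated) (I : ideal T) (X Y Z : T)
    (f : X ~> Y) (g : Y ~> Z) :=
  exists (X1 X0 : T) (f1 : Y ~> X1) (g1 : X1 ~> susp X)
         (f0 : Z ~> X0) (g0 : X0 ~> susp Y),
    [/\ exact_tri f f1 g1, exact_tri g f0 g0 & ideal_mem I (fmap susp f1 ∘ g0)].

(** Exactness is only demanded in degrees >= -1; below that, all objects of the
    complex are zero. *)
Definition resolution (C : preaddcat) (proj : C -> Prop)
    (ex : forall X Y Z : C, (X ~> Y) -> (Y ~> Z) -> Prop)
    (A : C) (P : augcx A) :=
  [/\ forall n, proj (P n),
      forall n, ex _ _ _ (cxd P n.+1) (cxd P n),
      ex _ _ _ (cxd P 0) (cxe P) &
      exists Z : C, is_zero Z /\ ex _ _ _ (cxe P) (0 : A ~> Z)].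

Definition ideal_projres (T : triangulated) (I : ideal T) (A : T) (P : augcx A) :=
  resolution (ideal_projective I) (@ideal_exact_at T I) P.

Definition projres (C : preaddcat) (X : C) (Q : augcx X) :=
  resolution (@projective C) (@exact_at C) Q.

Program Definition fmap_cx (C D : preaddcat) (F : functor C D) (A : C)
    (P : augcx A) : augcx (F A) :=
  {| cxob := fun n => F (P n); cxd := fun n => fmap F (cxd P n);
     cxe := fmap F (cxe P) |}.
Next Obligation.
by move=> C D F A P n; rewrite -fmap_comp cxdd fmap0.
Qed.
Next Obligation.
by move=> C D F A P; rewrite -fmap_comp cxed fmap0.
Qed.

(** [H] is the homology at [B] of A -f-> B -g-> C: the cokernel of the map
    from [A] to the kernel of [g] induced by [f]. *)
Record homology (D : preaddcat) (A B C : D) (f : A ~> B) (g : B ~> C) (H : D) :=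
  Homology {
    hcyc : D;
    hinc : hcyc ~> B;
    hbd : A ~> hcyc;
    hproj : hcyc ~> H;
    hincP : is_kernel g hinc;
    hbdP : hinc ∘ hbd = f;
    hprojP : is_cokernel hbd hproj
  }.

(** [h : H ~> H'] is the map on homology induced by [b : B ~> B']. *)
Definition homology_map (D : preaddcat) (A B C A' B' C' H H' : D)
    (f : A ~> B) (g : B ~> C) (f' : A' ~> B') (g' : B' ~> C')
    (w : homology f g H) (w' : homology f' g' H') (b : B ~> B') (h : H ~> H') :=
  exists z : hcyc w ~> hcyc w',
    hinc w' ∘ z = b ∘ hinc w /\ h ∘ hproj w = hproj w' ∘ z.

(** The differential leaving P_n in the truncated complex ... -> P_1 -> P_0 -> 0.
    For n = 0 any zero morphism out of P_0 has the required kernel and image. *)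
Definition cxtgt (C : preaddcat) (A : C) (P : augcx A) (n : nat) : C :=
  if n is m.+1 then P m else P 0.

Definition cxout (C : preaddcat) (A : C) (P : augcx A) (n : nat) :
    P n ~> cxtgt P n :=
  match n with 0 => 0 | m.+1 => cxd P m end.

(** [L] is the [n]th left derived functor of [G], computed by chosen resolutions
    in the class [res]. *)
Definition is_left_derived (C D : preaddcat)
    (res : forall A : C, augcx A -> Prop) (G : functor C D) (n : nat)
    (L : functor C D) :=
  exists P : forall A : C, augcx A, (forall A, res A (P A)) /\
  exists w : forall A, homology (fmap G (cxd (P A) n)) (fmap G (cxout (P A) n)) (L A),
    forall (A B : C) (f : A ~> B) (phi : forall n, P A n ~> P B n),
      chain_map_over f phi ->
      homology_map (w A) (w B) (fmap G (phi n)) (fmap L f).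

Definition cohomology (C D : preaddcat) (G : functor (opcat C) D) (A : C)
    (P : augcx A) (n : nat) (H : D) :=
  homology (@fmap (opcat C) D G (cxtgt P n) (P n) (cxout P n))
           (@fmap (opcat C) D G (P n) (P n.+1) (cxd P n)) H.

Definition is_right_derived (C D : preaddcat)
    (res : forall A : C, augcx A -> Prop) (G : functor (opcat C) D) (n : nat)
    (R : functor (opcat C) D) :=
  exists P : forall A : C, augcx A, (forall A, res A (P A)) /\
  exists w : forall A, cohomology G (P A) n (R A),
    forall (A B : C) (f : A ~> B) (phi : forall n, P A n ~> P B n),
      chain_map_over f phi ->
      homology_map (w B) (w A) (@fmap (opcat C) D G (P B n) (P A n) (phi n))
        (@fmap (opcat C) D R B A f).

(** Functors C^op x C -> Ab. *)
Record bifunctor (C : preaddcat) := Bifunctor {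
  biob :> C -> C -> Ab;
  bimap : forall A A' B B' : C, (A' ~> A) -> (B ~> B') ->
    (biob A B ~> biob A' B');
  bimap_id : forall A B, bimap (idm A) (idm B) = idm (biob A B);
  bimap_comp : forall (A A' A'' B B' B'' : C)
      (a : A' ~> A) (a' : A'' ~> A') (b : B ~> B') (b' : B' ~> B''),
    bimap (a ∘ a') (b' ∘ b) = bimap a' b' ∘ bimap a b
}.

Arguments bimap {C} E {A A' B B'} a b : rename.

(** [E] is Ext^n: for fixed [B] it is the [n]th right derived functor of
    Hom(-, B), and it is covariant in [B] through Hom(P, B) -> Hom(P, B'). *)
Definition is_Ext (C : preaddcat) (res : forall A : C, augcx A -> Prop)
    (n : nat) (E : bifunctor C) :=
  exists P : forall A : C, augcx A, (forall A, res A (P A)) /\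
  exists w : forall A B, cohomology (cohomfun B) (P A) n (E A B),
    forall (A A' B B' : C) (a : A' ~> A) (b : B ~> B')
        (phi : forall n, P A' n ~> P A n),
      chain_map_over a phi ->
      homology_map (w A B) (w A' B')
        (postcomp (P A' n) b ∘
           @fmap (opcat C) Ab (cohomfun B) (P A n) (P A' n) (phi n))
        (bimap E a b).

(** A representing object of B |-> Hom(X, F B). *)
Record representation (T C : preaddcat) (F : functor T C) (X : C) :=
  Representation {
    rep_ob : T;
    rep : forall B : T, (rep_ob ~> B) -> (X ~> F B);
    rep_inv : forall B : T, (X ~> F B) -> (rep_ob ~> B);
    repK : forall B, cancel (@rep B) (@rep_inv B);
    rep_invK : forall B, cancel (@rep_inv B) (@rep B);
    rep_nat : forall (B B' : T) (b : B ~> B') (g : rep_ob ~> B),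
      rep (b ∘ g) = fmap F b ∘ rep g
  }.

Arguments rep {T C F X} r {B} g : rename.
Arguments rep_inv {T C F X} r {B} f : rename.

Definition ladj_dom (T C : preaddcat) (F : functor T C) (X : C) :=
  exists r : representation F X, True.

Definition ladj_rep (T C : preaddcat) (F : functor T C)
    (X : fullsub (ladj_dom F)) : representation F (sval X) :=
  sval (cid (svalP X)).

Definition ladj_map (T C : preaddcat) (F : functor T C)
    (X Y : fullsub (ladj_dom F)) (u : X ~> Y) :
    rep_ob (ladj_rep X) ~> rep_ob (ladj_rep Y) :=
  rep_inv (ladj_rep X) (rep (ladj_rep Y) (idm _) ∘ u).

Lemma repE (T C : preaddcat) (F : functor T C) (X : C)
    (r : representation F X) (B : T) (g : rep_ob r ~> B) :
  rep r g = fmap F g ∘ rep r (idm _).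
Proof. by rewrite -rep_nat comp_idr. Qed.

Lemma rep_inj (T C : preaddcat) (F : functor T C) (X : C)
    (r : representation F X) (B : T) : injective (@rep _ _ _ _ r B).
Proof. exact: can_inj (repK (r := r) (B := B)). Qed.

Program Definition ladj (T C : preaddcat) (F : functor T C) :
    functor (fullsub (ladj_dom F)) T :=
  {| fob := fun X => rep_ob (ladj_rep X); fmap := @ladj_map T C F |}.
Next Obligation.
by move=> T C F X; rewrite /ladj_map comp_idr repK.
Qed.
Next Obligation.
move=> T C F X Y Z v u; apply: rep_inj.
by rewrite rep_nat !rep_invK compA -repE rep_invK -compA.
Qed.
Next Obligation.
move=> T C F X Y u v; apply: rep_inj.
by rewrite [RHS]repE fmapD compDl -!repE !rep_invK compDr.
Qed.

(** The image under the partial left adjoint of a complex over F(A): the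
    augmentation becomes its adjunct. *)
Program Definition ladj_cx (T C : preaddcat) (F : functor T C) (A : T)
    (Q : augcx (F A)) (Qdom : forall n, ladj_dom F (Q n)) : augcx A :=
  let Qn n : fullsub (ladj_dom F) := exist _ (Q n) (Qdom n) in
  {| cxob := fun n => ladj F (Qn n);
     cxd := fun n => @fmap _ _ (ladj F) (Qn n.+1) (Qn n) (cxd Q n);
     cxe := rep_inv (ladj_rep (Qn 0%N)) (cxe Q) |}.
Next Obligation.
move=> T C F A Q Qdom Qn n; rewrite -(fmap_comp (ladj F)).
by rewrite [_ ∘ _](cxdd Q) (fmap0 (ladj F)).
Qed.
Next Obligation.
move=> T C F A Q Qdom Qn; apply: rep_inj.
by rewrite rep_nat rep_invK compA -repE rep_invK cxed repE fmap0 comp0l.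
Qed.

(* Main.v *)
(** The universal functor is realised by the category of coherent functors on
    the ideal-projective objects: its objects are arrows [P1 -> P0], standing
    for the cokernel of [T(-, P1) -> T(-, P0)], and enough ideal-projectives
    provide weak kernels, which makes it Abelian.  Everything else follows from
    one intrinsic property of [F] ([ideal_resolving]): the objects [F P], [P]
    ideal-projective, are projective and cover [C], and [F] is bijective on
    [T(P, B)].  Such an [F] carries ideal-projective resolutions to projective
    resolutions, and chain maps and homotopies between them correspond.

    A functor [G] on the ideal-projectives extends to [C] by a left Kan
    extension, i.e. by the object carrying the universal family of maps
    [G P -> Gb X] indexed by [x : F P -> X]; right exactness and uniqueness are
    read off from this.  When [G] is homological and kills the ideal it is exact
    on resolutions by ideal-projectives, so the extension is exact.
    Contravariant functors are treated as functors into the opposite category. *)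
From HB Require Import structures.
From mathcomp Require Import all_boot all_order all_algebra.
From mathcomp Require Import boolp.
Require Import Defs.

Set Implicit Arguments.
Unset Strict Implicit.
Unset Printing Implicit Defensive.

Import GRing.Theory.

Local Open Scope ring_scope.

(** A universal property alone gives no access to the projective objects of [C]. So a universal
    functor with known projectives is built first, and any other one is compared with it: uniqueness
    up to natural isomorphism makes the two comparison functors mutually inverse equivalences, along
    which the resolving property is carried. Two points resist a formal argument. The objects [F P]
    a priori reach the projectives of [C] only up to retracts; bijectivity of [F] on [T(P, P)]
    brings the idempotent back to [T], where it splits. And an object in the domain of the partial
    left adjoint might fail to be projective; this is excluded because every object of [C] embeds
    into some [F A], which forces the unit to be an isomorphism. Derived functors are specified
    through arbitrary chosen resolutions. The two sides of a comparison are therefore both rewritten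
    as computed from resolutions of [F A] in [C], where any two choices are homotopy equivalent. *)

Section Preadditive.
Variable C : preaddcat.
Implicit Types A B D X Y Z : C.

Lemma comp0r A B D (g : B ~> D) : g ∘ (0 : A ~> B) = 0.
Proof. by apply: (addrI (g ∘ 0)); rewrite -compDr !addr0. Qed.

Lemma compNl A B D (g : B ~> D) (f : A ~> B) : (- g) ∘ f = - (g ∘ f).
Proof. by apply: (addrI (g ∘ f)); rewrite -compDl !subrr comp0l. Qed.

Lemma compNr A B D (g : B ~> D) (f : A ~> B) : g ∘ (- f) = - (g ∘ f).
Proof. by apply: (addrI (g ∘ f)); rewrite -compDr !subrr comp0r. Qed.

Lemma compBl A B D (g g' : B ~> D) (f : A ~> B) :
  (g - g') ∘ f = g ∘ f - g' ∘ f.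
Proof. by rewrite compDl compNl. Qed.

Lemma compBr A B D (g : B ~> D) (f f' : A ~> B) :
  g ∘ (f - f') = g ∘ f - g ∘ f'.
Proof. by rewrite compDr compNr. Qed.

Lemma zero_hom_from Z A (f : Z ~> A) : is_zero Z -> f = 0.
Proof. by move=> Z0; rewrite -(comp_idr f) Z0 comp0r. Qed.

Lemma monoP A B (f : A ~> B) :
  mono f <-> forall X (x : X ~> A), f ∘ x = 0 -> x = 0.
Proof.
split=> [fm X x fx0|fm X g h E]; first by apply: fm; rewrite comp0r.
by apply/subr0_eq/fm; rewrite compBr E subrr.
Qed.

Lemma epiP A B (f : A ~> B) :
  epi f <-> forall X (x : B ~> X), x ∘ f = 0 -> x = 0.
Proof.
split=> [fe X x fx0|fe X g h E]; first by apply: fe; rewrite comp0l.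
by apply/subr0_eq/fe; rewrite compBl E subrr.
Qed.

Lemma epi_comp A B D (g : B ~> D) (f : A ~> B) : epi g -> epi f -> epi (g ∘ f).
Proof. by move=> ge fe X x y; rewrite !compA => /fe/ge. Qed.

Lemma epi_left A B D (g : B ~> D) (f : A ~> B) : epi (g ∘ f) -> epi g.
Proof. by move=> e X x y E; apply: e; rewrite !compA E. Qed.

Lemma mono_right A B D (g : B ~> D) (f : A ~> B) : mono (g ∘ f) -> mono f.
Proof. by move=> m X x y E; apply: m; rewrite -!compA E. Qed.

Lemma epi_split A B (f : A ~> B) (s : B ~> A) : f ∘ s = idm B -> epi f.
Proof. by move=> E X x y /(congr1 (fun t => t ∘ s)); rewrite -!compA E !comp_idr. Qed.

Lemma iso_id A : is_iso (idm A).
Proof. by exists (idm A); rewrite comp_idl. Qed.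

Lemma iso_comp A B D (g : B ~> D) (f : A ~> B) :
  is_iso g -> is_iso f -> is_iso (g ∘ f).
Proof.
move=> [g' [g1 g2]] [f' [f1 f2]]; exists (f' ∘ g'); split.
  by rewrite compA -(compA f') g1 comp_idr.
by rewrite compA -(compA g) f2 comp_idr.
Qed.

Lemma iso_epi A B (f : A ~> B) : is_iso f -> epi f.
Proof. by case=> g [_ h]; apply: epi_split h. Qed.

Lemma iso_mono A B (f : A ~> B) : is_iso f -> mono f.
Proof.
by case=> g [h _] X x y /(congr1 (fun t => g ∘ t)); rewrite !compA h !comp_idl.
Qed.

Lemma kernel_mono K A B (f : A ~> B) (k : K ~> A) : is_kernel f k -> mono k.
Proof.
move=> [fk ku] X g h E.
have [|y [_ yu]] := ku _ (k ∘ h); first by rewrite compA fk comp0l.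
by rewrite -(yu g E) -(yu h erefl).
Qed.

Lemma kernel_lift K A B (f : A ~> B) (k : K ~> A) X (x : X ~> A) :
  is_kernel f k -> f ∘ x = 0 -> exists y : X ~> K, k ∘ y = x.
Proof. by move=> [_ ku] /ku [y [Ey _]]; exists y. Qed.

Lemma kernel_intro K A B (f : A ~> B) (k : K ~> A) : f ∘ k = 0 -> mono k ->
  (forall X (x : X ~> A), f ∘ x = 0 -> exists y : X ~> K, k ∘ y = x) ->
  is_kernel f k.
Proof.
move=> fk km ku; split=> // X x /ku [y Ey]; exists y; split=> // z Ez.
by apply: km; rewrite Ey Ez.
Qed.

Lemma cokernel_epi A B Q (f : A ~> B) (q : B ~> Q) : is_cokernel f q -> epi q.
Proof.
move=> [fk ku] X g h E.
have [|y [_ yu]] := ku _ (h ∘ q); first by rewrite -compA fk comp0r.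
by rewrite -(yu g E) -(yu h erefl).
Qed.

Lemma cokernel_desc A B Q (f : A ~> B) (q : B ~> Q) X (x : B ~> X) :
  is_cokernel f q -> x ∘ f = 0 -> exists y : Q ~> X, y ∘ q = x.
Proof. by move=> [_ ku] /ku [y [Ey _]]; exists y. Qed.

Lemma cokernel_intro A B Q (f : A ~> B) (q : B ~> Q) : q ∘ f = 0 -> epi q ->
  (forall X (x : B ~> X), x ∘ f = 0 -> exists y : Q ~> X, y ∘ q = x) ->
  is_cokernel f q.
Proof.
move=> fk km ku; split=> // X x /ku [y Ey]; exists y; split=> // z Ez.
by apply: km; rewrite Ey Ez.
Qed.

End Preadditive.

Lemma abelian_op (C : preaddcat) : is_abelian C -> is_abelian (opcat C).
Proof.
case=> -[zC bC] kC cC mC eC; split.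
- split; first by case: zC => Z Z0; exists Z.
  move=> A B; case: (bC A B) => S [i1 [i2 [p1 [p2 [a b c d e]]]]].
  by exists S, p1, p2, i1, i2; split.
- by move=> A B f; exact: (cC B A f).
- by move=> A B f; exact: (kC B A f).
- by move=> A B f; exact: (eC B A f).
- by move=> A B f; exact: (mC B A f).
Qed.

(** * Abelian categories: chasing diagrams with epimorphic covers *)

Section Abelian.
Variables (C : preaddcat) (Cab : is_abelian C).
Implicit Types A B D X Y Z U V : C.

Lemma biprod A B : exists S : C, is_biproduct A B S.
Proof. by case: Cab => -[_ h] *; apply: h. Qed.

Lemma epi_coker_ker K A B (f : A ~> B) (k : K ~> A) :
  epi f -> is_kernel f k -> is_cokernel k f.
Proof.
move=> fe fk; have [D [g fg]] := epi_normal Cab fe.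
apply: cokernel_intro => //; first by case: fk.
move=> X x xk; apply: (cokernel_desc fg).
have [y <-] : exists y, k ∘ y = g by apply: (kernel_lift fk); case: fg.
by rewrite compA xk comp0l.
Qed.

(** The pullback is the kernel of [h] on the biproduct. As [h] is epi, it is the cokernel of [k], so
    a [t] that kills [p2 ∘ k] gives [t ∘ p2 = y ∘ h]; restricting to the summand [X] yields
    [y ∘ e = 0], hence [y = 0]. *)
Lemma epi_pullback X K U (e : X ~> K) (u : U ~> K) : epi e ->
  exists (V : C) (e' : V ~> U) (u' : V ~> X), epi e' /\ e ∘ u' = u ∘ e'.
Proof.
move=> ee; have [S [i1 [i2 [p1 [p2 [a b c d s]]]]]] := biprod X U.
pose h := e ∘ p1 - u ∘ p2.
have h1 : h ∘ i1 = e by rewrite compBl -!compA a d comp_idr comp0r subr0.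
have h2 : h ∘ i2 = - u by rewrite compBl -!compA b c comp_idr comp0r sub0r.
have he : epi h by apply: (@epi_left _ _ _ _ h i1); rewrite h1.
have [V [k hk]] := has_kernel Cab h.
exists V, (p2 ∘ k), (p1 ∘ k); split; last first.
  by apply/subr0_eq; rewrite !compA -compBl; case: hk.
apply/epiP => W t; rewrite compA => tk.
have [y Ey] := cokernel_desc (epi_coker_ker he hk) tk.
have y0 : y = 0.
  apply: (iffLR (epiP _) ee).
  by rewrite -h1 compA Ey -compA d comp0r.
by rewrite -(comp_idr t) -b compA -Ey y0 !comp0l.
Qed.

Lemma exact_at_comp0 X Y Z (f : X ~> Y) (g : Y ~> Z) : exact_at f g -> g ∘ f = 0.
Proof. by case=> K [k [e [[gk _] _ ->]]]; rewrite compA gk comp0l. Qed.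

(** Replaces picking a preimage of an element: a generalised element [y] of the kernel comes from
    [X] only after passing to an epimorphic cover of its domain, found by pulling back along the epi
    part of [f]. *)
Lemma exact_at_lift X Y Z (f : X ~> Y) (g : Y ~> Z) U (y : U ~> Y) :
  exact_at f g -> g ∘ y = 0 ->
  exists (V : C) (e : V ~> U) (x : V ~> X), epi e /\ f ∘ x = y ∘ e.
Proof.
case=> K [k [e [gk ee ->]]] /(kernel_lift gk) [z <-].
have [V [e' [x [? E]]]] := epi_pullback z ee.
by exists V, e', x; split=> //; rewrite -!compA E.
Qed.

Lemma exact_at_intro X Y Z (f : X ~> Y) (g : Y ~> Z) : g ∘ f = 0 ->
  (forall U (y : U ~> Y), g ∘ y = 0 ->
     exists (V : C) (e : V ~> U) (x : V ~> X), epi e /\ f ∘ x = y ∘ e) ->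
  exact_at f g.
Proof.
move=> gf H; have [K [k gk]] := has_kernel Cab g.
have [e fe] := kernel_lift gk gf.
exists K, k, e; split=> //.
have [V [v [x [ve E]]]] := H _ k (proj1 gk).
apply: (@epi_left _ _ _ _ e x).
suff -> : e ∘ x = v by [].
by apply: (kernel_mono gk); rewrite compA fe.
Qed.

(** It must be seen that the map [e] from [X] to the kernel [K] of [g] is epi. If [t], with kernel
    [k'], kills [e], the mono [k ∘ k'] is the kernel of some [h]. This [h] kills [f], factors
    through [g], and so kills [k]; hence [k] factors through [k ∘ k'], [k'] has a section and
    [t = 0]. *)
Lemma cokernel_exact X Y Z (f : X ~> Y) (g : Y ~> Z) :
  is_cokernel f g -> exact_at f g.
Proof.
move=> fg; have [K [k gk]] := has_kernel Cab g.
have [e fe] := kernel_lift gk (proj1 fg).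
exists K, k, e; split=> //; apply/epiP => W t te.
have [K' [k' tk']] := has_kernel Cab t.
have [e' ee'] := kernel_lift tk' te.
have km : mono (k ∘ k').
  by move=> V x y; rewrite -!compA => /(kernel_mono gk)/(kernel_mono tk').
have [D [h hk]] := mono_normal Cab km.
have [h' hh'] : exists h', h' ∘ g = h.
  apply: (cokernel_desc fg); rewrite -fe -ee' !compA -(compA h).
  by case: hk => -> _; rewrite comp0l.
have [r Er] : exists r, k ∘ k' ∘ r = k.
  by apply: (kernel_lift hk); rewrite -hh' -compA (proj1 gk) comp0r.
have k'r : k' ∘ r = idm K by apply: (kernel_mono gk); rewrite compA Er comp_idr.
by rewrite -(comp_idr t) -k'r compA (proj1 tk') comp0l.
Qed.

Lemma exact_epi_cokernel X Y Z (f : X ~> Y) (g : Y ~> Z) :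
  exact_at f g -> epi g -> is_cokernel f g.
Proof.
case=> K [k [e [gk ee ->]]] ge; have gc := epi_coker_ker ge gk.
apply: cokernel_intro => //; first by rewrite compA (proj1 gk) comp0l.
move=> W x; rewrite compA => xk; apply: (cokernel_desc gc).
by apply: (iffLR (epiP _) ee).
Qed.

Lemma exact_at0_epi X Y Z (f : X ~> Y) : exact_at f (0 : Y ~> Z) <-> epi f.
Proof.
split=> [[K [k [e [zk ee ->]]]]|fe].
  have [y ky] : exists y, k ∘ y = idm Y by apply: (kernel_lift zk); rewrite comp0l.
  by apply: epi_comp => //; apply: epi_split ky.
exists Y, (idm Y), f; split=> //; last by rewrite comp_idl.
apply: kernel_intro; first by rewrite comp0l.
  exact/iso_mono/iso_id.
by move=> W x _; exists x; rewrite comp_idl.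
Qed.

End Abelian.

Lemma mono_ker_coker (C : preaddcat) (Cab : is_abelian C) (A B Q : C)
    (f : A ~> B) (q : B ~> Q) : mono f -> is_cokernel f q -> is_kernel q f.
Proof. exact: (@epi_coker_ker (opcat C) (abelian_op Cab) Q B A f q). Qed.

(** In the opposite category [cokernel_exact] factors [g] as a cokernel of [k] followed by a mono;
    [q] is another cokernel of [k], so [m] agrees with that mono up to an isomorphism. *)
Lemma coimage_mono (C : preaddcat) (Cab : is_abelian C) (K X Y Q : C)
    (k : K ~> X) (g : X ~> Y) (q : X ~> Q) (m : Q ~> Y) :
  is_kernel g k -> is_cokernel k q -> g = m ∘ q -> mono m.
Proof.
move=> gk kq E.
have [L [k' [e [kk mon E']]]] : exists (L : C) (k' : X ~> L) (e : L ~> Y),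
    [/\ is_cokernel k k', mono e & g = e ∘ k'].
  have := @cokernel_exact (opcat C) (abelian_op Cab) Y X K g k gk.
  by case=> L [k' [e [a b c]]]; exists L, k', e.
have [y Ey] := cokernel_desc kq (proj1 kk).
have [y' Ey'] := cokernel_desc kk (proj1 kq).
have yq : y' ∘ y = idm Q.
  by apply: (cokernel_epi kq); rewrite -compA Ey Ey' comp_idl.
have -> : m = e ∘ y by apply: (cokernel_epi kq); rewrite -E -compA Ey E'.
move=> W u v; rewrite -!compA => /mon /(congr1 (fun t => y' ∘ t)).
by rewrite !compA yq !comp_idl.
Qed.

Lemma dchoice (U : Type) (V : U -> Type) (R : forall x, V x -> Prop) :
  (forall x, exists y, R x y) -> exists f : forall x, V x, forall x, R x (f x).
Proof.
by move=> h; exists (fun x => sval (cid (h x))) => x; exact: svalP (cid (h x)).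
Qed.

(** * Functors and natural isomorphisms *)

Lemma fmapN (C D : preaddcat) (F : functor C D) A B (f : A ~> B) :
  fmap F (- f) = - fmap F f.
Proof. by apply: (addrI (fmap F f)); rewrite -fmapD !subrr fmap0. Qed.

Lemma fmapB (C D : preaddcat) (F : functor C D) A B (f g : A ~> B) :
  fmap F (f - g) = fmap F f - fmap F g.
Proof. by rewrite fmapD fmapN. Qed.

Lemma fmap_iso (C D : preaddcat) (F : functor C D) A B (f : A ~> B) :
  is_iso f -> is_iso (fmap F f).
Proof.
by case=> g [h k]; exists (fmap F g); rewrite -!fmap_comp h k !fmap_id.
Qed.

Lemma fmap_zero (C D : preaddcat) (F : functor C D) Z : is_zero Z -> is_zero (F Z).
Proof. by rewrite /is_zero -fmap_id => ->; rewrite fmap0. Qed.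

Lemma nat_iso_refl (C D : preaddcat) (F : functor C D) : nat_iso F F.
Proof.
by exists (fun A => idm (F A)); split=> *; [exact: iso_id|rewrite comp_idl comp_idr].
Qed.

Lemma nat_iso_sym (C D : preaddcat) (F G : functor C D) : nat_iso F G -> nat_iso G F.
Proof.
case=> a [ai an].
have /dchoice [b Eb] : forall A, exists b : G A ~> F A,
    b ∘ a A = idm _ /\ a A ∘ b = idm _ by move=> A; case: (ai A) => b; exists b.
exists b; split=> [A|A B f]; first by exists (a A); case: (Eb A).
apply: (iso_mono (ai B)); rewrite compA (proj2 (Eb B)) comp_idl.
by rewrite compA an -compA (proj2 (Eb A)) comp_idr.
Qed.

Lemma nat_iso_trans (C D : preaddcat) (F G H : functor C D) :
  nat_iso F G -> nat_iso G H -> nat_iso F H.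
Proof.
move=> [a [ai an]] [b [bi bn]]; exists (fun A => b A ∘ a A); split=> [A|A B f].
  exact: iso_comp.
by rewrite -compA an compA bn compA.
Qed.

Lemma nat_iso_whiskl (C D E : preaddcat) (H : functor D E) (F G : functor C D) :
  nat_iso F G -> nat_iso (H ⊚ F) (H ⊚ G).
Proof.
move=> [a [ai an]]; exists (fun A => fmap H (a A)); split=> [A|A B f].
  exact: (fmap_iso H (ai A)).
by rewrite /= -!fmap_comp an.
Qed.

Lemma nat_iso_whiskr (C D E : preaddcat) (H : functor C D) (F G : functor D E) :
  nat_iso F G -> nat_iso (F ⊚ H) (G ⊚ H).
Proof.
by move=> [a [ai an]]; exists (fun A => a (H A)); split=> *; [exact: ai|exact: an].
Qed.

Lemma right_exact_comp (C D E : preaddcat) (H : functor D E) (F : functor C D) :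
  right_exact H -> right_exact F -> right_exact (H ⊚ F).
Proof. by move=> h f X Y Z u v /f /h. Qed.

Lemma left_exact_comp (C D E : preaddcat) (H : functor D E) (F : functor C D) :
  left_exact H -> left_exact F -> left_exact (H ⊚ F).
Proof. by move=> h f X Y Z u v /f /h. Qed.

Lemma bij_exists (U V : Type) (f : U -> V) (fb : bijective f) (v : V) :
  exists u, f u = v.
Proof. by case: fb => g _ k; exists (g v). Qed.

Lemma automorphism_right_exact (C : preaddcat) (S : functor C C) :
  is_automorphism S -> right_exact S.
Proof.
move=> [So Sm] X Y Z f g fg; split; first by rewrite -fmap_comp (proj1 fg) fmap0.
move=> W x; have [W' ?] := bij_exists So W; subst W.
have [x' <-] := bij_exists (Sm _ _) x.
rewrite -fmap_comp -(fmap0 S) => /(bij_inj (Sm _ _)) /(proj2 fg) [y [Ey yu]].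
exists (fmap S y); split=> [|z]; first by rewrite -fmap_comp Ey.
have [z' <-] := bij_exists (Sm _ _) z.
by rewrite -fmap_comp => /(bij_inj (Sm _ _)) /yu ->.
Qed.

Lemma automorphism_op (C : preaddcat) (S : functor C C) :
  is_automorphism S -> is_automorphism (fop S).
Proof. by move=> [So Sm]; split=> // A B; exact: Sm. Qed.

Lemma automorphism_left_exact (C : preaddcat) (S : functor C C) :
  is_automorphism S -> left_exact S.
Proof.
move=> /automorphism_op /automorphism_right_exact h X Y Z f g fg.
exact: (h Z Y X g f fg).
Qed.

(** [fop F] would start at [opcat (opcat C)], which is not literally [C]; this version makes the
    covariant lemmas directly applicable to contravariant functors. *)
Definition fswap (C D : preaddcat) (F : functor (opcat C) D) : functor C (opcat D) :=
  @Functor C (opcat D) (fob F) (fun A B f => @fmap (opcat C) D F B A f)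
    (fmap_id F) (fun A B E g f => @fmap_comp (opcat C) D F E B A f g)
    (fun A B f g => @fmapD (opcat C) D F B A f g).

Definition funswap (C D : preaddcat) (F : functor C (opcat D)) : functor (opcat C) D :=
  @Functor (opcat C) D (fob F) (fun A B f => @fmap C (opcat D) F B A f)
    (fmap_id F) (fun A B E g f => @fmap_comp C (opcat D) F E B A f g)
    (fun A B f g => @fmapD C (opcat D) F B A f g).

Lemma nat_iso_fswap (C D : preaddcat) (F G : functor (opcat C) D) :
  nat_iso F G <-> nat_iso (fswap F) (fswap G).
Proof.
split=> /nat_iso_sym [a [ai an]]; exists a; split=> A *.
- by case: (ai A) => b [h k]; exists b; split.
- by apply/esym; exact: an.
- by case: (ai A) => b [h k]; exists b; split.
- by apply/esym; exact: an.
Qed.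

Lemma right_exact_fswap (C D : preaddcat) (F : functor (opcat C) D) :
  left_exact F <-> right_exact (fswap F).
Proof. by split=> h X Y Z f g fg; exact: (h Z Y X g f fg). Qed.

(** * Homology and derived functors *)

Section HomologyMaps.
Variable D : preaddcat.

(** One degree of a chain homotopy; such a [b] acts as zero on homology. *)
Definition null_map (U V W U' V' W' : D) (f : U ~> V) (g : V ~> W)
    (f' : U' ~> V') (g' : V' ~> W') (b : V ~> V') :=
  exists (s : V ~> U') (t : W ~> V'), b = f' ∘ s + t ∘ g.

(** One degree of a chain map with its two neighbours, which is enough to act on homology. *)
Definition pair_map (U V W U' V' W' : D) (f : U ~> V) (g : V ~> W)
    (f' : U' ~> V') (g' : V' ~> W') (b : V ~> V') :=
  exists (a : U ~> U') (c : W ~> W'), b ∘ f = f' ∘ a /\ g' ∘ b = c ∘ g.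

Context {U V W H : D} {f : U ~> V} {g : V ~> W} (w : homology f g H).
Context {U' V' W' H' : D} {f' : U' ~> V'} {g' : V' ~> W'} (w' : homology f' g' H').

Lemma homology_map_exists (b : V ~> V') :
  pair_map f g f' g' b -> exists h, homology_map w w' b h.
Proof.
move=> [a [c [bf gb]]].
have [z Ez] : exists z, hinc w' ∘ z = b ∘ hinc w.
  apply: (kernel_lift (hincP w')).
  by rewrite compA gb -compA (proj1 (hincP w)) comp0r.
have [h Eh] : exists h, h ∘ hproj w = hproj w' ∘ z.
  apply: (cokernel_desc (hprojP w)).
  suff E : z ∘ hbd w = hbd w' ∘ a.
    by rewrite -compA E compA (proj1 (hprojP w')) comp0l.
  apply: (kernel_mono (hincP w')).
  by rewrite compA Ez -compA hbdP bf compA hbdP.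
by exists h, z.
Qed.

Lemma homology_map_unique (b b' : V ~> V') h h' :
  null_map f g f' g' (b - b') ->
  homology_map w w' b h -> homology_map w w' b' h' -> h = h'.
Proof.
move=> [s [t E]] [z [Ez Eh]] [z' [Ez' Eh']].
have E2 : z - z' = hbd w' ∘ s ∘ hinc w.
  apply: (kernel_mono (hincP w')).
  rewrite compBr Ez Ez' -compBl E compDl -(compA t) (proj1 (hincP w)) comp0r addr0.
  by rewrite !compA hbdP.
apply: (cokernel_epi (hprojP w)); apply/subr0_eq.
by rewrite Eh Eh' -compBr E2 !compA (proj1 (hprojP w')) !comp0l.
Qed.

End HomologyMaps.

Section HomologyMaps2.
Variable D : preaddcat.

Lemma null_map0 (U V W U' V' W' : D) (f : U ~> V) (g : V ~> W)
    (f' : U' ~> V') (g' : V' ~> W') (b b' : V ~> V') :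
  b = b' -> null_map f g f' g' (b - b').
Proof. by move=> ->; exists 0, 0; rewrite comp0r comp0l addr0 subrr. Qed.

Lemma homology_map_id (U V W H : D) (f : U ~> V) (g : V ~> W)
    (w : homology f g H) : homology_map w w (idm V) (idm H).
Proof. by exists (idm _); rewrite !comp_idl !comp_idr. Qed.

Context {U V W H : D} {f : U ~> V} {g : V ~> W} (w : homology f g H).
Context {U' V' W' H' : D} {f' : U' ~> V'} {g' : V' ~> W'} (w' : homology f' g' H').

Lemma homology_map_comp (U2 V2 W2 H2 : D) (f2 : U2 ~> V2) (g2 : V2 ~> W2)
    (w2 : homology f2 g2 H2) b b' h h' :
  homology_map w' w2 b' h' -> homology_map w w' b h ->
  homology_map w w2 (b' ∘ b) (h' ∘ h).
Proof.
move=> [z' [Ez' Eh']] [z [Ez Eh]]; exists (z' ∘ z); split.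
  by rewrite compA Ez' -compA Ez compA.
by rewrite -compA Eh !compA Eh'.
Qed.

Lemma homology_mapD b b' h h' :
  homology_map w w' b h -> homology_map w w' b' h' ->
  homology_map w w' (b + b') (h + h').
Proof.
move=> [z [Ez Eh]] [z' [Ez' Eh']]; exists (z + z').
by rewrite !compDr !compDl Ez Eh Ez' Eh'.
Qed.

End HomologyMaps2.

Section HomologyMaps3.
Context {D : preaddcat}.
Context {U V W H : D} {f : U ~> V} {g : V ~> W} (w : homology f g H).
Context {U' V' W' H' : D} {f' : U' ~> V'} {g' : V' ~> W'} (w' : homology f' g' H').

Lemma homology_iso (u : V ~> V') (v : V' ~> V) :
  pair_map f g f' g' u -> pair_map f' g' f g v ->
  null_map f g f g (v ∘ u - idm V) -> null_map f' g' f' g' (u ∘ v - idm V') ->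
  exists i, homology_map w w' u i /\ is_iso i.
Proof.
move=> up vp vu uv.
have [i ui] := homology_map_exists w w' up.
have [j vj] := homology_map_exists w' w vp.
exists i; split=> //; exists j; split.
  apply: (homology_map_unique vu (homology_map_comp vj ui)).
  exact: homology_map_id.
apply: (homology_map_unique uv (homology_map_comp ui vj)).
exact: homology_map_id.
Qed.

(** Only the cycles are moved along [b], while the object [H] is kept; so the induced maps in both
    directions are identities, and a given functor can later be reread, unchanged, as the homology
    of another complex. *)
Lemma homology_transport (a : U ~> U') (b : V ~> V') (c : W ~> W') :
  is_iso a -> is_iso b -> is_iso c -> f' ∘ a = b ∘ f -> g' ∘ b = c ∘ g ->
  exists w2 : homology f' g' H, homology_map w w2 b (idm H) /\
    exists b' : V' ~> V, b ∘ b' = idm V' /\ homology_map w2 w b' (idm H).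
Proof.
case=> a' [a1 a2] [b' [b1 b2]] ci Ef Eg.
have k : is_kernel g' (b ∘ hinc w).
  apply: kernel_intro.
  - by rewrite compA Eg -compA (proj1 (hincP w)) comp0r.
  - move=> X x y; rewrite -!compA => E; apply: (kernel_mono (hincP w)).
    by rewrite -(comp_idl (_ ∘ x)) -(comp_idl (_ ∘ y)) -b1 -!compA E.
  - move=> X x gx; have [y Ey] : exists y, hinc w ∘ y = b' ∘ x.
      apply: (kernel_lift (hincP w)); apply: (iso_mono ci).
      by rewrite comp0r !compA -Eg -(compA g') b2 comp_idr.
    by exists y; rewrite -compA Ey compA b2 comp_idl.
have e : b ∘ hinc w ∘ (hbd w ∘ a') = f'.
  by rewrite compA -(compA b) hbdP -Ef -compA a2 comp_idr.
have q : is_cokernel (hbd w ∘ a') (hproj w).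
  apply: cokernel_intro.
  - by rewrite compA (proj1 (hprojP w)) comp0l.
  - exact: (cokernel_epi (hprojP w)).
  - move=> X x; rewrite compA => xa; apply: (cokernel_desc (hprojP w)).
    by rewrite -(comp_idr (x ∘ _)) -a1 compA xa comp0l.
exists (Homology k e q); split; first by exists (idm _); rewrite /= comp_idl !comp_idr.
exists b'; split=> //; exists (idm _).
by rewrite /= compA b1 !comp_idl !comp_idr.
Qed.

End HomologyMaps3.

Lemma homology_exists (D : preaddcat) :
  (forall (A B : D) (f : A ~> B), exists (K : D) (k : K ~> A), is_kernel f k) ->
  (forall (A B : D) (f : A ~> B), exists (Q : D) (q : B ~> Q), is_cokernel f q) ->
  forall (U V W : D) (f : U ~> V) (g : V ~> W), g ∘ f = 0 ->
  exists (H : D) (w : homology f g H), True.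
Proof.
move=> hk hc U V W f g gf.
have [K [k gk]] := hk _ _ g; have [b Eb] := kernel_lift gk gf.
have [H [p bp]] := hc _ _ b.
by exists H, (Homology gk Eb bp).
Qed.

(** [R f b] stands for [b] being one lift of [f] to the complexes. Lifts compose and add but are
    determined only up to null maps, so they form no functor; uniqueness on homology turns them into
    one. *)
Lemma homology_functor (E D : preaddcat) (U V W H : E -> D)
    (p : forall A, U A ~> V A) (q : forall A, V A ~> W A)
    (w : forall A, homology (p A) (q A) (H A))
    (R : forall A B, (A ~> B) -> (V A ~> V B) -> Prop) :
  (forall A B f, exists b, @R A B f b) ->
  (forall A B f b, @R A B f b -> pair_map (p A) (q A) (p B) (q B) b) ->
  (forall A B f b b', @R A B f b -> @R A B f b' ->
     null_map (p A) (q A) (p B) (q B) (b - b')) ->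
  (forall A, R A A (idm A) (idm (V A))) ->
  (forall A B X (g : B ~> X) (f : A ~> B) b' b, R _ _ g b' -> R _ _ f b ->
     R _ _ (g ∘ f) (b' ∘ b)) ->
  (forall A B (f f' : A ~> B) b b', R _ _ f b -> R _ _ f' b' ->
     R _ _ (f + f') (b + b')) ->
  exists L : functor E D, exists w : forall A, homology (p A) (q A) (L A),
    forall A B (f : A ~> B) b, R A B f b -> homology_map (w A) (w B) b (fmap L f).
Proof.
move=> Rex Rpair Rnull Rid Rcomp RD.
have hex : forall A B (f : A ~> B), exists h : H A ~> H B,
    forall b, R A B f b -> homology_map (w A) (w B) b h.
  move=> A B f; have [b Rb] := Rex A B f.
  have [h bh] := homology_map_exists (w A) (w B) (Rpair _ _ _ _ Rb).
  exists h => b' Rb'.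
  have [h' bh'] := homology_map_exists (w A) (w B) (Rpair _ _ _ _ Rb').
  by rewrite (homology_map_unique (Rnull _ _ _ _ _ Rb Rb') bh bh').
pose m A B (f : A ~> B) := sval (cid (hex A B f)).
have mP A B (f : A ~> B) b : R A B f b -> homology_map (w A) (w B) b (m A B f).
  exact: (svalP (cid (hex A B f))).
have mU A B (f : A ~> B) b h : R A B f b -> homology_map (w A) (w B) b h ->
    m A B f = h.
  move=> Rb bh; apply: (homology_map_unique _ (mP _ _ _ _ Rb) bh).
  exact: (Rnull _ _ _ _ _ Rb Rb).
have mid A : m A A (idm A) = idm (H A).
  exact: mU (Rid A) (homology_map_id _).
have mcomp A B X (g : B ~> X) (f : A ~> B) : m A X (g ∘ f) = m B X g ∘ m A B f.
  have [b Rb] := Rex _ _ f; have [b' Rb'] := Rex _ _ g.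
  apply: mU (Rcomp _ _ _ _ _ _ _ Rb' Rb) _.
  by apply: homology_map_comp; exact: mP.
have mD A B (f f' : A ~> B) : m A B (f + f') = m A B f + m A B f'.
  have [b Rb] := Rex _ _ f; have [b' Rb'] := Rex _ _ f'.
  apply: mU (RD _ _ _ _ _ _ Rb Rb') _.
  by apply: homology_mapD; exact: mP.
by exists (@Functor E D H m mid mcomp mD), w.
Qed.

(** * Chain complexes and classes of resolutions *)

Section Complexes.
Variable C : preaddcat.
Implicit Types A B X : C.

Lemma chain_map_over_id A (P : augcx A) :
  chain_map_over (P := P) (Q := P) (idm A) (fun n => idm (P n)).
Proof. by split=> *; rewrite comp_idl comp_idr. Qed.

Lemma chain_map_over_comp A B X (P : augcx A) (Q : augcx B) (S : augcx X)
    (g : B ~> X) (f : A ~> B) (psi : forall n, Q n ~> S n)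
    (phi : forall n, P n ~> Q n) :
  chain_map_over g psi -> chain_map_over f phi ->
  chain_map_over (g ∘ f) (fun n => psi n ∘ phi n).
Proof.
move=> [h k] [h' k']; split=> [n|]; first by rewrite -compA h' !compA h.
by rewrite -compA k' !compA k.
Qed.

Lemma chain_map_overD A B (P : augcx A) (Q : augcx B)
    (f f' : A ~> B) (phi phi' : forall n, P n ~> Q n) :
  chain_map_over f phi -> chain_map_over f' phi' ->
  chain_map_over (f + f') (fun n => phi n + phi' n).
Proof.
move=> [h k] [h' k']; split=> [n|]; first by rewrite compDl compDr h h'.
by rewrite compDl compDr k k'.
Qed.

Lemma cxout_dd A (P : augcx A) n : cxout P n ∘ cxd P n = 0.
Proof. by case: n => [|n] /=; [rewrite comp0l|rewrite cxdd]. Qed.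

Lemma chain_map_cxout A B (P : augcx A) (Q : augcx B) (f : A ~> B)
    (phi : forall n, P n ~> Q n) n :
  chain_map_over f phi ->
  exists c : cxtgt P n ~> cxtgt Q n, cxout Q n ∘ phi n = c ∘ cxout P n.
Proof.
move=> [h k]; case: n => [|n] /=; first by exists 0; rewrite !comp0l.
by exists (phi n); rewrite h.
Qed.

(** All that derived functors need to know of resolutions; it is proved for projective and for
    ideal-projective ones. Homotopies use [cxout], so in degree 0 nothing passes through the
    augmentation. *)
Record res_class (res : forall A : C, augcx A -> Prop) : Prop := ResClass {
  res_exists : forall A, exists P, res A P;
  res_lift : forall A B (P : augcx A) (Q : augcx B), res A P -> res B Q ->
    forall f : A ~> B, exists phi : forall n, P n ~> Q n, chain_map_over f phi;
  res_homotopy : forall A B (P : augcx A) (Q : augcx B), res A P -> res B Q ->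
    forall (f : A ~> B) (phi psi : forall n, P n ~> Q n),
    chain_map_over f phi -> chain_map_over f psi ->
    forall n, null_map (cxd P n) (cxout P n) (cxd Q n) (cxout Q n) (phi n - psi n)
}.

End Complexes.

Section FunctorComplexes.
Variables (C D : preaddcat) (G : functor C D).

Lemma pair_map_fmap (A B : C) (P : augcx A) (Q : augcx B) (f : A ~> B)
    (phi : forall n, P n ~> Q n) n : chain_map_over f phi ->
  pair_map (fmap G (cxd P n)) (fmap G (cxout P n))
           (fmap G (cxd Q n)) (fmap G (cxout Q n)) (fmap G (phi n)).
Proof.
move=> h; have [c Ec] := chain_map_cxout n h.
exists (fmap G (phi n.+1)), (fmap G c).
by rewrite -!fmap_comp (proj1 h) Ec.
Qed.

Lemma null_map_fmap (U V W U' V' W' : C) (f : U ~> V) (g : V ~> W)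
    (f' : U' ~> V') (g' : V' ~> W') (b b' : V ~> V') :
  null_map f g f' g' (b - b') ->
  null_map (fmap G f) (fmap G g) (fmap G f') (fmap G g') (fmap G b - fmap G b').
Proof.
move=> [s [t E]]; exists (fmap G s), (fmap G t).
by rewrite -fmapB E fmapD !fmap_comp.
Qed.

End FunctorComplexes.

Section CofunctorComplexes.
Variables (C D : preaddcat) (G : functor (opcat C) D).

Definition cofmap (A B : C) (f : A ~> B) : G B ~> G A := @fmap (opcat C) D G B A f.

Lemma cofmap_comp (A B X : C) (g : B ~> X) (f : A ~> B) :
  cofmap (g ∘ f) = cofmap f ∘ cofmap g.
Proof. exact: (@fmap_comp (opcat C) D G X B A f g). Qed.

Lemma cofmap_id (A : C) : cofmap (idm A) = idm (G A).
Proof. exact: (@fmap_id (opcat C) D G A). Qed.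

Lemma cofmapD (A B : C) (f f' : A ~> B) : cofmap (f + f') = cofmap f + cofmap f'.
Proof. exact: (@fmapD (opcat C) D G B A f f'). Qed.

Lemma cofmapB (A B : C) (f f' : A ~> B) : cofmap (f - f') = cofmap f - cofmap f'.
Proof. exact: (@fmapB (opcat C) D G B A f f'). Qed.

Lemma pair_map_cofmap (A B : C) (P : augcx A) (Q : augcx B) (f : A ~> B)
    (phi : forall n, P n ~> Q n) n : chain_map_over f phi ->
  pair_map (cofmap (cxout Q n)) (cofmap (cxd Q n))
           (cofmap (cxout P n)) (cofmap (cxd P n)) (cofmap (phi n)).
Proof.
move=> h; have [c Ec] := chain_map_cxout n h.
exists (cofmap c), (cofmap (phi n.+1)).
by rewrite -!cofmap_comp (proj1 h) Ec.
Qed.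

Lemma null_map_cofmap (U V W U' V' W' : C) (f : U ~> V) (g : V ~> W)
    (f' : U' ~> V') (g' : V' ~> W') (b b' : V ~> V') :
  null_map f g f' g' (b - b') ->
  null_map (cofmap g') (cofmap f') (cofmap g) (cofmap f) (cofmap b - cofmap b').
Proof.
move=> [s [t E]]; exists (cofmap t), (cofmap s).
by rewrite -cofmapB E cofmapD !cofmap_comp addrC.
Qed.

End CofunctorComplexes.

Section DerivedExist.
Variables (C D : preaddcat) (res : forall A : C, augcx A -> Prop).
Hypothesis resP : res_class res.
Hypothesis Dk : forall (A B : D) (f : A ~> B), exists (K : D) (k : K ~> A), is_kernel f k.
Hypothesis Dc : forall (A B : D) (f : A ~> B), exists (Q : D) (q : B ~> Q), is_cokernel f q.

Lemma left_derived_exists (G : functor C D) n :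
  exists L : functor C D, is_left_derived res G n L.
Proof.
have [P Pres] := dchoice (res_exists resP).
have /dchoice [H /dchoice [w _]] : forall A, exists (H : D)
    (w : homology (fmap G (cxd (P A) n)) (fmap G (cxout (P A) n)) H), True.
  by move=> A; apply: homology_exists => //; rewrite -fmap_comp cxout_dd fmap0.
pose R A B (f : A ~> B) b := exists phi : forall n, P A n ~> P B n,
  chain_map_over f phi /\ b = fmap G (phi n).
have [| | | | | |L [w' Lw]] := homology_functor w (R := R).
- move=> A B f; have [phi h] := res_lift resP (Pres A) (Pres B) f.
  by exists (fmap G (phi n)), phi.
- by move=> A B f b [phi [h ->]]; apply: pair_map_fmap h.
- move=> A B f b b' [phi [h ->]] [psi [k ->]]; apply: null_map_fmap.
  exact: (res_homotopy resP _ _ h k).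
- by move=> A; exists (fun k => idm _); rewrite fmap_id; split=> //; apply: chain_map_over_id.
- move=> A B X g f b b' [phi [h ->]] [psi [k ->]]; exists (fun k => phi k ∘ psi k).
  by rewrite fmap_comp; split=> //; apply: chain_map_over_comp.
- move=> A B f f' b b' [phi [h ->]] [psi [k ->]]; exists (fun k => phi k + psi k).
  by rewrite fmapD; split=> //; apply: chain_map_overD.
exists L, P; split=> //; exists w' => A B f phi h.
by apply: Lw; exists phi.
Qed.

Lemma right_derived_exists (G : functor (opcat C) D) n :
  exists R : functor (opcat C) D, is_right_derived res G n R.
Proof.
have [P Pres] := dchoice (res_exists resP).
have /dchoice [H /dchoice [w _]] : forall A, exists (H : D)
    (w : cohomology G (P A) n H), True.
  move=> A; apply: homology_exists => //.
  by rewrite -[LHS](cofmap_comp G) cxout_dd; apply: (fmap0 G).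
pose R (A B : opcat C) (f : A ~> B) b := exists phi : forall n, @hom C (P B n) (P A n),
  @chain_map_over C B A (P B) (P A) f phi /\ b = cofmap G (phi n).
have [| | | | | |L [w' Lw]] := @homology_functor (opcat C) D _ _ _ _ _ _ w R.
- move=> A B f; have [phi h] := res_lift resP (Pres B) (Pres A) f.
  by exists (cofmap G (phi n)), phi.
- by move=> A B f b [phi [h ->]]; apply: pair_map_cofmap h.
- move=> A B f b b' [phi [h ->]] [psi [k ->]]; apply: null_map_cofmap.
  exact: (res_homotopy resP _ _ h k).
- move=> A; exists (fun k => idm _); rewrite cofmap_id; split=> //.
  exact: (@chain_map_over_id C).
- move=> A B X g f b b' [phi [h ->]] [psi [k ->]]; exists (fun k => psi k ∘ phi k).
  by rewrite cofmap_comp; split=> //; apply: (@chain_map_over_comp C).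
- move=> A B f f' b b' [phi [h ->]] [psi [k ->]]; exists (fun k => phi k + psi k).
  by rewrite cofmapD; split=> //; apply: (@chain_map_overD C).
exists L, P; split=> //; exists w' => A B f phi h.
by apply: (Lw B A f); exists phi.
Qed.

End DerivedExist.

(** The squares only have to commute up to null maps for some representatives [b1], [b2], since
    naturality is tested on homology. *)
Lemma homology_compare (E D : preaddcat) (L1 L2 : functor E D)
    (U1 V1 W1 U2 V2 W2 : E -> D)
    (p1 : forall A, U1 A ~> V1 A) (q1 : forall A, V1 A ~> W1 A)
    (p2 : forall A, U2 A ~> V2 A) (q2 : forall A, V2 A ~> W2 A)
    (w1 : forall A, homology (p1 A) (q1 A) (L1 A))
    (w2 : forall A, homology (p2 A) (q2 A) (L2 A))
    (u : forall A, V1 A ~> V2 A) (v : forall A, V2 A ~> V1 A) :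
  (forall A, pair_map (p1 A) (q1 A) (p2 A) (q2 A) (u A)) ->
  (forall A, pair_map (p2 A) (q2 A) (p1 A) (q1 A) (v A)) ->
  (forall A, null_map (p1 A) (q1 A) (p1 A) (q1 A) (v A ∘ u A - idm _)) ->
  (forall A, null_map (p2 A) (q2 A) (p2 A) (q2 A) (u A ∘ v A - idm _)) ->
  (forall A B (f : A ~> B), exists b1 b2,
     [/\ homology_map (w1 A) (w1 B) b1 (fmap L1 f),
         homology_map (w2 A) (w2 B) b2 (fmap L2 f) &
         null_map (p1 A) (q1 A) (p2 B) (q2 B) (u B ∘ b1 - b2 ∘ u A)]) ->
  nat_iso L1 L2.
Proof.
move=> up vp vu uv nat.
have /dchoice [i Hi] : forall A, exists i, homology_map (w1 A) (w2 A) (u A) i /\ is_iso i.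
  by move=> A; apply: homology_iso.
exists i; split=> [A|A B f]; first by case: (Hi A).
have [b1 [b2 [h1 h2 n]]] := nat _ _ f.
exact: homology_map_unique n (homology_map_comp (proj1 (Hi B)) h1)
  (homology_map_comp h2 (proj1 (Hi A))).
Qed.

Lemma res_compare (C : preaddcat) (res : forall A : C, augcx A -> Prop) (A : C)
    (P Q : augcx A) : res_class res -> res A P -> res A Q ->
  exists (phi : forall n, P n ~> Q n) (psi : forall n, Q n ~> P n),
  [/\ chain_map_over (idm A) phi, chain_map_over (idm A) psi,
   forall n, null_map (cxd P n) (cxout P n) (cxd P n) (cxout P n)
               (psi n ∘ phi n - idm (P n)) &
   forall n, null_map (cxd Q n) (cxout Q n) (cxd Q n) (cxout Q n)
               (phi n ∘ psi n - idm (Q n))].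
Proof.
move=> rc rP rQ.
have [phi hphi] := res_lift rc rP rQ (idm A).
have [psi hpsi] := res_lift rc rQ rP (idm A).
exists phi, psi; split=> // n.
- have := chain_map_over_comp hpsi hphi; rewrite comp_idl => h.
  exact: (res_homotopy rc rP rP h (chain_map_over_id P)).
- have := chain_map_over_comp hphi hpsi; rewrite comp_idl => h.
  exact: (res_homotopy rc rQ rQ h (chain_map_over_id Q)).
Qed.

(** * Derived functors precomposed with a functor *)

Section DerivedAlong.
Variables (E C D : preaddcat) (res : forall A : C, augcx A -> Prop) (n : nat).
Variable (K : functor E C).
Hypothesis rc : res_class res.

(** [L] is the composite of [K] with the [n]th left derived functor of [G]. *)
Definition left_derived_along (G : functor C D) (L : functor E D) :=
  exists P : forall A : E, augcx (K A), (forall A, res (P A)) /\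
  exists w : forall A, homology (fmap G (cxd (P A) n)) (fmap G (cxout (P A) n)) (L A),
    forall (A B : E) (f : A ~> B), exists phi : forall n, P A n ~> P B n,
      chain_map_over (fmap K f) phi /\
      homology_map (w A) (w B) (fmap G (phi n)) (fmap L f).

(** Both functors are computed from resolutions of the same objects [K A], which [res_compare]
    relates by homotopy equivalences; the two ways around the naturality square lift the same map
    and are therefore homotopic. *)
Lemma left_derived_along_unique (G : functor C D) (L1 L2 : functor E D) :
  left_derived_along G L1 -> left_derived_along G L2 -> nat_iso L1 L2.
Proof.
move=> [P1 [r1 [w1 n1]]] [P2 [r2 [w2 n2]]].
have /dchoice [phi /dchoice [psi H]] := fun A => res_compare rc (r1 A) (r2 A).
apply: (homology_compare (w1 := w1) (w2 := w2) (u := fun A => fmap G (phi A n))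
  (v := fun A => fmap G (psi A n))) => [A|A|A|A|A B f].
- by case: (H A) => h _ _ _; apply: pair_map_fmap h.
- by case: (H A) => _ h _ _; apply: pair_map_fmap h.
- case: (H A) => _ _ h _; rewrite -fmap_comp -fmap_id.
  exact: null_map_fmap (h n).
- case: (H A) => _ _ _ h; rewrite -fmap_comp -fmap_id.
  exact: null_map_fmap (h n).
have [f1 [h1 m1]] := n1 _ _ f; have [f2 [h2 m2]] := n2 _ _ f.
exists (fmap G (f1 n)), (fmap G (f2 n)); split=> //.
rewrite -!fmap_comp; apply: null_map_fmap.
case: (H A) => pA _ _ _; case: (H B) => pB _ _ _.
have := chain_map_over_comp pB h1; rewrite comp_idl => k1.
have := chain_map_over_comp h2 pA; rewrite comp_idr => k2.
exact: (res_homotopy rc (r1 A) (r2 B) k1 k2).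
Qed.

Definition right_derived_along (G : functor (opcat C) D) (R : functor (opcat E) D) :=
  exists P : forall A : E, augcx (K A), (forall A, res (P A)) /\
  exists w : forall A, cohomology G (P A) n (R A),
    forall (A B : E) (f : A ~> B), exists phi : forall n, P A n ~> P B n,
      chain_map_over (fmap K f) phi /\
      homology_map (w B) (w A) (cofmap G (phi n)) (cofmap R f).

Lemma right_derived_along_unique (G : functor (opcat C) D) (R1 R2 : functor (opcat E) D) :
  right_derived_along G R1 -> right_derived_along G R2 -> nat_iso R1 R2.
Proof.
move=> [P1 [r1 [w1 n1]]] [P2 [r2 [w2 n2]]].
have /dchoice [phi /dchoice [psi H]] := fun A => res_compare rc (r1 A) (r2 A).
(* Contravariance reverses the comparison maps: [psi], from the second resolution to the first,
   induces the map from [R1] to [R2]. *)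
apply: (@homology_compare (opcat E) D R1 R2 _ _ _ _ _ _ _ _ _ _ w1 w2
  (fun A => cofmap G (psi A n)) (fun A => cofmap G (phi A n))) => [A|A|A|A|A B f].
- by case: (H A) => _ h _ _; apply: pair_map_cofmap h.
- by case: (H A) => h _ _ _; apply: pair_map_cofmap h.
- case: (H A) => _ _ h _; rewrite -cofmap_comp -cofmap_id.
  exact: null_map_cofmap (h n).
- case: (H A) => _ _ _ h; rewrite -cofmap_comp -cofmap_id.
  exact: null_map_cofmap (h n).
have [f1 [h1 m1]] := n1 _ _ f; have [f2 [h2 m2]] := n2 _ _ f.
exists (cofmap G (f1 n)), (cofmap G (f2 n)); split=> //.
rewrite -!cofmap_comp; apply: null_map_cofmap.
case: (H A) => _ pA _ _; case: (H B) => _ pB _ _.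
have := @chain_map_over_comp _ _ _ _ _ _ _ _ _ _ _ h1 pB; rewrite comp_idr => k1.
have := @chain_map_over_comp _ _ _ _ _ _ _ _ _ _ _ pA h2; rewrite comp_idl => k2.
exact: (res_homotopy rc (r2 B) (r1 A) k1 k2).
Qed.

End DerivedAlong.

(** * Hom complexes and Ext *)

Definition hom2 (C : preaddcat) (A A' B B' : C) (f : A' ~> A) (b : B ~> B') :
    @hom Ab (A ~> B) (A' ~> B') :=
  postcomp A' b ∘ cofmap (cohomfun B) f.

Lemma hom2E (C : preaddcat) (A A' B B' : C) (f : A' ~> A) (b : B ~> B') (x : A ~> B) :
  (hom2 f b : {additive _ -> _}) x = b ∘ x ∘ f.
Proof. exact: (compA b x f). Qed.

Section Hom2.
Variable C : preaddcat.
Implicit Types A B : C.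

Lemma hom2_comp A A' A'' B B' B'' (f : A' ~> A) (f' : A'' ~> A')
    (b : B ~> B') (b' : B' ~> B'') :
  hom2 (f ∘ f') (b' ∘ b) = hom2 f' b' ∘ hom2 f b.
Proof. by apply: addhomP => x; rewrite [RHS]hom2E !hom2E !compA. Qed.

Lemma hom2_id A B : hom2 (idm A) (idm B) = idm ((A ~> B) : Ab).
Proof. by apply: addhomP => x; rewrite hom2E comp_idl comp_idr. Qed.

Lemma cofmap_hom2 A A' B (f : A' ~> A) : cofmap (cohomfun B) f = hom2 f (idm B).
Proof. by apply: addhomP => x; rewrite hom2E comp_idl. Qed.

Lemma hom2Dl A A' B B' (f f' : A' ~> A) (b : B ~> B') :
  hom2 (f + f') b = hom2 f b + hom2 f' b.
Proof. by apply: addhomP => x; rewrite hom2E compDr -!hom2E. Qed.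

Lemma hom2Bl A A' B B' (f f' : A' ~> A) (b : B ~> B') :
  hom2 (f - f') b = hom2 f b - hom2 f' b.
Proof. by apply: (addIr (hom2 f' b)); rewrite -hom2Dl !subrK. Qed.

Lemma pair_map_hom2 A A' (P : augcx A) (Q : augcx A') (a : A' ~> A) (B B' : C)
    (b : B ~> B') (phi : forall n, Q n ~> P n) n : chain_map_over a phi ->
  pair_map (cofmap (cohomfun B) (cxout P n)) (cofmap (cohomfun B) (cxd P n))
           (cofmap (cohomfun B') (cxout Q n)) (cofmap (cohomfun B') (cxd Q n))
           (hom2 (phi n) b).
Proof.
move=> h; have [c Ec] := chain_map_cxout n h.
exists (hom2 c b), (hom2 (phi n.+1) b).
rewrite !cofmap_hom2 -!hom2_comp !comp_idl !comp_idr.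
by rewrite Ec (proj1 h).
Qed.

Lemma null_map_hom2 (U V W U' V' W' : C) (f : U ~> V) (g : V ~> W)
    (f' : U' ~> V') (g' : V' ~> W') (x x' : V ~> V') (B B' : C) (b : B ~> B') :
  null_map f g f' g' (x - x') ->
  null_map (cofmap (cohomfun B) g') (cofmap (cohomfun B) f')
           (cofmap (cohomfun B') g) (cofmap (cohomfun B') f) (hom2 x b - hom2 x' b).
Proof.
move=> [s [t E]]; exists (hom2 t b), (hom2 s b).
rewrite !cofmap_hom2 -!hom2_comp !comp_idl !comp_idr.
by rewrite -hom2Bl E hom2Dl addrC.
Qed.

End Hom2.

Section ExtExists.
Variables (C : preaddcat) (res : forall A : C, augcx A -> Prop).
Hypothesis rc : res_class res.
Hypothesis Abk : forall (A B : Ab) (f : A ~> B), exists (K : Ab) (k : K ~> A), is_kernel f k.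
Hypothesis Abc : forall (A B : Ab) (f : A ~> B), exists (Q : Ab) (q : B ~> Q), is_cokernel f q.

(** [good] asks for one map on cohomology that serves all lifts [phi] of [a]; it exists because
    homotopic lifts act alike, and its uniqueness makes the result functorial in both variables at
    once. *)
Lemma Ext_exists n : exists E : bifunctor C, is_Ext res n E.
Proof.
have [P Pres] := dchoice (res_exists rc).
have /dchoice [H /dchoice [w _]] : forall AB : C * C, exists (H : Ab)
    (w : cohomology (cohomfun AB.2) (P AB.1) n H), True.
  move=> [A B]; apply: (homology_exists Abk Abc).
  by rewrite -[LHS](cofmap_comp (cohomfun B)) cxout_dd; apply: (fmap0 (cohomfun B)).
pose E A B := H (A, B).
pose good A A' B B' (a : A' ~> A) (b : B ~> B') (h : E A B ~> E A' B') :=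
  forall phi : forall n, P A' n ~> P A n, chain_map_over a phi ->
    homology_map (w (A, B)) (w (A', B')) (hom2 (phi n) b) h.
have gex A A' B B' (a : A' ~> A) (b : B ~> B') : exists h, good A A' B B' a b h.
  have [phi hphi] := res_lift rc (Pres A') (Pres A) a.
  have [h bh] := homology_map_exists (w (A, B)) (w (A', B'))
    (pair_map_hom2 b n hphi).
  exists h => psi hpsi.
  have [h' bh'] := homology_map_exists (w (A, B)) (w (A', B'))
    (pair_map_hom2 b n hpsi).
  have k := null_map_hom2 b (res_homotopy rc (Pres A') (Pres A) hphi hpsi n).
  by rewrite (homology_map_unique k bh bh').
have gun A A' B B' (a : A' ~> A) (b : B ~> B') h phi : chain_map_over a phi ->
    homology_map (w (A, B)) (w (A', B')) (hom2 (phi n) b) h ->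
    sval (cid (gex A A' B B' a b)) = h.
  move=> hphi bh; have gh := svalP (cid (gex A A' B B' a b)) phi hphi.
  by apply: homology_map_unique gh bh; apply: null_map0.
pose bm A A' B B' (a : A' ~> A) (b : B ~> B') := sval (cid (gex A A' B B' a b)).
have bm1 A B : bm A A B B (idm A) (idm B) = idm (E A B).
  apply: gun (chain_map_over_id _) _.
  by rewrite hom2_id; apply: homology_map_id.
have bmc A A' A'' B B' B'' (a : A' ~> A) (a' : A'' ~> A') (b : B ~> B')
    (b' : B' ~> B'') : bm A A'' B B'' (a ∘ a') (b' ∘ b) =
    bm A' A'' B' B'' a' b' ∘ bm A A' B B' a b.
  have [phi hphi] := res_lift rc (Pres A') (Pres A) a.
  have [phi' hphi'] := res_lift rc (Pres A'') (Pres A') a'.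
  apply: gun (chain_map_over_comp hphi hphi') _.
  rewrite hom2_comp; apply: homology_map_comp.
    exact: (svalP (cid (gex A' A'' B' B'' a' b'))).
  exact: (svalP (cid (gex A A' B B' a b))).
exists (@Bifunctor C E bm bm1 bmc), P; split=> //.
exists (fun A B => w (A, B)) => A A' B B' a b phi hphi.
exact: (svalP (cid (gex A A' B B' a b))).
Qed.

End ExtExists.

Section ExtAlong.
Variables (E C : preaddcat) (res : forall A : C, augcx A -> Prop) (n : nat).
Variable (K : functor E C).
Hypothesis rc : res_class res.

(** The counterpart of [right_derived_along] for both variables of Ext. Groups and maps are given
    separately, so that a bifunctor on [C] restricted along [K] fits without forming a new bifunctor
    on [E]. *)
Definition Ext_along (X : E -> E -> Ab)
    (bm : forall A A' B B' : E, (A' ~> A) -> (B ~> B') -> (X A B ~> X A' B')) :=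
  exists P : forall A : E, augcx (K A), (forall A, res (P A)) /\
  exists w : forall A B, cohomology (cohomfun (K B)) (P A) n (X A B),
    forall (A A' B B' : E) (a : A' ~> A) (b : B ~> B'),
      exists phi : forall n, P A' n ~> P A n, chain_map_over (fmap K a) phi /\
      homology_map (w A B) (w A' B') (hom2 (phi n) (fmap K b)) (bm _ _ _ _ a b).

Lemma Ext_along_unique X bm X' bm' : @Ext_along X bm -> @Ext_along X' bm' ->
  exists i : forall A B, X A B ~> X' A B, (forall A B, is_iso (i A B)) /\
  forall (A A' B B' : E) (a : A' ~> A) (b : B ~> B'),
    i A' B' ∘ bm _ _ _ _ a b = bm' _ _ _ _ a b ∘ i A B.
Proof.
move=> [P1 [r1 [w1 n1]]] [P2 [r2 [w2 n2]]].
have /dchoice [phi /dchoice [psi H]] := fun A => res_compare rc (r1 A) (r2 A).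
have /dchoice [i Hi] : forall AB : E * E, exists i,
    homology_map (w1 AB.1 AB.2) (w2 AB.1 AB.2)
      (hom2 (psi AB.1 n) (idm (K AB.2))) i /\ is_iso i.
  move=> [A B] /=; case: (H A) => h1 h2 h3 h4.
  apply: (homology_iso _ _ (v := hom2 (phi A n) (idm (K B)))).
  - exact: pair_map_hom2 h2.
  - exact: pair_map_hom2 h1.
  - rewrite -hom2_comp comp_idl -hom2_id.
    exact: null_map_hom2 (h3 n).
  - rewrite -hom2_comp comp_idl -hom2_id.
    exact: null_map_hom2 (h4 n).
exists (fun A B => i (A, B)); split=> [A B|A A' B B' a b].
  by case: (Hi (A, B)).
have [f1 [h1 m1]] := n1 _ _ _ _ a b; have [f2 [h2 m2]] := n2 _ _ _ _ a b.
have l := homology_map_comp (proj1 (Hi (A', B'))) m1.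
have r := homology_map_comp m2 (proj1 (Hi (A, B))).
apply: homology_map_unique l r.
set x := (X in null_map _ _ _ _ (X - _)); set y := (X in null_map _ _ _ _ (_ - X)).
have -> : x = hom2 (f1 n ∘ psi A' n) (fmap K b).
  by rewrite /x -(comp_idl (fmap K b)) hom2_comp comp_idl.
have -> : y = hom2 (psi A n ∘ f2 n) (fmap K b).
  by rewrite /y -[in RHS](comp_idr (fmap K b)) hom2_comp.
apply: null_map_hom2.
case: (H A) => _ pA _ _; case: (H A') => _ pA' _ _.
have := chain_map_over_comp h1 pA'; rewrite comp_idr => k1.
have := chain_map_over_comp pA h2; rewrite comp_idl => k2.
exact: (res_homotopy rc (r2 A') (r1 A) k1 k2).
Qed.

End ExtAlong.

Lemma chain_map_over_fmap (T C : preaddcat) (F : functor T C) (A B : T)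
    (P : augcx A) (Q : augcx B) (f : A ~> B) (phi : forall n, P n ~> Q n) :
  chain_map_over f phi ->
  chain_map_over (P := fmap_cx F P) (Q := fmap_cx F Q) (fmap F f)
    (fun n => fmap F (phi n)).
Proof. by move=> [h k]; split=> [n|]; rewrite /= -!fmap_comp ?h ?k. Qed.

(** [cxtgt] matches on the degree, so for a variable [n] the two targets are not convertible; the
    isomorphism [c] bridges them. *)
Lemma cxout_fmap (T C : preaddcat) (F : functor T C) (A : T) (P : augcx A) n :
  exists c : cxtgt (fmap_cx F P) n ~> F (cxtgt P n),
    is_iso c /\ c ∘ cxout (fmap_cx F P) n = fmap F (cxout P n).
Proof.
case: n => [|n] /=; exists (idm _); split; rewrite ?comp_idl //.
- exact: iso_id.
- by rewrite fmap0.
- exact: iso_id.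
Qed.

(** * Transfer of derived functors along [F] *)

Section Transfer.
Variables (T C D : preaddcat) (F : functor T C).
Variables (resT : forall A : T, augcx A -> Prop) (resC : forall X : C, augcx X -> Prop).
Variables (Pr : T -> Prop) (n : nat).
Hypothesis rT : res_class resT.
Hypothesis rC : res_class resC.
Hypothesis rPr : forall (A : T) (P : augcx A), resT P -> forall k, Pr (P k).
Hypothesis rF : forall (A : T) (P : augcx A), resT P -> resC (fmap_cx F P).

Lemma cxtgt_res (A : T) (P : augcx A) k : resT P -> Pr (cxtgt P k).
Proof. by case: k => [|k] /rPr; apply. Qed.

Lemma left_derived_fcomp (G : functor C D) (L : functor C D) :
  is_left_derived resC G n L -> left_derived_along resC n F G (L ⊚ F).
Proof.
move=> [P [Pres [w nat]]]; exists (fun A => P (F A)); split=> //.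
exists (fun A => w (F A)) => A B f.
by have [phi h] := res_lift rC (Pres (F A)) (Pres (F B)) (fmap F f);
  exists phi; split=> //; apply: nat.
Qed.

Lemma right_derived_fcomp (G : functor (opcat C) D) (R : functor (opcat C) D) :
  is_right_derived resC G n R -> right_derived_along resC n F G (R ⊚ fop F).
Proof.
move=> [P [Pres [w nat]]]; exists (fun A => P (F A)); split=> //.
exists (fun A => w (F A)) => A B f.
by have [phi h] := res_lift rC (Pres (F A)) (Pres (F B)) (fmap F f);
  exists phi; split=> //; apply: nat.
Qed.

(** [F] turns the chosen resolution [P A] into one of [F A], and the natural isomorphism on [Pr]
    identifies the complexes [G P] and [Gb F P] degree by degree. So [L A] itself is the homology of
    the latter, by [homology_transport]. *)
Lemma left_derived_transfer (G : functor T D) (Gb : functor C D) (L : functor T D) :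
  nat_iso (Gb ⊚ F ⊚ femb Pr) (G ⊚ femb Pr) ->
  is_left_derived resT G n L -> left_derived_along resC n F Gb L.
Proof.
move=> /nat_iso_sym [d [di dn]] [P [Pres [w nat]]].
exists (fun A => fmap_cx F (P A)); split=> [A|]; first exact: rF.
pose e A k : G (P A k) ~> Gb (F (P A k)) := d (exist _ (P A k) (rPr (Pres A) k)).
have /dchoice [w2 Hw] : forall A, exists w2 : homology
    (fmap Gb (cxd (fmap_cx F (P A)) n)) (fmap Gb (cxout (fmap_cx F (P A)) n)) (L A),
    homology_map (w A) w2 (e A n) (idm (L A)) /\ exists b',
      e A n ∘ b' = idm _ /\ homology_map w2 (w A) b' (idm (L A)).
  move=> A; have [c [ci Ec]] := cxout_fmap F (P A) n.
  have [c' [c1 c2]] := ci.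
  pose t : G (cxtgt (P A) n) ~> Gb (F (cxtgt (P A) n)) :=
    d (exist _ (cxtgt (P A) n) (cxtgt_res n (Pres A))).
  apply: (homology_transport _ (a := e A n.+1) (c := fmap Gb c' ∘ t)).
  - exact: (di (exist _ _ (rPr (Pres A) n.+1))).
  - exact: (di (exist _ _ (rPr (Pres A) n))).
  - apply: iso_comp; last exact: (di (exist _ _ (cxtgt_res n (Pres A)))).
    by apply: fmap_iso; exists c.
  - have dd := dn (exist _ _ (rPr (Pres A) n.+1)) (exist _ _ (rPr (Pres A) n)).
    by rewrite /= -(dd (cxd (P A) n)).
  - have dd := dn (exist _ _ (rPr (Pres A) n)) (exist _ _ (cxtgt_res n (Pres A))).
    rewrite -compA [X in _ = _ ∘ X](dd (cxout (P A) n)) /= -Ec compA -fmap_comp.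
    by rewrite compA c1 comp_idl.
exists w2 => A B f.
have [phi h] := res_lift rT (Pres A) (Pres B) f.
exists (fun k => fmap F (phi k)); split; first exact: chain_map_over_fmap.
have [_ [b' [eb hb]]] := Hw A; have [h2 _] := Hw B.
have := homology_map_comp h2 (homology_map_comp (nat _ _ _ _ h) hb).
rewrite comp_idl comp_idr compA.
have dd := dn (exist _ _ (rPr (Pres A) n)) (exist _ _ (rPr (Pres B) n)) (phi n).
by rewrite [e B n ∘ _]dd -compA -/(e A n) eb comp_idr.
Qed.

Lemma right_derived_transfer (G : functor (opcat T) D) (Gb : functor (opcat C) D)
    (R : functor (opcat T) D) :
  nat_iso (Gb ⊚ fop F ⊚ fop (femb Pr)) (G ⊚ fop (femb Pr)) ->
  is_right_derived resT G n R -> right_derived_along resC n F Gb R.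
Proof.
move=> /nat_iso_sym [d [di dn]] [P [Pres [w nat]]].
exists (fun A => fmap_cx F (P A)); split=> [A|]; first exact: rF.
pose e A k : G (P A k) ~> Gb (F (P A k)) := d (exist _ (P A k) (rPr (Pres A) k)).
have /dchoice [w2 Hw] : forall A, exists w2 : cohomology Gb (fmap_cx F (P A)) n (R A),
    homology_map (w A) w2 (e A n) (idm (R A)) /\ exists b',
      e A n ∘ b' = idm _ /\ homology_map w2 (w A) b' (idm (R A)).
  move=> A; have [c [ci Ec]] := cxout_fmap F (P A) n.
  pose t : G (cxtgt (P A) n) ~> Gb (F (cxtgt (P A) n)) :=
    d (exist _ (cxtgt (P A) n) (cxtgt_res n (Pres A))).
  apply: (homology_transport _ (a := cofmap Gb c ∘ t) (c := e A n.+1)).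
  - apply: iso_comp; last exact: (di (exist _ _ (cxtgt_res n (Pres A)))).
    by have [c' [c1 c2]] := ci; exists (cofmap Gb c');
      rewrite -!cofmap_comp c1 c2 !cofmap_id.
  - exact: (di (exist _ _ (rPr (Pres A) n))).
  - exact: (di (exist _ _ (rPr (Pres A) n.+1))).
  - have dd := dn (exist _ _ (cxtgt_res n (Pres A))) (exist _ _ (rPr (Pres A) n)).
    by rewrite compA -[LHS]/(cofmap Gb _ ∘ cofmap Gb _ ∘ t) -cofmap_comp Ec
      (dd (cxout (P A) n)).
  - have dd := dn (exist _ _ (rPr (Pres A) n)) (exist _ _ (rPr (Pres A) n.+1)).
    by rewrite [RHS](dd (cxd (P A) n)).
exists w2 => A B f.
have [phi h] := res_lift rT (Pres A) (Pres B) f.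
exists (fun k => fmap F (phi k)); split; first exact: chain_map_over_fmap.
have [_ [b' [eb hb]]] := Hw B; have [h2 _] := Hw A.
have := homology_map_comp h2 (homology_map_comp (nat _ _ _ _ h) hb).
rewrite comp_idl comp_idr compA.
have dd := dn (exist _ _ (rPr (Pres B) n)) (exist _ _ (rPr (Pres A) n)) (phi n).
by rewrite [e A n ∘ _]dd -compA -/(e B n) eb comp_idr.
Qed.

Lemma Ext_fcomp (E : bifunctor C) : is_Ext resC n E ->
  @Ext_along T C resC n F (fun A B => E (F A) (F B))
    (fun A A' B B' a b => bimap E (fmap F a) (fmap F b)).
Proof.
move=> [P [Pres [w nat]]]; exists (fun A => P (F A)); split=> //.
exists (fun A B => w (F A) (F B)) => A A' B B' a b.
by have [phi h] := res_lift rC (Pres (F A')) (Pres (F A)) (fmap F a);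
  exists phi; split=> //; apply: nat.
Qed.

End Transfer.

Lemma Ab_iso (U V : Ab) (f : U ~> V) :
  bijective (f : {additive _ -> _}) -> is_iso f.
Proof.
move=> fb; have [g fg gf] := fb.
have gD : zmod_morphism g.
  move=> x y; apply: (bij_inj fb).
  by rewrite (raddfB (f : {additive _ -> _})) !gf.
exists (HB.pack_for {additive V -> U} g (GRing.isZmodMorphism.Build _ _ _ gD)).
by split; apply: addhomP => x; [exact: fg|exact: gf].
Qed.

Section ExtTransfer.
Variables (T C : preaddcat) (F : functor T C).
Variables (resT : forall A : T, augcx A -> Prop) (resC : forall X : C, augcx X -> Prop).
Variables (Pr : T -> Prop) (n : nat).
Hypothesis rT : res_class resT.
Hypothesis rPr : forall (A : T) (P : augcx A), resT P -> forall k, Pr (P k).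
Hypothesis rF : forall (A : T) (P : augcx A), resT P -> resC (fmap_cx F P).
Hypothesis Fff : forall P B, Pr P -> bijective (fun f : P ~> B => fmap F f).

Lemma fmap_zmod_morphism (A B : T) : zmod_morphism (fun f : A ~> B => fmap F f).
Proof. by move=> x y; exact: fmapB. Qed.

Definition fmapAb (A B : T) : @hom Ab (A ~> B) (F A ~> F B) :=
  HB.pack_for {additive (A ~> B) -> (F A ~> F B)} (fun f : A ~> B => fmap F f)
    (GRing.isZmodMorphism.Build _ _ _ (@fmap_zmod_morphism A B)).

Lemma fmapAb_iso P B : Pr P -> is_iso (fmapAb P B).
Proof. by move=> hP; apply: Ab_iso; exact: Fff. Qed.

Lemma fmapAb_hom2 (A A' B B' : T) (a : A' ~> A) (b : B ~> B') :
  fmapAb A' B' ∘ hom2 a b = hom2 (fmap F a) (fmap F b) ∘ fmapAb A B.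
Proof.
apply: addhomP => x; rewrite [RHS]hom2E -!fmap_comp.
by rewrite -[LHS]/(fmap F _) hom2E.
Qed.

(** The bijections from [T(P, B)] to [C(F P, F B)], for [P] in the resolution, form an isomorphism
    of Hom complexes compatible with both variables; the groups [E A B] thus serve unchanged as
    cohomology of the complex in [C]. *)
Lemma Ext_transfer (E : bifunctor T) : is_Ext resT n E ->
  @Ext_along T C resC n F (fun A B => E A B) (fun A A' B B' a b => bimap E a b).
Proof.
move=> [P [Pres [w nat]]].
exists (fun A => fmap_cx F (P A)); split=> [A|]; first exact: rF.
have /dchoice [w2 Hw] : forall AB : T * T, exists w2 :
      cohomology (cohomfun (F AB.2)) (fmap_cx F (P AB.1)) n (E AB.1 AB.2),
    homology_map (w AB.1 AB.2) w2 (fmapAb (P AB.1 n) AB.2) (idm _) /\ exists b',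
      fmapAb (P AB.1 n) AB.2 ∘ b' = idm _ /\ homology_map w2 (w AB.1 AB.2) b' (idm _).
  move=> [A B]; have [c [ci Ec]] := cxout_fmap F (P A) n.
  apply: (homology_transport _ (c := fmapAb (P A n.+1) B)
    (a := hom2 c (idm (F B)) ∘ fmapAb (cxtgt (P A) n) B)).
  - apply: iso_comp; last exact: (fmapAb_iso _ (cxtgt_res rPr n (Pres A))).
    by have [c' [c1 c2]] := ci; exists (hom2 c' (idm (F B)));
      rewrite -!hom2_comp c1 c2 comp_idl !hom2_id.
  - exact: (fmapAb_iso _ (rPr (Pres A) n)).
  - exact: (fmapAb_iso _ (rPr (Pres A) n.+1)).
  - rewrite -[X in X ∘ _]/(cofmap _ _) -[X in _ = _ ∘ X]/(cofmap _ _) !cofmap_hom2.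
    by rewrite compA -hom2_comp comp_idl Ec fmapAb_hom2 fmap_id.
  - rewrite -[X in X ∘ _]/(cofmap _ _) -[X in _ = _ ∘ X]/(cofmap _ _) !cofmap_hom2.
    by rewrite fmapAb_hom2 fmap_id.
exists (fun A B => w2 (A, B)) => A A' B B' a b.
have [phi h] := res_lift rT (Pres A') (Pres A) a.
exists (fun k => fmap F (phi k)); split; first exact: chain_map_over_fmap.
have [_ [b' [eb hb]]] := Hw (A, B); have [h2 _] := Hw (A', B').
have := homology_map_comp h2 (homology_map_comp (nat _ _ _ _ _ b _ h) hb).
rewrite comp_idl comp_idr compA.
set x := (X in homology_map _ _ X).
suff -> : x = hom2 (fmap F (phi n)) (fmap F b) by [].
by rewrite /x -[X in _ ∘ X ∘ _]/(hom2 (phi n) b) fmapAb_hom2 -compA eb comp_idr.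
Qed.

End ExtTransfer.

(** * Subquotients of abelian groups *)

Record subgroup (M : zmodType) := Subgroup {
  sg_mem :> M -> Prop;
  sg0 : sg_mem 0;
  sgB : forall x y, sg_mem x -> sg_mem y -> sg_mem (x - y)
}.

Section Subgroup.
Variables (M : zmodType) (S : subgroup M).

Lemma sgN x : S x -> S (- x).
Proof. by move=> h; rewrite -sub0r; apply: sgB => //; exact: sg0. Qed.

Lemma sgD x y : S x -> S y -> S (x + y).
Proof. by move=> h k; rewrite -(opprK y); apply: sgB => //; exact: sgN. Qed.

End Subgroup.

(** Elements are the cosets [x + B] with [x] in [Z], kept as predicates so that extensionality gives
    honest equality. Nothing relates [Z] and [B]: the group is [Z] modulo its intersection with [B].
    Taking [B] zero or [Z] full gives subgroups and quotients as types. *)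
Definition subquot (M : zmodType) (Z B : subgroup M) : Type :=
  {c : M -> Prop | exists x, Z x /\ c = (fun y => B (x - y))}.

HB.instance Definition _ M Z B := gen_eqMixin (@subquot M Z B).
HB.instance Definition _ M Z B := gen_choiceMixin (@subquot M Z B).

Section Subquotient.
Variables (M : zmodType) (Z B : subgroup M).

Definition cls x (Zx : Z x) : subquot Z B :=
  exist _ (fun y => B (x - y)) (ex_intro _ x (conj Zx erefl)).

Definition repr (c : subquot Z B) : M := sval (cid (svalP c)).

Lemma repr_mem c : Z (repr c).
Proof. by case: (svalP (cid (svalP c))). Qed.

Lemma cls_eq x y (Zx : Z x) (Zy : Z y) : cls Zx = cls Zy <-> B (x - y).
Proof.
split=> [[/(congr1 (fun c => c y)) ->]|Bxy]; first by rewrite subrr; exact: sg0.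
apply: eq_exist => /=; apply: funext => z; apply: propext; split=> h.
  have -> : y - z = x - z - (x - y) by rewrite opprB [RHS]addrC subrKA.
  exact: sgB.
by rewrite -(subrKA y) ; apply: sgD.
Qed.

Lemma repr_cls x (Zx : Z x) : B (x - repr (cls Zx)).
Proof.
rewrite /repr; case: cid => y /= [_ E].
by rewrite (congr1 (fun c => c y) E) subrr; exact: sg0.
Qed.

Lemma cls_repr c (Zc : Z (repr c)) : cls Zc = c.
Proof.
case: c Zc => p hp Zc; apply: eq_exist; rewrite /repr /=.
by have [_ E] := svalP (cid (svalP (exist _ p hp : subquot Z B))); exact: (esym E).
Qed.

Lemma cls_surj c : exists x (Zx : Z x), c = cls Zx.
Proof. by exists (repr c), (repr_mem c); rewrite cls_repr. Qed.

Definition sq_zero := cls (sg0 Z).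
Definition sq_opp c := cls (sgN (repr_mem c)).
Definition sq_add c d := cls (sgD (repr_mem c) (repr_mem d)).

Lemma sq_addE x y (Zx : Z x) (Zy : Z y) : sq_add (cls Zx) (cls Zy) = cls (sgD Zx Zy).
Proof.
apply/cls_eq; rewrite -opprB; apply: sgN; rewrite opprD addrACA.
by apply: sgD; apply: repr_cls.
Qed.

Lemma sq_oppE x (Zx : Z x) : sq_opp (cls Zx) = cls (sgN Zx).
Proof. by apply/cls_eq; rewrite opprK addrC; apply: repr_cls. Qed.

Lemma sq_addA : associative sq_add.
Proof.
move=> c d e; have [x [Zx ->]] := cls_surj c; have [y [Zy ->]] := cls_surj d.
have [z [Zz ->]] := cls_surj e; rewrite !sq_addE.
by apply/cls_eq; rewrite -[x + y + z]addrA subrr; exact: sg0.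
Qed.

Lemma sq_addC : commutative sq_add.
Proof.
move=> c d; have [x [Zx ->]] := cls_surj c; have [y [Zy ->]] := cls_surj d.
by rewrite !sq_addE; apply/cls_eq; rewrite [y + x]addrC subrr; exact: sg0.
Qed.

Lemma sq_add0 : left_id sq_zero sq_add.
Proof.
move=> c; have [x [Zx ->]] := cls_surj c; rewrite sq_addE.
by apply/cls_eq; rewrite add0r subrr; exact: sg0.
Qed.

Lemma sq_addN : left_inverse sq_zero sq_opp sq_add.
Proof.
move=> c; have [x [Zx ->]] := cls_surj c; rewrite sq_oppE sq_addE.
by apply/cls_eq; rewrite addNr subrr; exact: sg0.
Qed.

HB.instance Definition _ :=
  GRing.isZmodule.Build (subquot Z B) sq_addA sq_addC sq_add0 sq_addN.

Lemma clsD x y (Zx : Z x) (Zy : Z y) (Zxy : Z (x + y)) :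
  cls Zxy = cls Zx + cls Zy.
Proof.
by rewrite -[RHS]/(sq_add _ _) sq_addE; apply/cls_eq; rewrite subrr; exact: sg0.
Qed.

Lemma clsB x y (Zx : Z x) (Zy : Z y) (Zxy : Z (x - y)) :
  cls Zxy = cls Zx - cls Zy.
Proof.
apply: (addIr (cls Zy)); have Zs : Z (x - y + y) by rewrite subrK.
rewrite -[RHS]addrA addNr addr0 -(clsD _ _ Zs).
by apply/cls_eq; rewrite subrK subrr; exact: sg0.
Qed.

Lemma reprB c d : B (repr (c - d) - (repr c - repr d)).
Proof.
apply/(cls_eq (repr_mem (c - d)) (sgB (repr_mem c) (repr_mem d))).
by rewrite cls_repr (clsB (repr_mem c) (repr_mem d)) !cls_repr.
Qed.

Lemma cls_eq0 x (Zx : Z x) : cls Zx = 0 <-> B x.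
Proof. by rewrite -[0]/(cls (sg0 Z)) cls_eq subr0. Qed.

End Subquotient.

Definition full_subgroup (M : zmodType) : subgroup M :=
  @Subgroup M (fun=> True) Logic.I (fun _ _ _ _ => Logic.I).

Definition zero_subgroup (M : zmodType) : subgroup M.
Proof.
refine (@Subgroup M (fun x => x = 0) erefl _).
by move=> x y -> ->; rewrite subrr.
Defined.

Definition mk_additive (U V : zmodType) (f : U -> V) (fB : zmod_morphism f) :
    @hom Ab U V :=
  HB.pack_for {additive U -> V} f (GRing.isZmodMorphism.Build _ _ _ fB).

Lemma Ab_has_kernel (U V : Ab) (f : U ~> V) :
  exists (K : Ab) (k : K ~> U), is_kernel f k.
Proof.
have SB (x y : U) : (f : {additive U -> V}) x = 0 -> (f : {additive U -> V}) y = 0 ->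
    (f : {additive U -> V}) (x - y) = 0.
  by move=> hx hy; rewrite raddfB hx hy subrr.
pose S := @Subgroup U (fun x => (f : {additive U -> V}) x = 0) (raddf0 _) SB.
(* Modulo zero, [repr] is the inclusion of the subgroup [S]. *)
pose K : zmodType := subquot S (zero_subgroup U).
have kB : zmod_morphism (@repr U S (zero_subgroup U) : K -> U).
  by move=> c d; apply/subr0_eq; exact: (@reprB U S (zero_subgroup U) c d).
exists K, (mk_additive kB); apply: kernel_intro.
- by apply: addhomP => c; exact: (repr_mem c).
- move=> X g h E; apply: addhomP => x.
  have /(congr1 (fun t => (t : {additive _ -> _}) x)) /= E' := E.
  rewrite -(cls_repr (repr_mem ((g : {additive _ -> _}) x))).
  rewrite -(cls_repr (repr_mem ((h : {additive _ -> _}) x))).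
  by apply/cls_eq; rewrite /= E' subrr.
move=> X x fx.
have Sx t : S ((x : {additive _ -> _}) t).
  exact: (congr1 (fun t' => (t' : {additive _ -> _}) t) fx).
have yB : zmod_morphism (fun t => cls (zero_subgroup U) (Sx t) : K).
  move=> t t'.
  apply: (etrans _ (clsB (zero_subgroup U) (Sx t) (Sx t') (sgB (Sx t) (Sx t')))).
  by apply/cls_eq; rewrite raddfB; exact: subrr.
exists (mk_additive yB); apply: addhomP => t /=.
by apply/esym/subr0_eq; exact: (repr_cls (zero_subgroup U) (Sx t)).
Qed.

Lemma Ab_has_cokernel (U V : Ab) (f : U ~> V) :
  exists (Q : Ab) (q : V ~> Q), is_cokernel f q.
Proof.
have SB (x y : V) : (exists u, (f : {additive U -> V}) u = x) ->
    (exists v, (f : {additive U -> V}) v = y) ->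
    exists w, (f : {additive U -> V}) w = x - y.
  by move=> [u <-] [v <-]; exists (u - v); rewrite raddfB.
pose S := @Subgroup V (fun y => exists x, (f : {additive U -> V}) x = y)
  (ex_intro _ 0 (raddf0 _)) SB.
pose Q : zmodType := subquot (full_subgroup V) S.
pose p (y : V) : Q := cls S (Logic.I : full_subgroup V y).
have pB : zmod_morphism p.
  by move=> x y; exact: (clsB S (Logic.I : full_subgroup V x) Logic.I Logic.I).
exists Q, (mk_additive pB); apply: cokernel_intro.
- by apply: addhomP => x; apply/cls_eq0; exists x.
- move=> X g h E; apply: addhomP => c.
  have [y [Zy ->]] := cls_surj c.
  have -> : cls S Zy = p y by apply/cls_eq; rewrite subrr; exact: sg0.
  by have /(congr1 (fun t => (t : {additive _ -> _}) y)) := E.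
move=> X x xf.
have x0 z : S z -> (x : {additive _ -> _}) z = 0.
  by move=> [u <-]; exact: (congr1 (fun t => (t : {additive _ -> _}) u) xf).
have yE y (Zy : full_subgroup V y) :
    (x : {additive _ -> _}) (repr (cls S Zy)) = (x : {additive _ -> _}) y.
  by apply/esym/subr0_eq; rewrite -raddfB; apply/x0/repr_cls.
have yB : zmod_morphism (fun c : Q => (x : {additive _ -> _}) (repr c)).
  move=> c d; rewrite -raddfB; apply/subr0_eq; rewrite -raddfB; apply: x0.
  exact: (@reprB V (full_subgroup V) S c d).
by exists (mk_additive yB); apply: addhomP => y; exact: yE.
Qed.

(** * Projective resolutions *)

Lemma projective_lift (C : preaddcat) (P X Y Z : C) (f : X ~> Y) (g : Y ~> Z)
    (y : P ~> Y) :
  projective P -> exact_at f g -> g ∘ y = 0 -> exists x, f ∘ x = y.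
Proof.
move=> hP [K [k [e [gk ee ->]]]] /(kernel_lift gk) [z <-].
by have [x Ex] := hP _ _ e z ee; exists x; rewrite -compA Ex.
Qed.

Section Resolutions.
Variable C : preaddcat.

(** The complex [P] with [A] put in degree [0] and everything else shifted up. *)
Definition axob (A : C) (P : augcx A) n : C := if n is m.+1 then P m else A.

Definition axd (A : C) (P : augcx A) n : axob P n.+1 ~> axob P n :=
  match n with 0 => cxe P | m.+1 => cxd P m end.

Lemma axdd (A : C) (P : augcx A) n : axd P n ∘ axd P n.+1 = 0.
Proof. by case: n => [|n] /=; [exact: cxed|exact: cxdd]. Qed.

Section Compare.
Variables (A B : C) (P : augcx A) (Q : augcx B).
Hypothesis Pproj : forall n, projective (P n).
Hypothesis Qepi : epi (cxe Q).
Hypothesis Qex : forall n, exact_at (axd Q n.+1) (axd Q n).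

Lemma chain_lift (f : A ~> B) : exists phi : forall n, P n ~> Q n, chain_map_over f phi.
Proof.
(* The recursion carries two consecutive components with their commuting square: the square is what
   makes the next lifting problem solvable. It starts from [f] in degree 0 of the shifted
   complexes. *)
pose S n := {ab : (axob P n ~> axob Q n) * (axob P n.+1 ~> axob Q n.+1) |
  ab.1 ∘ axd P n = axd Q n ∘ ab.2}.
have [b Eb] := Pproj (f ∘ cxe P) Qepi.
have step n (s : S n) : exists c, (sval s).2 ∘ axd P n.+1 = axd Q n.+1 ∘ c.
  have [|c Ec] := projective_lift (@Pproj n.+1) (Qex n)
    (y := (sval s).2 ∘ axd P n.+1); last by exists c.
  by rewrite compA -(svalP s) -compA axdd comp0r.
pose nx n (s : S n) : S n.+1 :=
  exist _ ((sval s).2, sval (cid (step n s))) (svalP (cid (step n s))).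
pose st := nat_rect S (exist _ (f, b) (esym Eb)) nx.
exists (fun n => (sval (st n)).2); split=> [n|]; last exact: (svalP (st 0%N)).
exact: (svalP (st n.+1)).
Qed.

Lemma chain_homotopy (chi : forall n, P n ~> Q n) n : chain_map_over 0 chi ->
  null_map (cxd P n) (cxout P n) (cxd Q n) (cxout Q n) (chi n).
Proof.
move=> [ch ch0].
(* Again two consecutive components with their relation; the first one, out of [A], is zero, which
   is consistent because [chi] lies over zero. *)
pose S n := {ab : (axob P n ~> axob Q n.+1) * (axob P n.+1 ~> axob Q n.+2) |
  chi n = axd Q n.+1 ∘ ab.2 + ab.1 ∘ axd P n}.
have [|b Eb] := projective_lift (@Pproj 0%N) (Qex 0%N) (y := chi 0%N).
  by rewrite /= -ch0 comp0l.
have s0 : chi 0%N = axd Q 1 ∘ b + (0 : axob P 0 ~> axob Q 1) ∘ axd P 0.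
  by rewrite comp0l addr0.
have step n' (s : S n') : exists c,
    chi n'.+1 = axd Q n'.+2 ∘ c + (sval s).2 ∘ axd P n'.+1.
  have [|c Ec] := projective_lift (@Pproj n'.+1) (Qex n'.+1)
    (y := chi n'.+1 - (sval s).2 ∘ axd P n'.+1); last first.
    by exists c; rewrite Ec subrK.
  rewrite compBr compA -[axd Q n'.+1 ∘ chi _]/(cxd Q n' ∘ chi n'.+1) -ch.
  have := svalP s; move: (sval s) => [u v] /= ->.
  by rewrite compDl -(compA u) axdd comp0r addr0 subrr.
pose nx n' (s : S n') : S n'.+1 :=
  exist _ ((sval s).2, sval (cid (step n' s))) (svalP (cid (step n' s))).
pose st := nat_rect S (exist _ (0, b) s0) nx.
case: n => [|n].
  by exists b, 0; rewrite comp0l addr0 s0 comp0l addr0.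
by exists (sval (st n.+1)).2, (sval (st n.+1)).1; exact: (svalP (st n.+1)).
Qed.

End Compare.

Lemma projresP (Cab : is_abelian C) (A : C) (P : augcx A) : projres P <->
  [/\ forall n, projective (P n), epi (cxe P) &
      forall n, exact_at (axd P n.+1) (axd P n)].
Proof.
split=> [[h1 h2 h3 [Z [_ h4]]]|[h1 h2 h3]].
  split=> //; first exact: (iffLR (exact_at0_epi _ _) h4).
  by case.
split=> //; [by move=> n; exact: (h3 n.+1)|exact: (h3 0%N)|].
have [Z Z0] := has_zero (abelian_additive Cab).
by exists Z; split=> //; apply/exact_at0_epi.
Qed.

Hypothesis Cab : is_abelian C.
Hypothesis Cproj : enough_projectives C.

Lemma projres_exists (A : C) : exists P : augcx A, projres P.
Proof.
pose arr := {XY : C * C & XY.1 ~> XY.2}.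
pose src (a : arr) := (tag a).1.
have step (a : arr) : exists P : {P : C & P ~> src a},
    projective (tag P) /\ exact_at (tagged P) (tagged a).
  have [K [k gk]] := has_kernel Cab (tagged a).
  have [P [e [hP he]]] := Cproj K.
  by exists (existT (fun P => P ~> src a) P (k ∘ e)); split=> //; exists K, k, e.
pose nx (a : arr) : arr := existT (fun XY : C * C => XY.1 ~> XY.2)
  (tag (sval (cid (step a))), src a) (tagged (sval (cid (step a)))).
have nxP a : projective (src (nx a)) /\ exact_at (tagged (nx a)) (tagged a).
  exact: (svalP (cid (step a))).
(* The zero map on [A] has kernel [A], so the first step covers [A] itself: [st 1] is the
   augmentation and [st n.+2] the differential out of degree [n.+1]. *)
pose st n := iter n nx (existT (fun XY : C * C => XY.1 ~> XY.2) (A, A) 0).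
pose P : augcx A := @Augcx C A (fun n => src (st n.+1)) (fun n => tagged (st n.+2))
  (tagged (st 1%N)) (fun n => exact_at_comp0 (proj2 (nxP (st n.+2))))
  (exact_at_comp0 (proj2 (nxP (st 1%N)))).
exists P; apply/(projresP Cab); split=> [n||n].
- exact: (proj1 (nxP (st n))).
- by have := proj2 (nxP (st 0%N)) => /exact_at0_epi.
- by case: n => [|n]; [exact: (proj2 (nxP (st 1%N)))|exact: (proj2 (nxP (st n.+2)))].
Qed.

Lemma projres_class : res_class (@projres C).
Proof.
split.
- exact: projres_exists.
- move=> A B P Q /(projresP Cab) [h1 _ _] /(projresP Cab) [_ k2 k3] f.
  exact: chain_lift.
- move=> A B P Q /(projresP Cab) [h1 _ _] /(projresP Cab) [_ k2 k3] f phi psi hp hq n.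
  apply: (chain_homotopy h1 k3 (chi := fun n => phi n - psi n)).
  split=> [m|]; first by rewrite compBl compBr (proj1 hp) (proj1 hq).
  by rewrite comp0l compBr -(proj2 hp) -(proj2 hq) subrr.
Qed.

End Resolutions.

(** * Right exact extension from a dense class of projectives *)

(** Intended for [J = F ⊚ femb (ideal_projective I)]: a class of projectives given by a category of
    its own, large enough to present every object. *)
Record dense_projectives (A C : preaddcat) (J : functor A C) : Prop := DenseProjectives {
  dense_ff : forall Q Q' : A, bijective (@fmap A C J Q Q');
  dense_proj : forall Q : A, projective (J Q);
  dense_cover : forall X : C, exists (Q : A) (e : J Q ~> X), epi e
}.

Section Dense.
Variables (A C : preaddcat) (J : functor A C).
Hypothesis Cab : is_abelian C.
Hypothesis dJ : dense_projectives J.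

Lemma dense_inj Q Q' (t t' : Q ~> Q') : fmap J t = fmap J t' -> t = t'.
Proof. exact: bij_inj (dense_ff dJ Q Q') t t'. Qed.

Lemma dense_full Q Q' (x : J Q ~> J Q') : exists t : Q ~> Q', fmap J t = x.
Proof. exact: bij_exists (dense_ff dJ Q Q') x. Qed.

Lemma dense_exact_lift X Y Z (f : X ~> Y) (g : Y ~> Z) Q (y : J Q ~> Y) :
  exact_at f g -> g ∘ y = 0 -> exists x, f ∘ x = y.
Proof. by apply: projective_lift; exact: (dense_proj dJ). Qed.

Lemma dense_epi X Y (f : X ~> Y) :
  (forall Q (y : J Q ~> Y), exists x, f ∘ x = y) -> epi f.
Proof.
move=> h; have [Q [e ee]] := dense_cover dJ Y; have [x Ex] := h _ e.
by apply: (@epi_left _ _ _ _ f x); rewrite Ex.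
Qed.

Lemma dense_mono X Y (f : X ~> Y) :
  (forall Q (x : J Q ~> X), f ∘ x = 0 -> x = 0) -> mono f.
Proof.
move=> h; have [K [k fk]] := has_kernel Cab f; have [Q [e ee]] := dense_cover dJ K.
have k0 : k = 0.
  apply: (iffLR (epiP _) ee); apply: h.
  by rewrite compA (proj1 fk) comp0l.
by apply/monoP => U x /(kernel_lift fk) [y <-]; rewrite k0 comp0l.
Qed.

Lemma dense_exact X Y Z (f : X ~> Y) (g : Y ~> Z) : g ∘ f = 0 ->
  (forall Q (y : J Q ~> Y), g ∘ y = 0 -> exists x, f ∘ x = y) -> exact_at f g.
Proof.
move=> gf h; have [K [k gk]] := has_kernel Cab g.
have [e fe] := kernel_lift gk gf.
exists K, k, e; split=> //; apply: dense_epi => Q y.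
have [|x Ex] := h _ (k ∘ y); first by rewrite compA (proj1 gk) comp0l.
by exists x; apply: (kernel_mono gk); rewrite compA fe.
Qed.

Lemma dense_presentation X : exists (Q1 Q0 : A) (d : Q1 ~> Q0) (e : J Q0 ~> X),
  epi e /\ exact_at (fmap J d) e.
Proof.
have [Q0 [e ee]] := dense_cover dJ X; have [K [k ek]] := has_kernel Cab e.
have [Q1 [c ce]] := dense_cover dJ K; have [d Ed] := dense_full (k ∘ c).
by exists Q1, Q0, d, e; split=> //; exists K, k, c.
Qed.

Lemma enough_projectives_dense : enough_projectives C.
Proof.
by move=> X; have [Q [e ee]] := dense_cover dJ X; exists (J Q), e; split=> //;
  exact: (dense_proj dJ).
Qed.

Section Families.
Variables (D : preaddcat) (g : functor A D).

(** Compatible families indexed by the maps [J Q ~> X]; the universal one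
    exhibits the value at [X] of the left Kan extension of [g] along [J]. *)
Record is_family (X : C) (W : D) (al : forall Q, (J Q ~> X) -> (g Q ~> W)) : Prop :=
  IsFamily {
    fam_nat : forall Q Q' (t : Q' ~> Q) x, al Q' (x ∘ fmap J t) = al Q x ∘ fmap g t;
    famD : forall Q x y, al Q (x + y) = al Q x + al Q y
  }.

Record universal_family (X : C) (W : D) (io : forall Q, (J Q ~> X) -> (g Q ~> W)) :
    Prop := UniversalFamily {
  univ_family : is_family io;
  univ_desc : forall W' (al : forall Q, (J Q ~> X) -> (g Q ~> W')), is_family al ->
    exists u : W ~> W', forall Q x, u ∘ io Q x = al Q x;
  univ_unique : forall W' (u u' : W ~> W'),
    (forall Q x, u ∘ io Q x = u' ∘ io Q x) -> u = u'
}.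

Lemma fam0 X W al Q : @is_family X W al -> al Q 0 = 0.
Proof. by move=> h; apply: (addrI (al Q 0)); rewrite -(famD h) !addr0. Qed.

Lemma famB X W al Q x y : @is_family X W al -> al Q (x - y) = al Q x - al Q y.
Proof. by move=> h; apply: (addIr (al Q y)); rewrite -(famD h) !subrK. Qed.

Section Presentation.
Variables (X : C) (Q1 Q0 : A) (d : Q1 ~> Q0) (e : J Q0 ~> X).
Hypotheses (ee : epi e) (de : exact_at (fmap J d) e).

Lemma presentation_lift Q (x : J Q ~> X) : exists l : Q ~> Q0, e ∘ fmap J l = x.
Proof.
have [y Ey] := dense_proj dJ x ee; have [l El] := dense_full y.
by exists l; rewrite El.
Qed.

(** The value at [x] is [u ∘ fmap g l] for any lift [l] of [x] along [e]; two lifts differ by a map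
    through [d], which [u] kills. As a family is also determined by its value at [e], families on
    [X] are the maps out of the cokernel of [fmap g d], which is how the universal one is found. *)
Lemma presentation_family W (u : g Q0 ~> W) : u ∘ fmap g d = 0 ->
  exists al, @is_family X W al /\ al Q0 e = u.
Proof.
move=> ud.
have key Q (l l' : Q ~> Q0) : e ∘ fmap J l = e ∘ fmap J l' ->
    u ∘ fmap g l = u ∘ fmap g l'.
  move=> E; have [|y Ey] := dense_exact_lift (y := fmap J (l - l')) de.
    by rewrite fmapB compBr E subrr.
  have [t Et] := dense_full y.
  have -> : l = d ∘ t + l'.
    by apply: (addIr (- l')); rewrite addrK; apply: dense_inj; rewrite fmap_comp Et Ey.
  by rewrite fmapD compDr fmap_comp compA ud comp0l add0r.
pose l Q x := sval (cid (@presentation_lift Q x)).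
have lP Q x : e ∘ fmap J (l Q x) = x := svalP (cid (@presentation_lift Q x)).
exists (fun Q x => u ∘ fmap g (l Q x)); split; first split.
- move=> Q Q' t x; rewrite -compA -fmap_comp; apply: key.
  by rewrite fmap_comp compA !lP.
- move=> Q x y; rewrite -compDr -fmapD; apply: key.
  by rewrite fmapD compDr !lP.
rewrite -[RHS]comp_idr -fmap_id; apply: key.
by rewrite lP fmap_id comp_idr.
Qed.

Lemma family_ext W al be : @is_family X W al -> @is_family X W be ->
  al Q0 e = be Q0 e -> forall Q x, al Q x = be Q x.
Proof.
move=> ha hb E Q x; have [l <-] := presentation_lift x.
by rewrite (fam_nat ha) (fam_nat hb) E.
Qed.

Lemma family_comp W W' al (v : W ~> W') : @is_family X W al ->
  @is_family X W' (fun Q x => v ∘ al Q x).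
Proof.
move=> h; split=> *; first by rewrite (fam_nat h) compA.
by rewrite (famD h) compDr.
Qed.

Lemma universal_presentation W io : @is_family X W io ->
  is_cokernel (fmap g d) (io Q0 e) -> universal_family io.
Proof.
move=> hio ck; split=> // [W' al hal|W' u u' E].
  have [|u Eu] := cokernel_desc ck (x := al Q0 e).
    by rewrite -(fam_nat hal) (exact_at_comp0 de) (fam0 _ hal).
  by exists u; apply: family_ext => //; apply: family_comp.
exact: (cokernel_epi ck).
Qed.

End Presentation.

Lemma universal_exists :
  (forall (U V : D) (f : U ~> V), exists (Q : D) (q : V ~> Q), is_cokernel f q) ->
  forall X, exists W io, @universal_family X W io.
Proof.
move=> Dc X; have [Q1 [Q0 [d [e [ee de]]]]] := dense_presentation X.
have [W [q ck]] := Dc _ _ (fmap g d).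
have [io [hio E]] := presentation_family ee de (proj1 ck).
by exists W, io; apply: (universal_presentation ee de) => //; rewrite E.
Qed.

(** [H] computes the Kan extension only at the objects [K X]. The freedom in [K] matters: with [K]
    the identity this is the extension on [C], with [K = J] it is compared with [g], and with
    [K = F] with a functor on [T]. *)
Definition kan_data (E : preaddcat) (K : functor E C) (H : functor E D)
    (io : forall X Q, (J Q ~> K X) -> (g Q ~> H X)) :=
  (forall X, universal_family (io X)) /\
  forall X Y (f : X ~> Y) Q x, fmap H f ∘ io X Q x = io Y Q (fmap K f ∘ x).

Lemma kan_unique (E : preaddcat) (K : functor E C) (H H' : functor E D) io io' :
  @kan_data E K H io -> @kan_data E K H' io' -> nat_iso H H'.
Proof.
move=> [u n] [u' n'].
have /dchoice [a Ea] : forall X, exists a : H X ~> H' X,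
    forall Q x, a ∘ io X Q x = io' X Q x.
  by move=> X; apply: (univ_desc (u X)); exact: (univ_family (u' X)).
have /dchoice [b Eb] : forall X, exists b : H' X ~> H X,
    forall Q x, b ∘ io' X Q x = io X Q x.
  by move=> X; apply: (univ_desc (u' X)); exact: (univ_family (u X)).
exists a; split=> [X|X Y f].
  exists (b X); split.
    by apply: (univ_unique (u X)) => Q x; rewrite -compA Ea Eb comp_idl.
  by apply: (univ_unique (u' X)) => Q x; rewrite -compA Eb Ea comp_idl.
by apply: (univ_unique (u X)) => Q x; rewrite -!compA n !Ea n'.
Qed.

Lemma kan_exists :
  (forall (U V : D) (f : U ~> V), exists (Q : D) (q : V ~> Q), is_cokernel f q) ->
  exists H io, @kan_data C (fid C) H io.
Proof.
move=> Dc; have /dchoice [W /dchoice [io u]] := universal_exists Dc.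
have hf X Y (f : X ~> Y) : exists v : W X ~> W Y,
    forall Q x, v ∘ io X Q x = io Y Q (f ∘ x).
  apply: (univ_desc (u X)); have h := univ_family (u Y).
  split=> *; first by rewrite compA (fam_nat h).
  by rewrite compDr (famD h).
pose m X Y f := sval (cid (hf X Y f)).
have mP X Y f Q x : m X Y f ∘ io X Q x = io Y Q (f ∘ x).
  exact: (svalP (cid (hf X Y f))).
have m1 X : m X X (idm X) = idm (W X).
  by apply: (univ_unique (u X)) => Q x; rewrite mP !comp_idl.
have mc X Y Z (g' : Y ~> Z) (f : X ~> Y) : m X Z (g' ∘ f) = m Y Z g' ∘ m X Y f.
  by apply: (univ_unique (u X)) => Q x; rewrite -compA !mP compA.
have mD X Y (f f' : X ~> Y) : m X Y (f + f') = m X Y f + m X Y f'.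
  apply: (univ_unique (u X)) => Q x.
  by rewrite compDl !mP compDl (famD (univ_family (u Y))).
by exists (@Functor C D W m m1 mc mD), io.
Qed.

(** Maps out of [H Z] are families on [Z]. Given [a] killing [H f], send [z] to the value of [a] at
    a lift of [z] along [h], available because [J Q] is projective; two lifts differ by a map
    through [f], so the choice is harmless. *)
Lemma kan_right_exact H io : @kan_data C (fid C) H io -> right_exact H.
Proof.
move=> [u n] X Y Z f h fh.
have he := cokernel_epi fh; have ex := cokernel_exact Cab fh.
apply: cokernel_intro.
- by rewrite -fmap_comp (proj1 fh) fmap0.
- move=> W a b E; apply: (univ_unique (u Z)) => Q z.
  have [y Ey] := dense_proj dJ z he; rewrite -Ey.
  by rewrite -[h ∘ y]/(fmap (fid C) h ∘ y) -n !compA E.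
move=> W a af.
have lift Q (z : J Q ~> Z) : exists y, h ∘ y = z by apply: (dense_proj dJ).
pose l Q z := sval (cid (lift Q z)).
have lP Q z : h ∘ l Q z = z := svalP (cid (lift Q z)).
have key Q (y y' : J Q ~> Y) : h ∘ y = h ∘ y' -> a ∘ io Y Q y = a ∘ io Y Q y'.
  move=> E; have [|x Ex] := dense_exact_lift (y := y - y') ex.
    by rewrite compBr E subrr.
  apply/subr0_eq; rewrite -compBr -(famB _ _ (univ_family (u Y))) -Ex.
  by rewrite -[f ∘ x]/(fmap (fid C) f ∘ x) -n compA af comp0l.
have uY := univ_family (u Y).
have [|b Eb] := univ_desc (u Z) (al := fun Q z => a ∘ io Y Q (l Q z)).
  split=> [Q Q' t z|Q z z'].
    by rewrite -compA -(fam_nat uY); apply: key; rewrite compA !lP.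
  by rewrite -compDr -(famD uY); apply: key; rewrite compDr !lP.
exists b; apply: (univ_unique (u Y)) => Q y.
by rewrite -compA n Eb; apply: key; rewrite lP.
Qed.

(** At an object [J Q] a family is determined by its value at the identity, as in the Yoneda lemma,
    so [g Q] already carries the universal family. *)
Lemma kan_restrict H io : @kan_data C (fid C) H io -> nat_iso (H ⊚ J) g.
Proof.
move=> [u n].
have fullJ Q Q' (x : J Q' ~> J Q) : exists t, fmap J t = x := dense_full x.
pose t Q Q' x := sval (cid (fullJ Q Q' x)).
have tP Q Q' x : fmap J (t Q Q' x) = x := svalP (cid (fullJ Q Q' x)).
have tE Q Q' (s : Q' ~> Q) : t Q Q' (fmap J s) = s by apply: dense_inj; rewrite tP.
apply: (@kan_unique A J (H ⊚ J) g (fun Q => io (J Q)) (fun Q Q' x => fmap g (t Q Q' x))).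
  by split=> [Q|Q Q' f S x]; [exact: u|exact: n].
split=> [Q|Q Q' f S x]; last first.
  by rewrite -fmap_comp; congr (fmap g _); apply: dense_inj; rewrite fmap_comp !tP.
split.
- split=> [S S' s x|S x y].
    by rewrite -fmap_comp; congr (fmap g _); apply: dense_inj; rewrite fmap_comp !tP.
  by rewrite -fmapD; congr (fmap g _); apply: dense_inj; rewrite fmapD !tP.
- move=> W al hal; exists (al Q (idm _)) => S x.
  by rewrite -(fam_nat hal) tP comp_idl.
- move=> W a b /(_ Q (idm _)).
  by rewrite -(fmap_id J) tE fmap_id !comp_idr.
Qed.

(** Right exactness makes [H X] a cokernel of [fmap g d] for a presentation [d] of [X], which is
    what universality asks. Uniqueness of right exact extensions thereby reduces to that of Kan
    extensions. *)
Lemma right_exact_kan (H : functor C D) : right_exact H -> nat_iso (H ⊚ J) g ->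
  exists io, @kan_data C (fid C) H io.
Proof.
move=> Hr /nat_iso_sym [a [ai an]].
exists (fun X Q x => fmap H x ∘ a Q); split=> [X|X Y f Q x]; last first.
  by rewrite compA -fmap_comp.
have [Q1 [Q0 [d [e [ee de]]]]] := dense_presentation X.
apply: (universal_presentation ee de).
  split=> [Q Q' t x|Q x y]; last by rewrite fmapD compDl.
  by rewrite fmap_comp -!compA -an.
have ck := Hr _ _ _ _ _ (exact_epi_cokernel Cab de ee).
apply: cokernel_intro.
- rewrite -compA [X in _ ∘ X]an compA.
  rewrite -[X in X ∘ _]/(fmap H e ∘ fmap H (fmap J d) ) -fmap_comp.
  by rewrite (exact_at_comp0 de) fmap0 comp0l.
- by apply: epi_comp; [exact: (cokernel_epi ck)|exact/iso_epi/ai].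
move=> W x xd; have [b [b1 b2]] := ai Q0; have [c [c1 c2]] := ai Q1.
have [|y Ey] := cokernel_desc ck (x := x ∘ b).
  rewrite -(comp_idr (_ ∘ fmap H _)) -c2 compA -(compA _ (fmap H _)).
  rewrite -[X in _ ∘ X ∘ _]an compA -(compA x) b1 comp_idr.
  by rewrite xd comp0l.
by exists y; rewrite compA Ey -compA b1 comp_idr.
Qed.

Lemma right_exact_unique (H H' : functor C D) : right_exact H -> right_exact H' ->
  nat_iso (H ⊚ J) g -> nat_iso (H' ⊚ J) g -> nat_iso H H'.
Proof.
move=> r r' h h'; have [io k] := right_exact_kan r h.
have [io' k'] := right_exact_kan r' h'.
exact: kan_unique k k'.
Qed.

Lemma right_exact_extension :
  (forall (U V : D) (f : U ~> V), exists (Q : D) (q : V ~> Q), is_cokernel f q) ->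
  exists H, right_exact H /\ nat_iso (H ⊚ J) g.
Proof.
move=> Dc; have [H [io k]] := kan_exists Dc.
by exists H; split; [exact: kan_right_exact k|exact: kan_restrict k].
Qed.

End Families.
End Dense.

Lemma exact_at_iso (C : preaddcat) (X Y Z X' Y' Z' : C) (f : X ~> Y) (g : Y ~> Z)
    (f' : X' ~> Y') (g' : Y' ~> Z') (a : X ~> X') (b : Y ~> Y') (c : Z ~> Z') :
  is_iso a -> is_iso b -> is_iso c -> b ∘ f = f' ∘ a -> c ∘ g = g' ∘ b ->
  exact_at f g -> exact_at f' g'.
Proof.
move=> [a' [a1 a2]] [b' [b1 b2]] ci Ef Eg [K [k [e [gk ee E]]]].
exists K, (b ∘ k), (e ∘ a'); split.
- apply: kernel_intro.
  + by rewrite compA -Eg -compA (proj1 gk) comp0r.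
  + move=> U x y; rewrite -!compA => /(congr1 (fun t => b' ∘ t)).
    by rewrite !(compA b') b1 !comp_idl => /(kernel_mono gk).
  move=> U x gx; have [|y Ey] := kernel_lift (x := b' ∘ x) gk.
    apply: (iso_mono ci).
    by rewrite comp0r !compA Eg -(compA g') b2 comp_idr.
  by exists y; rewrite -compA Ey compA b2 comp_idl.
- by apply: epi_comp => //; apply/iso_epi; exists a.
by rewrite compA -(compA b) -E Ef -compA a2 comp_idr.
Qed.

(** * Exactness of a right exact extension *)

Section DenseExact.
Variables (A C D : preaddcat) (J : functor A C) (H : functor C D).
Hypothesis Cab : is_abelian C.
Hypothesis Dab : is_abelian D.
Hypothesis dJ : dense_projectives J.
Hypothesis Hr : right_exact H.
Hypothesis HJ : forall (Q2 Q1 Q0 : A) (a : Q2 ~> Q1) (b : Q1 ~> Q0),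
  exact_at (fmap J a) (fmap J b) -> exact_at (fmap H (fmap J a)) (fmap H (fmap J b)).

(** For epi [c] this is the vanishing of the first left derived functor of [H] at [Z]. Composing a
    presentation of [K] with [k] gives an exact pair between objects [J Q], which [H] respects; a
    [w] killed by [H k] lifts locally to [H (J Q1)], comes there from [H (J Q2)], and so dies in
    [H K]. *)
Lemma syzygy_mono Q Z K (c : J Q ~> Z) (k : K ~> J Q) : is_kernel c k ->
  mono (fmap H k).
Proof.
move=> ck; have [Q2 [Q1 [b2 [c1 [ce ex]]]]] := dense_presentation Cab dJ K.
have [b1 Eb1] := dense_full dJ (k ∘ c1).
have ex1 : exact_at (fmap J b2) (fmap J b1).
  case: ex => L [l [e [lk ee E]]]; exists L, l, e; split=> //.
  rewrite Eb1; apply: kernel_intro; last first.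
  - move=> U x; rewrite -compA => kx; apply: (kernel_lift lk).
    by apply: (kernel_mono ck); rewrite kx comp0r.
  - exact: (kernel_mono lk).
  - by rewrite -compA (proj1 lk) comp0r.
apply/monoP => U w kw.
have ckH := Hr (exact_epi_cokernel Cab ex ce).
have [V [e [v [ee Ev]]]] := epi_pullback Dab w (cokernel_epi ckH).
have [|V' [e' [v' [ee' Ev']]]] := exact_at_lift Dab (y := v) (HJ ex1).
  by rewrite Eb1 fmap_comp -compA Ev compA kw comp0l.
have E : w ∘ (e ∘ e') = 0.
  by rewrite compA -Ev -compA -Ev' compA (proj1 ckH) comp0l.
by apply: (iffLR (epiP _) (epi_comp ee ee')).
Qed.

(** The connecting argument of the long exact sequence. With [K] the kernel of a cover [J Q] of the
    cokernel [Z] of [m], the object [Y] is the pushout of [X] and [J Q] over [K]. Right exactness of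
    [H] preserves this description, and [syzygy_mono] controls the component in [J Q]. *)
Lemma right_exact_mono X Y (m : X ~> Y) : mono m -> mono (fmap H m).
Proof.
move=> mm; have [Z [g mg]] := has_cokernel Cab m.
have gm := mono_ker_coker Cab mm mg; have ge := cokernel_epi mg.
have [Q [c ce]] := dense_cover dJ Z; have [l El] := dense_proj dJ c ge.
have [K [k ck]] := has_kernel Cab c.
have [|a Ea] := kernel_lift (x := l ∘ k) gm.
  by rewrite compA El (proj1 ck).
have [S [i1 [i2 [p1 [p2 [h11 h22 h12 h21 hs]]]]]] := biprod Cab X (J Q).
pose u := i1 ∘ a - i2 ∘ k; pose v := m ∘ p1 + l ∘ p2.
have pu1 : p1 ∘ u = a by rewrite compBr !compA h11 h12 comp0l comp_idl subr0.
have pu2 : p2 ∘ u = - k by rewrite compBr !compA h21 h22 comp0l comp_idl sub0r.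
have vi1 : v ∘ i1 = m by rewrite compDl -!compA h11 h21 comp0r comp_idr addr0.
have vi2 : v ∘ i2 = l by rewrite compDl -!compA h12 h22 comp0r comp_idr add0r.
have vu : v ∘ u = 0 by rewrite compDl -!compA pu1 pu2 compNr Ea subrr.
have ve : epi v.
  apply: (dense_epi dJ) => P y.
  have [b Eb] := dense_proj dJ (g ∘ y) ce.
  have [|x Ex] := kernel_lift (x := y - l ∘ b) gm.
    by rewrite compBr compA El Eb subrr.
  exists (i1 ∘ x + i2 ∘ b).
  by rewrite compDr !compA vi1 vi2 Ex subrK.
have uv : exact_at u v.
  apply: (dense_exact Cab dJ) => // P s vs.
  have E0 : m ∘ (p1 ∘ s) + l ∘ (p2 ∘ s) = 0 by rewrite !compA -compDl.
  have [|t Et] := kernel_lift (x := p2 ∘ s) ck.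
    have /(congr1 (fun t => g ∘ t)) := E0.
    by rewrite compDr !compA El (proj1 gm) !comp0l add0r comp0r.
  have Ep1 : p1 ∘ s = - (a ∘ t).
    apply: mm; rewrite compNr (compA m a) Ea -(compA l) Et; apply/eqP.
    by rewrite -addr_eq0 E0.
  exists (- t); rewrite -[RHS]comp_idl -hs compDl -!compA Ep1 -Et !compNr.
  by rewrite compBl -!compA opprB addrC.
have ckH := Hr (exact_epi_cokernel Cab uv ve).
apply/monoP => U w mw.
have exH := cokernel_exact Dab ckH.
have [|V [e [x [ee Ex]]]] := exact_at_lift Dab (y := fmap H i1 ∘ w) exH.
  by rewrite compA -fmap_comp vi1.
(* [fmap H i1 ∘ w] has no component in [J Q], so [H k] kills [x]. *)
have x0 : x = 0.
  apply: (syzygy_mono ck); rewrite comp0r.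
  have /(congr1 (fun t => fmap H p2 ∘ t)) := Ex.
  rewrite !compA -!fmap_comp pu2 h21 fmap0 !comp0l fmapN compNl.
  by move=> /eqP; rewrite oppr_eq0 => /eqP.
apply: (iffLR (epiP _) ee).
have /(congr1 (fun t => fmap H p1 ∘ t)) := Ex.
by rewrite x0 !comp0r !compA -!fmap_comp h11 fmap_id comp_idl.
Qed.

(** The mono [m] from the cokernel [q] of [f] to [Z] stays mono under [H], so [H g] and [H q] have
    the same kernel; that of [H q] is [H f], a mono with cokernel [H q]. *)
Lemma right_exact_exact : exact_functor H.
Proof.
split=> // X Y Z f g gf.
have fm := kernel_mono gf.
have [W [q fq]] := has_cokernel Cab f.
have [m Em] := cokernel_desc fq (proj1 gf).
have mm := coimage_mono Cab gf fq (esym Em).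
have kH := mono_ker_coker Dab (right_exact_mono fm) (Hr fq).
apply: kernel_intro.
- by rewrite -fmap_comp (proj1 gf) fmap0.
- exact: (kernel_mono kH).
move=> U x; rewrite -Em fmap_comp -compA => h; apply: (kernel_lift kH).
by apply: (right_exact_mono mm); rewrite h comp0r.
Qed.

End DenseExact.

(** * The category of coherent functors *)

Lemma bij_of_inj_surj (U V : Type) (f : U -> V) :
  injective f -> (forall v, exists u, f u = v) -> bijective f.
Proof.
move=> fi /dchoice [g gf]; exists g => // u.
by apply: fi; rewrite gf.
Qed.

Section Freyd.
Variable A : preaddcat.
Hypothesis Aadd : is_additive A.
Hypothesis Awk : forall (X Y : A) (f : X ~> Y), exists (K : A) (k : K ~> X),
  f ∘ k = 0 /\ forall W (x : W ~> X), f ∘ x = 0 -> exists t, k ∘ t = x.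

(** An arrow [arr1 -> arr0] stands for the cokernel of the map
    [A(-, arr1) -> A(-, arr0)] of representable functors. *)
Record arrow := Arrow { arr1 : A; arr0 : A; arr : arr1 ~> arr0 }.

Implicit Types X Y Z : arrow.

(** By Yoneda, a map between the cokernels is induced by an [f] on the targets that carries
    relations to relations; two of them agree when they differ by a map into relations, which is
    [fnull]. *)
Definition frel X Y (f : arr0 X ~> arr0 Y) := exists f1, f ∘ arr X = arr Y ∘ f1.
Definition fnull X Y (f : arr0 X ~> arr0 Y) := exists s, f = arr Y ∘ s.

Definition frel_subgroup X Y : subgroup (arr0 X ~> arr0 Y).
Proof.
refine (@Subgroup _ (@frel X Y) _ _); first by exists 0; rewrite comp0l comp0r.
by move=> f g [f1 E] [g1 E']; exists (f1 - g1); rewrite compBl compBr E E'.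
Defined.

Definition fnull_subgroup X Y : subgroup (arr0 X ~> arr0 Y).
Proof.
refine (@Subgroup _ (@fnull X Y) _ _); first by exists 0; rewrite comp0r.
by move=> f g [f1 E] [g1 E']; exists (f1 - g1); rewrite compBr E E'.
Defined.

Definition fhom X Y : zmodType := subquot (frel_subgroup X Y) (fnull_subgroup X Y).

Definition fcls X Y (f : arr0 X ~> arr0 Y) (hf : frel f) : fhom X Y :=
  @cls _ (frel_subgroup X Y) (fnull_subgroup X Y) f hf.

Lemma fcls_eq X Y f f' hf hf' :
  @fcls X Y f hf = @fcls X Y f' hf' <-> exists s, f - f' = arr Y ∘ s.
Proof. exact: cls_eq. Qed.

Lemma fcls_eq0 X Y f hf : @fcls X Y f hf = 0 <-> exists s, f = arr Y ∘ s.
Proof. exact: cls_eq0. Qed.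

Lemma fcls_surj X Y (f : fhom X Y) : exists f0 hf, f = @fcls X Y f0 hf.
Proof. by have [x [h E]] := cls_surj f; exists x, h. Qed.

Lemma fclsD X Y (f f' : arr0 X ~> arr0 Y) (hf : frel f) (hf' : frel f') (h : frel (f + f')) :
  @fcls X Y (f + f') h = fcls hf + fcls hf'.
Proof. exact: clsD. Qed.

Lemma fcls_congr X Y f f' hf hf' : f = f' -> @fcls X Y f hf = @fcls X Y f' hf'.
Proof. by move=> E; apply/fcls_eq; exists 0; rewrite E subrr comp0r. Qed.

Lemma frel_id X : frel (X := X) (Y := X) (idm _).
Proof. by exists (idm _); rewrite comp_idl comp_idr. Qed.

Lemma frel_comp X Y Z (g : arr0 Y ~> arr0 Z) (f : arr0 X ~> arr0 Y) :
  frel g -> frel f -> frel (g ∘ f).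
Proof.
move=> [g1 Eg] [f1 Ef]; exists (g1 ∘ f1).
by rewrite -compA Ef compA Eg compA.
Qed.

Definition fid0 X : fhom X X := fcls (frel_id X).

Definition fcomp0 X Y Z (g : fhom Y Z) (f : fhom X Y) : fhom X Z :=
  fcls (frel_comp (repr_mem g) (repr_mem f)).

Lemma fcomp0E X Y Z g f hg hf h :
  fcomp0 (@fcls Y Z g hg) (@fcls X Y f hf) = @fcls X Z (g ∘ f) h.
Proof.
apply/fcls_eq.
have [s Es] : fnull (g - repr (fcls hg)) :=
    @repr_cls _ (frel_subgroup Y Z) (fnull_subgroup Y Z) _ hg.
have [t Et] : fnull (f - repr (fcls hf)) :=
    @repr_cls _ (frel_subgroup X Y) (fnull_subgroup X Y) _ hf.
have [g1 Eg1] : frel (repr (fcls hg)) := repr_mem (fcls hg).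
set g' := repr _ in Es Eg1 *; set f' := repr _ in Et *.
exists (- (s ∘ f + g1 ∘ t)).
rewrite compNr compDr !compA -Es -Eg1 -(compA g') -Et compBl compBr.
by rewrite -opprB addrC subrKA addrC.
Qed.

Lemma fcomp0_idl X Y (f : fhom X Y) : fcomp0 (fid0 Y) f = f.
Proof.
have [f0 [hf ->]] := fcls_surj f.
rewrite (fcomp0E _ _ (frel_comp (frel_id Y) hf)).
by apply: fcls_congr; rewrite comp_idl.
Qed.

Lemma fcomp0_idr X Y (f : fhom X Y) : fcomp0 f (fid0 X) = f.
Proof.
have [f0 [hf ->]] := fcls_surj f.
rewrite (fcomp0E _ _ (frel_comp hf (frel_id X))).
by apply: fcls_congr; rewrite comp_idr.
Qed.

Lemma fcomp0A X Y Z W (h : fhom Z W) (g : fhom Y Z) (f : fhom X Y) :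
  fcomp0 h (fcomp0 g f) = fcomp0 (fcomp0 h g) f.
Proof.
have [f0 [hf ->]] := fcls_surj f; have [g0 [hg ->]] := fcls_surj g.
have [h0 [hh ->]] := fcls_surj h.
have gf := frel_comp hg hf; have hg' := frel_comp hh hg.
rewrite (fcomp0E _ _ gf) (fcomp0E _ _ hg') (fcomp0E _ _ (frel_comp hh gf)).
rewrite (fcomp0E _ _ (frel_comp hg' hf)).
by apply: fcls_congr; rewrite compA.
Qed.

Lemma fcomp0Dl X Y Z (g g' : fhom Y Z) (f : fhom X Y) :
  fcomp0 (g + g') f = fcomp0 g f + fcomp0 g' f.
Proof.
have [f0 [hf ->]] := fcls_surj f; have [g0 [hg ->]] := fcls_surj g.
have [g1 [hg' ->]] := fcls_surj g'.
have s : frel (X := Y) (Y := Z) (g0 + g1) := sgD (S := frel_subgroup Y Z) hg hg'.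
have c := frel_comp hg hf; have c' := frel_comp hg' hf.
have c2 : frel (X := X) (Y := Z) (g0 ∘ f0 + g1 ∘ f0) :=
  sgD (S := frel_subgroup X Z) c c'.
rewrite -(fclsD _ _ s) (fcomp0E _ _ (frel_comp s hf)) (fcomp0E _ _ c) (fcomp0E _ _ c').
by rewrite -(fclsD _ _ c2); apply: fcls_congr; rewrite compDl.
Qed.

Lemma fcomp0Dr X Y Z (g : fhom Y Z) (f f' : fhom X Y) :
  fcomp0 g (f + f') = fcomp0 g f + fcomp0 g f'.
Proof.
have [f0 [hf ->]] := fcls_surj f; have [g0 [hg ->]] := fcls_surj g.
have [f1 [hf' ->]] := fcls_surj f'.
have s : frel (X := X) (Y := Y) (f0 + f1) := sgD (S := frel_subgroup X Y) hf hf'.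
have c := frel_comp hg hf; have c' := frel_comp hg hf'.
have c2 : frel (X := X) (Y := Z) (g0 ∘ f0 + g0 ∘ f1) :=
  sgD (S := frel_subgroup X Z) c c'.
rewrite -(fclsD _ _ s) (fcomp0E _ _ (frel_comp hg s)) (fcomp0E _ _ c) (fcomp0E _ _ c').
by rewrite -(fclsD _ _ c2); apply: fcls_congr; rewrite compDr.
Qed.

Definition freyd : preaddcat :=
  {| ob := arrow; hom := fhom; idm := fid0; comp := fcomp0;
     comp_idl := fcomp0_idl; comp_idr := fcomp0_idr; compA := fcomp0A;
     compDl := fcomp0Dl; compDr := fcomp0Dr |}.

Definition fmor X Y (f : arr0 X ~> arr0 Y) (hf : frel f) : @hom freyd X Y := fcls hf.

Lemma fmor_eq X Y f f' hf hf' :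
  @fmor X Y f hf = @fmor X Y f' hf' <-> exists s, f - f' = arr Y ∘ s.
Proof. exact: fcls_eq. Qed.

Lemma fmor_eq0 X Y f hf : @fmor X Y f hf = 0 <-> exists s, f = arr Y ∘ s.
Proof. exact: fcls_eq0. Qed.

Lemma fmor_surj X Y (f : @hom freyd X Y) : exists f0 hf, f = @fmor X Y f0 hf.
Proof. exact: fcls_surj. Qed.

Lemma fmor_congr X Y f f' hf hf' : f = f' -> @fmor X Y f hf = @fmor X Y f' hf'.
Proof. exact: fcls_congr. Qed.

Lemma fmor_comp X Y Z g f hg hf :
  @fmor Y Z g hg ∘ @fmor X Y f hf = @fmor X Z (g ∘ f) (frel_comp hg hf).
Proof. exact: fcomp0E. Qed.

Lemma fmorD X Y (f f' : arr0 X ~> arr0 Y) (hf : frel f) (hf' : frel f') (h : frel (f + f')) :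
  @fmor X Y (f + f') h = fmor hf + fmor hf'.
Proof. exact: fclsD. Qed.

Lemma fmor_id X h : @fmor X X (idm _) h = @idm freyd X.
Proof. exact: fcls_congr. Qed.

Lemma weak_pullback (X Y Z : A) (f : X ~> Z) (g : Y ~> Z) :
  exists (K : A) (p : K ~> X) (q : K ~> Y), f ∘ p = g ∘ q /\
  forall W (x : W ~> X) (y : W ~> Y), f ∘ x = g ∘ y ->
    exists t, p ∘ t = x /\ q ∘ t = y.
Proof.
have [S [i1 [i2 [p1 [p2 [h11 h22 h12 h21 hs]]]]]] := has_biproduct Aadd X Y.
have [K [k [hk ku]]] := Awk (f ∘ p1 - g ∘ p2).
exists K, (p1 ∘ k), (p2 ∘ k); split.
  by apply/subr0_eq; rewrite !compA -compBl.
move=> W x y E.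
have E1 : p1 ∘ (i1 ∘ x + i2 ∘ y) = x.
  by rewrite compDr !compA h11 h12 comp0l comp_idl addr0.
have E2 : p2 ∘ (i1 ∘ x + i2 ∘ y) = y.
  by rewrite compDr !compA h22 h21 comp0l comp_idl add0r.
have [|t Et] := ku W (i1 ∘ x + i2 ∘ y).
  by rewrite compBl -!compA E1 E2 E subrr.
by exists t; rewrite -!compA Et E1 E2.
Qed.

(** Generators of the kernel are a weak pullback of [f0] and [arr Y], that is, elements sent to
    relations; its relations are a weak pullback of these generators with [arr X]. The last three
    clauses record this on representatives, for arguments that do not go through classes. *)
Lemma freyd_kernel X Y (f : @hom freyd X Y) f0 hf : f = @fmor X Y f0 hf ->
  exists (K : arrow) (k : arr0 K ~> arr0 X) (hk : frel (X := K) (Y := X) k),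
  [/\ is_kernel f (fmor hk),
      exists y, f0 ∘ k = arr Y ∘ y,
      forall W (x : W ~> arr0 X) y, f0 ∘ x = arr Y ∘ y -> exists t, k ∘ t = x &
      forall W (t : W ~> arr0 K) s, k ∘ t = arr X ∘ s -> exists r, t = arr K ∘ r].
Proof.
move=> ->; have [K0 [k [y [Ek Uk]]]] := weak_pullback f0 (arr Y).
have [K1 [dk [k1 [Ed Ud]]]] := weak_pullback k (arr X).
pose K := Arrow dk.
have hk : frel (X := K) (Y := X) k by exists k1.
have null W (t : W ~> K0) s : k ∘ t = arr X ∘ s -> exists r, t = dk ∘ r.
  by move=> /Ud [r [Er _]]; exists r.
have lift W (x : W ~> arr0 X) y' : f0 ∘ x = arr Y ∘ y' -> exists t, k ∘ t = x.
  by move=> /Uk [t [Et _]]; exists t.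
exists K, k, hk; split=> //; last by exists y.
apply: kernel_intro.
- by rewrite fmor_comp; apply/fmor_eq0; exists y.
- apply/monoP => W x; have [x0 [hx ->]] := fmor_surj x.
  rewrite fmor_comp => /fmor_eq0 [s /null [r Er]].
  by apply/fmor_eq0; exists r.
move=> W x; have [x0 [hx ->]] := fmor_surj x.
rewrite fmor_comp => /fmor_eq0 [s /lift [t Et]].
have ht : frel (X := W) (Y := K) t.
  have [x1 Ex] := hx.
  have [r Er] : exists r, t ∘ arr W = dk ∘ r.
    by apply: (@null _ _ x1); rewrite compA Et.
  by exists r.
by exists (fmor ht); rewrite fmor_comp; apply: fmor_congr.
Qed.

Lemma freyd_mono X Y f hf : mono (@fmor X Y f hf) ->
  forall W (x : W ~> arr0 X) y, f ∘ x = arr Y ∘ y -> exists s, x = arr X ∘ s.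
Proof.
move=> fm W x y E; have [K [k [hk [fk _ lift _]]]] := freyd_kernel (erefl (fmor hf)).
have /fmor_eq0 [s Es] : fmor hk = 0 by apply: (iffLR (monoP _) fm); case: fk.
have [t <-] := lift _ _ _ E.
by exists (s ∘ t); rewrite compA Es.
Qed.

(** [f] is surjective once the universal element of [Y], the identity of [arr0 Y], lies in its image
    modulo relations. [freyd_epi] is the converse, because the cokernel has the same generators as
    [Y]. *)
Lemma freyd_epi_intro X Y f hf (a : arr0 Y ~> arr1 Y) (b : arr0 Y ~> arr0 X) :
  idm _ = arr Y ∘ a + f ∘ b -> epi (@fmor X Y f hf).
Proof.
move=> E; apply/epiP => W x; have [x0 [[x1 Ex] ->]] := fmor_surj x.
rewrite fmor_comp => /fmor_eq0 [s Es]; apply/fmor_eq0.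
exists (x1 ∘ a + s ∘ b).
by rewrite -[x0]comp_idr E !compDr !compA Ex Es.
Qed.

(** The generators of [Y] are kept and the image of [f] is added to the relations, so the identity
    represents the cokernel map. *)
Lemma freyd_cokernel X Y f hf : exists (S : A) (dq : S ~> arr0 Y)
    (hq : frel (X := Y) (Y := Arrow dq) (idm _)),
  is_cokernel (@fmor X Y f hf) (fmor hq) /\
  (forall W (z : W ~> arr0 Y), (exists s, z = dq ∘ s) ->
     exists a b, z = arr Y ∘ a + f ∘ b) .
Proof.
have [S [i1 [i2 [p1 [p2 [h11 h22 h12 h21 hs]]]]]] :=
  has_biproduct Aadd (arr1 Y) (arr0 X).
pose dq := arr Y ∘ p1 + f ∘ p2; pose Q := Arrow dq.
have hq : frel (X := Y) (Y := Q) (idm _).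
  exists i1; rewrite comp_idl /= compDl -!compA h11 h21.
  by rewrite comp_idr comp0r addr0.
exists S, dq, hq; split; last first.
  move=> W z [s ->]; exists (p1 ∘ s), (p2 ∘ s).
  by rewrite /= compDl !compA.
apply: cokernel_intro.
- rewrite fmor_comp; apply/fmor_eq0; exists i2.
  by rewrite comp_idl /= compDl -!compA h12 h22 comp_idr comp0r add0r.
- by apply: (@freyd_epi_intro Y Q _ hq 0 (idm (arr0 Y))); rewrite comp0r add0r comp_idl.
move=> W x; have [x0 [hx ->]] := fmor_surj x.
rewrite fmor_comp => /fmor_eq0 [s Es]; have [x1 Ex] := hx.
have hx' : frel (X := Q) (Y := W) x0.
  exists (x1 ∘ p1 + s ∘ p2).
  by rewrite /= !compDr !compA Ex -Es.
by exists (fmor hx'); rewrite fmor_comp; apply: fmor_congr; rewrite comp_idr.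
Qed.

Lemma freyd_epi X Y f hf : epi (@fmor X Y f hf) ->
  exists (a : arr0 Y ~> arr1 Y) (b : arr0 Y ~> arr0 X), idm _ = arr Y ∘ a + f ∘ b.
Proof.
move=> fe; have [S [dq [hq [ck Qn]]]] := freyd_cokernel hf.
by apply: Qn; apply/(fmor_eq0 hq); apply: (iffLR (epiP _) fe); case: ck.
Qed.

Lemma freyd_abelian : is_abelian freyd.
Proof.
split.
- split.
    have [Z Z0] := has_zero Aadd; exists (Arrow (0 : Z ~> Z)).
    by apply/fmor_eq0; exists 0; rewrite comp0r; exact: Z0.
  move=> X Y.
  have [S [i1 [i2 [p1 [p2 [h11 h22 h12 h21 hs]]]]]] :=
    has_biproduct Aadd (arr1 X) (arr1 Y).
  have [S' [j1 [j2 [q1 [q2 [k11 k22 k12 k21 ks]]]]]] :=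
    has_biproduct Aadd (arr0 X) (arr0 Y).
  pose B := @Arrow S S' (j1 ∘ arr X ∘ p1 + j2 ∘ arr Y ∘ p2).
  have hi1 : frel (X := X) (Y := B) j1.
    by exists i1; rewrite /= compDl -!compA h11 h21 !comp0r addr0 comp_idr.
  have hi2 : frel (X := Y) (Y := B) j2.
    by exists i2; rewrite /= compDl -!compA h12 h22 !comp0r add0r comp_idr.
  have hp1 : frel (X := B) (Y := X) q1.
    by exists p1; rewrite /= compDr !compA k11 k12 !comp0l addr0 comp_idl.
  have hp2 : frel (X := B) (Y := Y) q2.
    by exists p2; rewrite /= compDr !compA k21 k22 !comp0l add0r comp_idl.
  exists B, (fmor hi1), (fmor hi2), (fmor hp1), (fmor hp2); rewrite !fmor_comp; split.
  + by apply: fmor_congr.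
  + by apply: fmor_congr.
  + by apply/fmor_eq0; exists 0; rewrite comp0r.
  + by apply/fmor_eq0; exists 0; rewrite comp0r.
  have hs' : frel (X := B) (Y := B) (j1 ∘ q1 + j2 ∘ q2) by rewrite ks; apply: frel_id.
  by rewrite -(fmorD _ _ hs'); apply: fmor_congr.
- move=> X Y f; have [f0 [hf E]] := fmor_surj f.
  by have [K [k [hk [fk _ _ _]]]] := freyd_kernel E; exists K, (fmor hk).
- move=> X Y f; have [f0 [hf ->]] := fmor_surj f.
  by have [S [dq [hq [ck _]]]] := freyd_cokernel hf; exists (Arrow dq), (fmor hq).
- move=> X Y f fm; have [f0 [hf E]] := fmor_surj f; subst f.
  have [S [dq [hq [ck Qn]]]] := freyd_cokernel hf.
  exists (Arrow dq), (fmor hq); apply: kernel_intro => //; first by case: ck.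
  move=> W z; have [z0 [[z1 Ez] ->]] := fmor_surj z.
  (* Being zero in the cokernel means [z0 = arr Y ∘ a + f0 ∘ b], and [b] represents the
     factorization through [f]; that it respects relations is where [f] being mono is used. *)
  rewrite fmor_comp => /fmor_eq0; rewrite comp_idl => /Qn [a [b Eab]].
  have [s Es] : exists s, b ∘ arr W = arr X ∘ s.
    apply: (freyd_mono fm (y := z1 - a ∘ arr W)).
    by rewrite compBr -Ez Eab compDl -!compA [_ + f0 ∘ _]addrC addrK.
  have hb : frel (X := W) (Y := X) b by exists s.
  exists (fmor hb); rewrite fmor_comp; apply/fmor_eq; exists (- a).
  by rewrite Eab opprD addrCA subrr addr0 compNr.
- move=> X Y f fe; have [f0 [hf E]] := fmor_surj f; subst f.
  have [a [b Eab]] := freyd_epi fe.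
  have [K [k [hk [fk [y0 Ey0] lift _]]]] := freyd_kernel (erefl (fmor hf)).
  exists K, (fmor hk); apply: cokernel_intro => //; first by case: fk.
  move=> W w; have [w0 [hw ->]] := fmor_surj w; have [w1 Ew] := hw.
  rewrite fmor_comp => /fmor_eq0 [s Es].
  (* [w0] takes to relations whatever [f0] takes to relations. Since [b] is a right inverse of [f0]
     up to relations, [w0 ∘ b] is then the factorization of [w] through [f]. *)
  have kill V (x : V ~> arr0 X) y : f0 ∘ x = arr Y ∘ y -> exists r, w0 ∘ x = arr W ∘ r.
    by move=> /lift [t <-]; exists (s ∘ t); rewrite !compA Es.
  have Efb : f0 ∘ b = idm _ - arr Y ∘ a by rewrite Eab addrC addKr.
  have [r Er] : exists r, w0 ∘ (b ∘ arr Y) = arr W ∘ r.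
    apply: (@kill _ _ (idm _ - a ∘ arr Y)).
    by rewrite compA Efb compBl compBr comp_idl comp_idr compA.
  have hv : frel (X := Y) (Y := W) (w0 ∘ b) by exists r; rewrite -compA.
  exists (fmor hv); rewrite fmor_comp; apply/fmor_eq.
  have [r' Er'] : exists r, w0 ∘ (b ∘ f0 - idm _) = arr W ∘ r.
    apply: (@kill _ _ (- (a ∘ f0))).
    by rewrite compBr compA Efb compBl comp_idl comp_idr addrC addKr compNr compA.
  by exists r'; rewrite -Er' compBr comp_idr compA.
Qed.

Lemma freyd_exact X Y Z f g hf hg : (exists s, g ∘ f = arr Z ∘ s) ->
  (forall W (y : W ~> arr0 Y) z, g ∘ y = arr Z ∘ z ->
     exists x s, y = f ∘ x + arr Y ∘ s) ->
  exact_at (@fmor X Y f hf) (@fmor Y Z g hg).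
Proof.
move=> gf h; have [K [k [hk [gk [z Ez] lift null]]]] := freyd_kernel (erefl (fmor hg)).
have [s Es] := gf; have [e Ee] := lift _ _ _ Es.
have he : frel (X := X) (Y := K) e.
  have [f1 Ef] := hf.
  have [r Er] : exists r, e ∘ arr X = arr K ∘ r.
    by apply: (null _ _ f1); rewrite compA Ee.
  by exists r.
exists K, (fmor hk), (fmor he); split=> //; last first.
  by rewrite fmor_comp; apply: fmor_congr.
have [x [t E]] := h _ _ _ Ez.
have [r Er] : exists r, idm _ - e ∘ x = arr K ∘ r.
  by apply: (null _ _ t); rewrite compBr comp_idr compA Ee E addrC addKr.
by apply: (@freyd_epi_intro _ _ _ _ r x); rewrite -Er subrK.
Qed.

(** As [e] kills the relations and represents the identity, it splits the quotient map from the
    representable object on [arr0 X] onto [X], and representable objects are projective. *)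
Lemma freyd_projective X (e : arr0 X ~> arr0 X) c : e ∘ arr X = 0 ->
  idm _ - e = arr X ∘ c -> projective (X : freyd).
Proof.
move=> eX Ec U V h u he; have [h0 [hh E]] := fmor_surj h; subst h.
have [u0 [hu ->]] := fmor_surj u; have [a [b Eab]] := freyd_epi he.
have [u1 Eu] := hu.
have hg : frel (X := X) (Y := U) (b ∘ u0 ∘ e).
  by exists 0; rewrite -compA eX !comp0r.
exists (fmor hg); rewrite fmor_comp; apply/fmor_eq.
exists (- (a ∘ u0 ∘ e + u1 ∘ c)).
have Efb : h0 ∘ b = idm _ - arr V ∘ a by rewrite Eab addrC addKr.
rewrite compNr compDr !compA Efb -Eu -(compA u0 (arr X)) -Ec !compBl compBr.
by rewrite comp_idl comp_idr opprD opprB addrAC [LHS]addrC.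
Qed.

End Freyd.

(** * Suspension of coherent functors *)

Section FreydSuspension.
Variables (A : preaddcat) (S : functor A A).
Hypothesis Saut : is_automorphism S.

Definition fsusp_ob (X : freyd A) : freyd A := Arrow (fmap S (arr X)).

Lemma frel_susp (X Y : freyd A) f : frel (X := X) (Y := Y) f ->
  frel (X := fsusp_ob X) (Y := fsusp_ob Y) (fmap S f).
Proof. by move=> [f1 E]; exists (fmap S f1); rewrite /= -!fmap_comp E. Qed.

Definition fsusp_map (X Y : freyd A) (f : X ~> Y) : fsusp_ob X ~> fsusp_ob Y :=
  fmor (frel_susp (repr_mem (f : fhom X Y))).

Lemma fsusp_mapE (X Y : freyd A) f hf h : fsusp_map (@fmor A X Y f hf) =
  @fmor A (fsusp_ob X) (fsusp_ob Y) (fmap S f) h.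
Proof.
apply/fmor_eq.
have [s Es] : fnull (f - repr (fcls hf)) :=
    @repr_cls _ (frel_subgroup X Y) (fnull_subgroup X Y) _ hf.
by exists (- fmap S s); rewrite -fmapB -opprB Es compNr -fmap_comp fmapN.
Qed.

Lemma fsusp_id (X : freyd A) : fsusp_map (idm X) = idm (fsusp_ob X).
Proof.
rewrite -(fmor_id (frel_id X)) (fsusp_mapE _ (frel_susp (frel_id X))).
by rewrite -(fmor_id (frel_id _)); apply: fmor_congr; rewrite fmap_id.
Qed.

Lemma fsusp_comp (X Y Z : freyd A) (g : Y ~> Z) (f : X ~> Y) :
  fsusp_map (g ∘ f) = fsusp_map g ∘ fsusp_map f.
Proof.
have [f0 [hf ->]] := fmor_surj f; have [g0 [hg ->]] := fmor_surj g.
rewrite fmor_comp (fsusp_mapE _ (frel_susp (frel_comp hg hf))).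
rewrite (fsusp_mapE _ (frel_susp hf)) (fsusp_mapE _ (frel_susp hg)) fmor_comp.
by apply: fmor_congr; rewrite fmap_comp.
Qed.

Lemma fsusp_D (X Y : freyd A) (f g : X ~> Y) :
  fsusp_map (f + g) = fsusp_map f + fsusp_map g.
Proof.
have [f0 [hf ->]] := fmor_surj f; have [g0 [hg ->]] := fmor_surj g.
have h : frel (X := X) (Y := Y) (f0 + g0) := sgD (S := frel_subgroup X Y) hf hg.
have h' : frel (X := fsusp_ob X) (Y := fsusp_ob Y) (fmap S f0 + fmap S g0) :=
  sgD (S := frel_subgroup (fsusp_ob X) (fsusp_ob Y)) (frel_susp hf) (frel_susp hg).
rewrite -(fmorD _ _ h) (fsusp_mapE _ (frel_susp h)).
rewrite (fsusp_mapE _ (frel_susp hf)) (fsusp_mapE _ (frel_susp hg)).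
by rewrite -(fmorD _ _ h'); apply: fmor_congr; rewrite fmapD.
Qed.

Definition fsusp : functor (freyd A) (freyd A) :=
  Functor fsusp_id fsusp_comp fsusp_D.

(** Equality of records gives equality of [d] and [d'] only up to transport in the endpoints; [cast]
    does the transport and proof irrelevance removes it. *)
Lemma arrow_inj (X1 X0 : A) (d d' : X1 ~> X0) : Arrow d = Arrow d' -> d = d'.
Proof.
pose cast (Y : arrow A) (e1 : arr1 Y = X1) (e0 : arr0 Y = X0) : X1 ~> X0 :=
  eq_rect _ (fun Z => Z ~> X0) (eq_rect _ (fun Z => arr1 Y ~> Z) (arr Y) _ e0) _ e1.
have castE Y e1 e0 : Arrow d = Y -> cast Y e1 e0 = d.
  move=> E; subst Y.
  by rewrite (Prop_irrelevance e1 erefl) (Prop_irrelevance e0 erefl).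
by move=> E; rewrite -(castE (Arrow d') erefl erefl E).
Qed.

Lemma fsusp_automorphism : is_automorphism fsusp.
Proof.
have [So Sm] := Saut; split=> [|X Y].
  apply: bij_of_inj_surj => [[X1 X0 d] [Y1 Y0 d'] E|[Y1 Y0 d]].
    have E1 : X1 = Y1 := bij_inj So (congr1 (@arr1 A) E).
    have E0 : X0 = Y0 := bij_inj So (congr1 (@arr0 A) E).
    subst Y1 Y0; congr Arrow; apply: (bij_inj (Sm _ _)).
    exact: arrow_inj E.
  have [X1 ?] := bij_exists So Y1; have [X0 ?] := bij_exists So Y0; subst Y1 Y0.
  by have [d' <-] := bij_exists (Sm _ _) d; exists (Arrow d').
apply: bij_of_inj_surj => [f g|f].
  have [f0 [hf ->]] := fmor_surj f; have [g0 [hg ->]] := fmor_surj g.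
  rewrite -![fmap _ _]/(fsusp_map _).
  rewrite (fsusp_mapE _ (frel_susp hf)) (fsusp_mapE _ (frel_susp hg)).
  move=> /fmor_eq [s]; have [s' <-] := bij_exists (Sm _ _) s.
  rewrite /= -fmap_comp -fmapB => /(bij_inj (Sm _ _)) E.
  by apply/fmor_eq; exists s'.
have [f0 [[f1 Ef] ->]] := fmor_surj f; simpl in *.
have [g0 Eg0] := bij_exists (Sm _ _) f0; have [g1 Eg1] := bij_exists (Sm _ _) f1.
have hg : frel (X := X) (Y := Y) g0.
  by exists g1; apply: (bij_inj (Sm _ _)); rewrite !fmap_comp Eg0 Eg1.
exists (fmor hg); rewrite -[LHS]/(fsusp_map _) (fsusp_mapE _ (frel_susp hg)).
exact: (@fmor_congr A (fsusp_ob X) (fsusp_ob Y) _ _ _ _ Eg0).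
Qed.

End FreydSuspension.

(** * Triangulated categories and ideals *)

Section Triangulated.
Variable T : triangulated.
Implicit Types A B X Y Z W : T.

Lemma susp_ob_surj Y : exists X, susp X = Y.
Proof. exact: (bij_exists (proj1 (suspP T)) Y). Qed.

Lemma susp_full A B (f : susp A ~> susp B) : exists g : A ~> B, fmap susp g = f.
Proof. exact: (bij_exists (proj2 (suspP T) A B) f). Qed.

Lemma susp_inj A B (f g : A ~> B) : fmap susp f = fmap susp g -> f = g.
Proof. exact: (bij_inj (proj2 (suspP T) A B)). Qed.

Lemma tri_comp0 A B X (f : A ~> B) (g : B ~> X) (h : X ~> susp A) :
  exact_tri f g h -> g ∘ f = 0.
Proof.
move=> t; have [Z Z0] := has_zero (tri_additive T).
have [c [E _]] := tri_morph (b := f) (tri_id A Z0) t (erefl (f ∘ idm A)).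
by rewrite -E comp0r.
Qed.

(** The rotated identity triangle of [W] maps to the rotated given triangle, with [x] and [0] as
    first two components; the third is the suspension of [y]. *)
Lemma tri_lift A B X (f : A ~> B) (g : B ~> X) (h : X ~> susp A) W (x : W ~> B) :
  exact_tri f g h -> g ∘ x = 0 -> exists y, f ∘ y = x.
Proof.
move=> t gx; have [Z Z0] := has_zero (tri_additive T).
have t' := iffLR (tri_rotate _ _ _) (tri_id W Z0).
have [|c [_ E]] := tri_morph (a := x) (b := 0) t' (iffLR (tri_rotate _ _ _) t).
  by rewrite gx comp0l.
have [y Ey] := susp_full c; exists y; apply: susp_inj.
move: E; rewrite fmap_id compNr comp_idr compNl => /oppr_inj.
by rewrite fmap_comp Ey.
Qed.

Lemma tri_desc A B X (f : A ~> B) (g : B ~> X) (h : X ~> susp A) W (x : B ~> W) :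
  exact_tri f g h -> x ∘ f = 0 -> exists y, y ∘ g = x.
Proof.
move=> t xf; have [Z Z0] := has_zero (tri_additive T).
have t' : exact_tri (0 : Z ~> W) (idm W) (0 : W ~> susp Z).
  apply/tri_rotate; rewrite fmap0 oppr0.
  by apply: tri_id; exact: fmap_zero.
have [|c [E _]] := tri_morph (a := 0) (b := x) t t'.
  by rewrite xf comp0l.
by exists c; rewrite E comp_idl.
Qed.

Lemma tri_fiber A B (g : A ~> B) : exists K (k : K ~> A) (h : B ~> susp K),
  exact_tri k g h.
Proof.
have [X [f [h t]]] := tri_complete g; have [K ?] := susp_ob_surj X; subst X.
have [k Ek] := susp_full (- h); exists K, k, f; apply/tri_rotate.
by rewrite Ek opprK.
Qed.

Section Ideal.
Variable I : ideal T.

Lemma idealN A B (f : A ~> B) : ideal_mem I f -> ideal_mem I (- f).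
Proof. by move=> h; rewrite -sub0r; apply: idealB => //; exact: ideal0. Qed.

Lemma ideal_projectiveP A : ideal_projective I A <->
  forall X Y (f : X ~> Y) (u : A ~> X), ideal_mem I f -> f ∘ u = 0.
Proof.
split=> h X Y f; last by move=> fI; apply: addhomP => u; exact: h.
by move=> u fI; exact: (congr1 (fun t => (t : {additive _ -> _}) u) (h _ _ f fI)).
Qed.

Lemma ideal_epic_lift P A (f : P ~> A) Q (u : Q ~> A) : ideal_epic I f ->
  ideal_projective I Q -> exists v, f ∘ v = u.
Proof.
move=> [X [g [h [t gI]]]] /ideal_projectiveP hQ.
by apply: (tri_lift t); exact: hQ.
Qed.

Lemma ideal_epic_kill P A (f : P ~> A) B (u : A ~> B) : ideal_epic I f ->
  u ∘ f = 0 -> ideal_mem I u.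
Proof.
move=> [X [g [h [t gI]]]] uf; have [y <-] := tri_desc t uf.
exact: ideal_compl.
Qed.

Lemma ideal_projective_retract P Q (r : P ~> Q) (s : Q ~> P) : r ∘ s = idm Q ->
  ideal_projective I P -> ideal_projective I Q.
Proof.
move=> rs /ideal_projectiveP hP; apply/ideal_projectiveP => X Y f u fI.
by rewrite -(comp_idr u) -rs (compA u) compA hP // comp0l.
Qed.

Definition homologicalP (D : preaddcat) (G : functor T D) :=
  forall A B X (f : A ~> B) (g : B ~> X) (h : X ~> susp A),
    exact_tri f g h -> exact_at (fmap G f) (fmap G g).

Hypothesis Isusp : forall A B (f : A ~> B),
  ideal_mem I (fmap susp f) <-> ideal_mem I f.

(** The cone of [g] is traded for its fibre [k], which removes the suspension. Now [k] is a weak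
    kernel of [g] and [f1] a weak cokernel of [f], and the condition reads: cycles are boundaries up
    to the ideal. *)
Lemma ideal_exact_atP X Y Z (f : X ~> Y) (g : Y ~> Z) : ideal_exact_at I f g <->
  exists X1 K (f1 : Y ~> X1) (g1 : X1 ~> susp X) (k : K ~> Y) (h : Z ~> susp K),
  [/\ exact_tri f f1 g1, exact_tri k g h & ideal_mem I (f1 ∘ k)].
Proof.
split=> [[X1 [X0 [f1 [g1 [f0 [g0 [t1 t0 m]]]]]]]|].
  have [K ?] := susp_ob_surj X0; subst X0.
  have [k Ek] := susp_full (- g0); exists X1, K, f1, g1, k, f0; split=> //.
    by apply/tri_rotate; rewrite Ek opprK.
  by apply/Isusp; rewrite fmap_comp Ek compNr; apply: idealN.
move=> [X1 [K [f1 [g1 [k [h [t1 t0 m]]]]]]].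
exists X1, (susp K), f1, g1, h, (- fmap susp k); split=> //.
  exact: (iffLR (tri_rotate _ _ _) t0).
by rewrite compNr -fmap_comp; apply/idealN/Isusp.
Qed.

(** A chase in [D]: an element killed by [G g] comes locally from [G K]; since [G] kills [f1 ∘ k],
    it is killed by [G f1] and so comes from [G X]. *)
Lemma ideal_exact_at_map (D : preaddcat) (Dab : is_abelian D) (G : functor T D)
    X Y Z (f : X ~> Y) (g : Y ~> Z) : homologicalP G -> ideal_exact I G ->
  g ∘ f = 0 -> ideal_exact_at I f g -> exact_at (fmap G f) (fmap G g).
Proof.
move=> Gh GI gf /ideal_exact_atP [X1 [K [f1 [g1 [k [h [t1 t0 m]]]]]]].
apply: exact_at_intro => //; first by rewrite -fmap_comp gf fmap0.
move=> U y gy.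
have [V [e [x [ee Ex]]]] := exact_at_lift Dab (Gh _ _ _ _ _ _ t0) gy.
have [|V' [e' [x' [ee' Ex']]]] :=
    exact_at_lift Dab (y := y ∘ e) (Gh _ _ _ _ _ _ t1).
  by rewrite -Ex compA -fmap_comp (GI _ _ _ m) comp0l.
exists V', (e ∘ e'), x'; split; first exact: epi_comp.
by rewrite compA.
Qed.

Lemma ideal_exact_at_reflect (D : preaddcat) (Dab : is_abelian D) (F : functor T D)
    X Y Z (f : X ~> Y) (g : Y ~> Z) : homologicalP F -> kernel_is F I ->
  exact_at (fmap F f) (fmap F g) -> ideal_exact_at I f g.
Proof.
move=> Fh FI ex; apply/ideal_exact_atP.
have [X1 [f1 [g1 t1]]] := tri_complete f; have [K [k [h t0]]] := tri_fiber g.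
exists X1, K, f1, g1, k, h; split=> //; apply/FI; rewrite fmap_comp.
have [|V [e [x [ee Ex]]]] := exact_at_lift Dab (y := fmap F k) ex.
  by rewrite -fmap_comp (tri_comp0 t0) fmap0.
apply: (iffLR (epiP _) ee).
by rewrite -compA -Ex compA -fmap_comp (tri_comp0 t1) fmap0 comp0l.
Qed.

Lemma ideal_epicP (D : preaddcat) (Dab : is_abelian D) (F : functor T D)
    A B (f : A ~> B) : homologicalP F -> kernel_is F I ->
  ideal_epic I f <-> epi (fmap F f).
Proof.
move=> Fh FI; split=> [[X [g [h [t gI]]]]|fe].
  have := Fh _ _ _ _ _ _ t; rewrite (iffRL (FI _ _ _) gI).
  by move/exact_at0_epi.
have [X [g [h t]]] := tri_complete f; exists X, g, h; split=> //; apply/FI.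
by apply: (iffLR (epiP _) fe); rewrite -fmap_comp (tri_comp0 t) fmap0.
Qed.

Lemma ideal_projective_susp A : ideal_projective I (susp A) <-> ideal_projective I A.
Proof.
split=> /ideal_projectiveP h; apply/ideal_projectiveP => X Y f u fI.
  by apply: susp_inj; rewrite fmap_comp h ?fmap0 //; apply/Isusp.
have [X0 ?] := susp_ob_surj X; have [Y0 ?] := susp_ob_surj Y; subst X Y.
have [f0 ?] := susp_full f; have [u0 ?] := susp_full u; subst f u.
by rewrite -fmap_comp h ?fmap0 //; apply/Isusp.
Qed.

End Ideal.

Lemma stable_zero (C : stablecat) (F : functor T C) A B (f : A ~> B) :
  stable_functor F -> (fmap F (fmap susp f) = 0 <-> fmap F f = 0).
Proof.
move=> [a [ai an]]; split=> E.
  apply: (bij_inj (proj2 (suspP C) (F A) (F B))).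
  rewrite fmap0; apply: (iffLR (epiP _) (iso_epi (ai A))).
  by rewrite -[X in X ∘ _]/(fmap (susp ⊚ F) f) -an [fmap (F ⊚ susp) f]E comp0r.
apply: (iso_mono (ai B)); rewrite comp0r.
rewrite -[X in _ ∘ X]/(fmap (F ⊚ susp) f) an.
by rewrite -[X in X ∘ _]/(fmap susp (fmap F f)) E fmap0 comp0l.
Qed.

Lemma kernel_susp (C : stablecat) (F : functor T C) (I : ideal T) :
  stable_functor F -> kernel_is F I -> forall A B (f : A ~> B),
  ideal_mem I (fmap susp f) <-> ideal_mem I f.
Proof.
move=> Fs FI A B f; split=> /FI h; apply/FI; exact/(stable_zero f Fs).
Qed.

End Triangulated.

(** * The category of ideal-projective objects *)

Section ProjectiveSubcategory.
Variables (T : triangulated) (I : ideal T).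
Hypothesis Isusp : forall (A B : T) (f : A ~> B),
  ideal_mem I (fmap susp f) <-> ideal_mem I f.
Hypothesis Ienough : enough_ideal_projectives I.

Definition ipcat : preaddcat := fullsub (ideal_projective I).

Lemma ipcat_additive : is_additive ipcat.
Proof.
split.
  have [Z Z0] := has_zero (tri_additive T).
  have hZ : ideal_projective I Z.
    by apply/ideal_projectiveP => X Y f u _; apply: zero_hom_from.
  by exists (exist _ Z hZ).
move=> [A hA] [B hB]; have [S [i1 [i2 [p1 [p2 [h11 h22 h12 h21 hs]]]]]] :=
  has_biproduct (tri_additive T) A B.
have hS : ideal_projective I S.
  apply/ideal_projectiveP => X Y f u fI.
  have hA' : f ∘ (u ∘ i1) = 0 by exact: (iffLR (ideal_projectiveP _ _) hA).
  have hB' : f ∘ (u ∘ i2) = 0 by exact: (iffLR (ideal_projectiveP _ _) hB).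
  rewrite -(comp_idr u) -hs !compDr (compA u) (compA u i2) (compA f _ p1).
  by rewrite (compA f _ p2) hA' hB' !comp0l addr0.
by exists (exist _ S hS), i1, i2, p1, p2; split.
Qed.

Lemma ipcat_weak_kernel (X Y : ipcat) (f : X ~> Y) : exists (K : ipcat) (k : K ~> X),
  f ∘ k = 0 /\ forall W (x : W ~> X), f ∘ x = 0 -> exists t, k ∘ t = x.
Proof.
case: X Y f => X hX [Y hY] f.
have [K [k [h t]]] := tri_fiber (f : @hom T X Y).
have [P [p [hP pe]]] := Ienough K.
exists (exist _ P hP), (@comp T P K X k p); split.
  by rewrite -[LHS]/(@comp T P X Y f (k ∘ p)) compA (tri_comp0 t) comp0l.
case=> W hW x fx; have [y Ey] := tri_lift (x := (x : @hom T W X)) t fx.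
have [z Ez] := ideal_epic_lift y pe hW.
exists z; rewrite -[LHS]/(@comp T W P X (k ∘ p) z) -compA.
by rewrite -Ey -Ez.
Qed.

Definition ipsusp : functor ipcat ipcat :=
  @fcorestr ipcat T (susp ⊚ femb (ideal_projective I)) (ideal_projective I)
    (fun A => iffRL (ideal_projective_susp Isusp (sval A)) (svalP A)).

Lemma ipsusp_automorphism : is_automorphism ipsusp.
Proof.
split=> [|[A hA] [B hB]]; last exact: (proj2 (suspP T) A B).
apply: bij_of_inj_surj => [[A hA] [B hB] /(congr1 (@sval _ _)) /= E|[B hB]].
  by have E' := bij_inj (proj1 (suspP T)) E; subst B; apply: eq_exist.
have [A ?] := susp_ob_surj B; subst B.
have hA := iffLR (ideal_projective_susp Isusp A) hB.
by exists (exist _ A hA); apply: eq_exist.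
Qed.

End ProjectiveSubcategory.

(** * The functor to coherent functors on ideal-projectives *)

Section FreydFunctor.
Variables (T : triangulated) (I : ideal T).
Hypothesis Isusp : forall (A B : T) (f : A ~> B),
  ideal_mem I (fmap susp f) <-> ideal_mem I f.
Hypothesis Ienough : enough_ideal_projectives I.

Let A := ipcat I.
Let Aadd : is_additive A := ipcat_additive I.
Let Awk := ipcat_weak_kernel Ienough.
Let FA : preaddcat := freyd A.

Definition tarr (X : arrow A) : @hom T (sval (arr1 X)) (sval (arr0 X)) := arr X.

(** The start of an ideal-projective resolution of [B], described by what ideal-projective test
    objects see. It makes [X] a presentation of the functor [T(-, B)] on ideal-projectives;
    [pres_kill] keeps the information that [p] is ideal-epic. *)
Record presents (B : T) (X : arrow A) (p : sval (arr0 X) ~> B) : Prop := Presents {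
  pres_comp0 : p ∘ tarr X = 0;
  pres_lift : forall Q, ideal_projective I Q -> forall u : Q ~> B,
    exists v, p ∘ v = u;
  pres_ker : forall Q, ideal_projective I Q -> forall u : Q ~> sval (arr0 X),
    p ∘ u = 0 -> exists v, u = tarr X ∘ v;
  pres_kill : forall D (u : B ~> D), u ∘ p = 0 -> ideal_mem I u
}.

Lemma presents_exists B : exists X p, @presents B X p.
Proof.
have [P0 [p [h0 e0]]] := Ienough B; have [K [k [h t]]] := tri_fiber p.
have [P1 [q [h1 e1]]] := Ienough K.
exists (@Arrow A (exist _ P1 h1) (exist _ P0 h0) (k ∘ q)), p; split.
- by rewrite /tarr /= compA (tri_comp0 t) comp0l.
- by move=> Q hQ u; apply: ideal_epic_lift e0 hQ.
- move=> Q hQ u pu; have [y Ey] := tri_lift t pu.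
  have [z Ez] := ideal_epic_lift y e1 hQ.
  by exists z; rewrite /tarr /= -compA Ez Ey.
by move=> D u; apply: ideal_epic_kill e0.
Qed.

Definition lifts (B D : T) (X Y : FA) (p : sval (arr0 X) ~> B)
    (q : sval (arr0 Y) ~> D) (f : B ~> D) (u : X ~> Y) :=
  exists (u0 : @hom T (sval (arr0 X)) (sval (arr0 Y))) (h : @frel A X Y u0),
    u = fmor h /\ q ∘ u0 = f ∘ p.

Section Lifts.
Variables (B D : T) (X Y : FA) (p : sval (arr0 X) ~> B) (q : sval (arr0 Y) ~> D).
Hypotheses (pX : @presents B X p) (qY : @presents D Y q).

Lemma lifts_exists f : exists u : X ~> Y, lifts p q f u.
Proof.
have [u0 Eu] := pres_lift qY (svalP (arr0 X)) (f ∘ p).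
have [|u1 Eu1] := pres_ker qY (svalP (arr1 X)) (u := u0 ∘ tarr X).
  by rewrite compA Eu -compA (pres_comp0 pX) comp0r.
have h : @frel A X Y u0 by exists u1.
by exists (fmor h), u0, h.
Qed.

(** Both conditions amount to [f ∘ p = 0], through [pres_ker] on one side and ideal-projectivity of
    [arr0 X] with [pres_kill] on the other. This will identify the kernel of [F] with [I]. *)
Lemma lifts_null f u0 (h : @frel A X Y u0) : q ∘ u0 = f ∘ p ->
  fmor h = 0 <-> ideal_mem I f.
Proof.
move=> E; split=> [/fmor_eq0 [s Es]|fI].
  apply: (pres_kill pX); rewrite -E [u0]Es.
  by rewrite -[arr Y ∘ s]/(tarr Y ∘ s) compA (pres_comp0 qY) comp0l.
apply/fmor_eq0; have [|v Ev] := pres_ker qY (svalP (arr0 X)) (u := u0).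
  by rewrite E; apply: (iffLR (ideal_projectiveP _ _) (svalP (arr0 X))).
by exists v.
Qed.

Lemma lifts_unique f u u' : lifts p q f u -> lifts p q f u' -> u = u'.
Proof.
move=> [u0 [h [-> E]]] [u1 [h' [-> E']]]; apply/fmor_eq.
have [|v Ev] := pres_ker qY (svalP (arr0 X)) (u := u0 - u1).
  by rewrite compBr E E' subrr.
by exists v.
Qed.

Lemma liftsD f f' u u' : lifts p q f u -> lifts p q f' u' ->
  lifts p q (f + f') (u + u').
Proof.
move=> [u0 [h [-> E]]] [u1 [h' [-> E']]].
have s : @frel A X Y (u0 + u1) := sgD (S := frel_subgroup X Y) h h'.
exists (u0 + u1), s; split; first by rewrite -(fmorD _ _ s).
by rewrite compDr compDl E E'.
Qed.

End Lifts.

Lemma lifts_id B (X : FA) p : @presents B X p -> lifts p p (idm B) (idm X).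
Proof.
move=> pX; exists (idm _), (frel_id X); split; first by rewrite fmor_id.
by rewrite comp_idl comp_idr.
Qed.

Lemma lifts_comp B D E (X Y Z : FA) p q r (g : D ~> E) (f : B ~> D)
    (v : Y ~> Z) (u : X ~> Y) : lifts q r g v -> lifts p q f u ->
  lifts p r (g ∘ f) (v ∘ u).
Proof.
move=> [v0 [h [-> Ev]]] [u0 [h' [-> Eu]]].
exists (v0 ∘ u0), (frel_comp h h'); split; first by rewrite fmor_comp.
by rewrite compA Ev -compA Eu compA.
Qed.

Lemma lifts_exact B D E (f : B ~> D) (g : D ~> E) h (X Y Z : FA) p q r u v :
  @presents B X p -> @presents D Y q -> @presents E Z r -> exact_tri f g h ->
  lifts p q f u -> lifts q r g v -> exact_at u v.
Proof.
move=> pX qY rZ t [u0 [hu [-> Eu]]] [v0 [hv [-> Ev]]].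
apply: (freyd_exact Aadd Awk).
  have [|s Es] := pres_ker rZ (svalP (arr0 X)) (u := v0 ∘ u0).
    by rewrite compA Ev -compA Eu compA (tri_comp0 t) comp0l.
  by exists s.
move=> W y z E'; have [|a Ea] := tri_lift (x := q ∘ y) t.
  rewrite compA -Ev -compA [v0 ∘ y]E'.
  by rewrite -[arr Z ∘ z]/(tarr Z ∘ z) compA (pres_comp0 rZ) comp0l.
have [x Ex] := pres_lift pX (svalP W) a.
have [|s Es] := pres_ker qY (svalP W) (u := y - u0 ∘ x).
  by rewrite compBr compA Eu -compA Ex Ea subrr.
by exists x, s; rewrite -[arr Y ∘ s]/(tarr Y ∘ s) -Es addrC subrK.
Qed.

Lemma presents_susp B (X : FA) p : @presents B X p ->
  @presents (susp B) (fsusp_ob (ipsusp Isusp) X) (fmap susp p).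
Proof.
move=> pX; split.
- rewrite -[LHS]/(fmap susp p ∘ fmap susp (tarr X)).
  by rewrite -fmap_comp (pres_comp0 pX) fmap0.
- move=> Q hQ u; have [Q0 ?] := susp_ob_surj Q; subst Q.
  have [u0 <-] := susp_full u.
  have [v <-] := pres_lift pX (iffLR (ideal_projective_susp Isusp Q0) hQ) u0.
  by exists (fmap susp v); rewrite fmap_comp.
- move=> Q hQ u; have [Q0 ?] := susp_ob_surj Q; subst Q.
  have [u0 <-] := susp_full u; rewrite -fmap_comp -(fmap0 susp) => /susp_inj E.
  have [v ->] := pres_ker pX (iffLR (ideal_projective_susp Isusp Q0) hQ) E.
  by exists (fmap susp v); rewrite fmap_comp.
move=> D u; have [D0 ?] := susp_ob_surj D; subst D.
have [u0 Eu] := susp_full u; subst u => E; apply/Isusp; apply: (pres_kill pX).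
by apply: susp_inj; rewrite fmap_comp fmap0.
Qed.

Lemma lifts_susp B D (X Y : FA) p q (f : B ~> D) (u : X ~> Y) : lifts p q f u ->
  lifts (X := fsusp (ipsusp Isusp) X) (Y := fsusp (ipsusp Isusp) Y)
    (fmap susp p) (fmap susp q) (fmap susp f) (fmap (fsusp (ipsusp Isusp)) u).
Proof.
move=> [u0 [h [-> E]]].
exists (fmap susp u0), (frel_susp (ipsusp Isusp) h); split.
  exact: (fsusp_mapE _ (frel_susp (ipsusp Isusp) h)).
have := congr1 (fun t => fmap susp t) E; rewrite !fmap_comp => E'; exact: E'.
Qed.

Definition freyd_stabcat : stabcat :=
  @Stabcat (@Stablecat FA (fsusp (ipsusp Isusp))
    (fsusp_automorphism (ipsusp_automorphism Isusp))) (freyd_abelian Aadd Awk).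

Lemma freyd_functor_exists : exists F : functor T FA,
  exists p : forall B, sval (arr0 (F B)) ~> B,
  (forall B, presents (p B)) /\ forall B D (f : B ~> D), lifts (p B) (p D) f (fmap F f).
Proof.
have /dchoice [X /dchoice [p pX]] := presents_exists.
pose m B D f := sval (cid (lifts_exists (pX B) (pX D) f)).
have mP B D f : lifts (p B) (p D) f (m B D f) := svalP (cid (lifts_exists (pX B) (pX D) f)).
have m1 B : m B B (idm B) = @idm FA (X B).
  exact: (lifts_unique (pX B) (mP _ _ _) (lifts_id (pX B))).
have mc B D E (g : D ~> E) (f : B ~> D) : m B E (g ∘ f) = m D E g ∘ m B D f.
  exact: (lifts_unique (pX E) (mP _ _ _) (lifts_comp (mP _ _ _) (mP _ _ _))).
have mD B D (f f' : B ~> D) : m B D (f + f') = m B D f + m B D f'.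
  exact: (lifts_unique (pX D) (mP _ _ _) (liftsD (mP _ _ _) (mP _ _ _))).
by exists (@Functor T FA X m m1 mc mD), p.
Qed.

End FreydFunctor.

Record ideal_resolving (T : triangulated) (I : ideal T) (C : stabcat)
    (F : functor T C) : Prop := IdealResolving {
  ires_hom : stable_homological F;
  ires_ker : kernel_is F I;
  ires_dense : dense_projectives (F ⊚ femb (ideal_projective I));
  ires_ff : forall P B : T, ideal_projective I P ->
    bijective (fun f : P ~> B => fmap F f)
}.

Lemma ideal_resolving_exists (T : triangulated) (I : ideal T) :
  homological_ideal I -> enough_ideal_projectives I ->
  exists (C : stabcat) (F : functor T C), ideal_resolving I F.
Proof.
move=> [C1 [F1 [[_ F1s] F1k]]] Ienough.
have Isusp := kernel_susp F1s F1k.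
have [F [p [pF lF]]] := freyd_functor_exists Ienough.
(* [F P] comes from a chosen presentation, not from [P] alone; a section of [p P] makes it
   isomorphic to the representable object of an ideal-projective [P]. *)
have projE (P : T) (hP : ideal_projective I P) : exists s, p P ∘ s = idm P.
  exact: (pres_lift (pF P) hP (idm P)).
have kerE (P : T) s : p P ∘ s = idm P ->
    exists c, idm _ - s ∘ p P = tarr (F P) ∘ c.
  move=> ps; apply: (pres_ker (pF P) (svalP (arr0 (F P)))).
  by rewrite compBr comp_idr compA ps comp_idl subrr.
have ker : kernel_is F I.
  move=> B D f; have [u0 [h [-> E]]] := lF _ _ f.
  exact: (lifts_null (pF B) (pF D) h E).
have ff P B : ideal_projective I P -> bijective (fun f : P ~> B => fmap F f).
  move=> hP; have [s ps] := projE P hP.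
  apply: bij_of_inj_surj => [f g E|u].
    have /ker fg : fmap F (f - g) = 0 by rewrite fmapB E subrr.
    apply/subr0_eq; rewrite -(comp_idr (f - g)).
    exact: (iffLR (ideal_projectiveP _ _) hP).
  have [u0 [h Eu]] := fmor_surj u; have [c Ec] := kerE P s ps.
  have [u1 Eu1] := h.
  (* Up to relations [s ∘ p P] is the identity, so this map has [u0] as a lift. *)
  exists (p B ∘ u0 ∘ s); apply: (lifts_unique (pF B) (lF _ _ _)).
  exists u0, h; split=> //.
  have -> : p B ∘ u0 ∘ s ∘ p P = p B ∘ u0 - p B ∘ u0 ∘ (idm _ - s ∘ p P).
    by rewrite compBr comp_idr opprB addrC subrK compA.
  rewrite Ec compA -(@compA T _ _ _ _ (p B) u0) [_ ∘ tarr (F P)]Eu1.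
  rewrite -[arr (F B) ∘ u1]/(tarr (F B) ∘ u1).
  by rewrite (compA _ (tarr (F B))) (pres_comp0 (pF B)) !comp0l subr0.
exists (freyd_stabcat Isusp Ienough), F; split=> //; last first.
- split=> [Q Q'|[P hP]|X].
  + exact: (ff (sval Q) (sval Q') (svalP Q)).
  + have [s ps] := projE P hP; have [c Ec] := kerE P s ps.
    have e0 : s ∘ p P ∘ tarr (F P) = 0 by rewrite -compA (pres_comp0 (pF P)) comp0r.
    exact: (@freyd_projective (ipcat I) (ipcat_additive I) (F P) (s ∘ p P) c e0 Ec).
  (* The generators of [X] form an ideal-projective object, whose image under [F] maps onto [X]
     through its own presentation. *)
  exists (arr0 X); have [s ps] := projE _ (svalP (arr0 X)).
  have h : @frel (ipcat I) (F (sval (arr0 X))) X (p (sval (arr0 X))).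
    by exists 0; rewrite comp0r; exact: (pres_comp0 (pF _)).
  have E0 : idm (arr0 X) = arr X ∘ (0 : @hom (ipcat I) _ _) + p (sval (arr0 X)) ∘ s.
    by rewrite comp0r add0r; exact: (esym ps).
  have ee := @freyd_epi_intro (ipcat I) _ _ _ h _ _ E0.
  by exists (fmor h).
split=> [B D E f g h t|].
  exact: (lifts_exact Ienough (pF B) (pF D) (pF E) t (lF _ _ _) (lF _ _ _)).
(* Both [F (susp B)] and the suspension of [F B] present [susp B], so the lifts of its identity are
   mutually inverse. *)
have pS B := presents_susp Isusp (pF B).
have /dchoice [a aP] : forall B, exists a : F (susp B) ~> fsusp_ob (ipsusp Isusp) (F B),
    lifts (Y := fsusp_ob (ipsusp Isusp) (F B)) (p (susp B)) (fmap susp (p B)) (idm _) a.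
  by move=> B; apply: lifts_exists => //; exact: pS.
exists a; split=> [B|B D f].
  have [b bP] := lifts_exists (pS B) (pF (susp B)) (idm _).
  have ba := lifts_comp bP (aP B); have ab := lifts_comp (aP B) bP.
  rewrite comp_idl in ba; rewrite comp_idl in ab.
  exists b; split; first exact: (lifts_unique (pF (susp B)) ba (lifts_id (pF _))).
  exact: (lifts_unique (pS B) ab (lifts_id (pS B))).
have l := lifts_comp (aP D) (lF _ _ (fmap susp f)).
have r := lifts_comp (lifts_susp Isusp (lF _ _ f)) (aP B).
rewrite comp_idl in l; rewrite comp_idr in r.
exact: (lifts_unique (pS D) l r).
Qed.

(** * Universality *)

Section DenseDual.
Variables (A C D : preaddcat) (J : functor A C).
Hypothesis Cab : is_abelian C.
Hypothesis dJ : dense_projectives J.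
Variable g : functor (opcat A) D.

Lemma left_exact_unique (H H' : functor (opcat C) D) : left_exact H -> left_exact H' ->
  nat_iso (H ⊚ fop J) g -> nat_iso (H' ⊚ fop J) g -> nat_iso H H'.
Proof.
move=> /right_exact_fswap r /right_exact_fswap r' /nat_iso_fswap h /nat_iso_fswap h'.
apply/nat_iso_fswap; apply: (right_exact_unique Cab dJ (g := fswap g)) => //.
Qed.

Lemma left_exact_extension :
  (forall (U V : D) (f : U ~> V), exists (K : D) (k : K ~> U), is_kernel f k) ->
  exists H : functor (opcat C) D, left_exact H /\ nat_iso (H ⊚ fop J) g.
Proof.
move=> Dk; have Dc : forall (U V : opcat D) (f : U ~> V),
    exists (Q : opcat D) (q : V ~> Q), is_cokernel f q by move=> U V f; exact: (Dk V U f).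
have [H [Hr Hg]] := right_exact_extension Cab dJ (fswap g) Dc.
exists (funswap H); split; last exact/nat_iso_fswap.
by move=> X Y Z f h; exact: (Hr Z Y X h f).
Qed.

End DenseDual.

Section Stability.
Variables (T : triangulated) (I : ideal T) (C : stabcat) (F : functor T C).
Hypothesis res : ideal_resolving I F.

Let P := ideal_projective I.
Let Isusp := kernel_susp (proj2 (ires_hom res)) (ires_ker res).
Let dJ := ires_dense res.
Let Cab : is_abelian C := @stabcatP C.

(** [H ⊚ susp] and [susp ⊚ H] are right exact, and agree on the objects [F P] because [F] and [G]
    are stable; uniqueness of right exact extensions does the rest. *)
Lemma stable_extension (D : stablecat) (G : functor T D) (H : functor C D) :
  right_exact H -> stable_functor G -> nat_iso (H ⊚ F ⊚ femb P) (G ⊚ femb P) ->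
  stable_functor H.
Proof.
move=> Hr Gs HG; apply: (right_exact_unique Cab dJ (g := susp ⊚ (G ⊚ femb P))).
- apply: right_exact_comp => //.
  exact/automorphism_right_exact/suspP.
- by apply: right_exact_comp => //; exact/automorphism_right_exact/suspP.
- have s1 : nat_iso (H ⊚ (susp ⊚ F) ⊚ femb P) (H ⊚ (F ⊚ susp) ⊚ femb P).
    apply/nat_iso_whiskr/nat_iso_whiskl/nat_iso_sym.
    exact: (proj2 (ires_hom res)).
  have s2 : nat_iso (H ⊚ (F ⊚ susp) ⊚ femb P) (G ⊚ susp ⊚ femb P).
    (* [HG] may be evaluated at suspended objects, since the suspension preserves
       ideal-projectives. *)
    exact: (nat_iso_whiskr (ipsusp Isusp) HG).
  have s3 : nat_iso (G ⊚ susp ⊚ femb P) (susp ⊚ G ⊚ femb P) by exact: nat_iso_whiskr.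
  exact: (nat_iso_trans s1 (nat_iso_trans s2 s3)).
- exact: (nat_iso_whiskl susp HG).
Qed.

Lemma stable_coextension (D : stablecat) (G : functor (opcat T) D)
    (H : functor (opcat C) D) : left_exact H -> stable_cofunctor G ->
  nat_iso (H ⊚ fop F ⊚ fop (femb P)) (G ⊚ fop (femb P)) -> stable_cofunctor H.
Proof.
move=> Hl Gs HG.
apply: (left_exact_unique Cab dJ (g := G ⊚ fop (femb P))) => //.
  apply: left_exact_comp; first apply: left_exact_comp => //.
    exact/automorphism_left_exact/suspP.
  by apply: automorphism_left_exact; apply: automorphism_op; exact: suspP.
have s1 : nat_iso (susp ⊚ H ⊚ fop (susp ⊚ F) ⊚ fop (femb P))
    (susp ⊚ H ⊚ fop (F ⊚ susp) ⊚ fop (femb P)).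
  apply/nat_iso_whiskr/nat_iso_whiskl.
  have [a [ai an]] := proj2 (ires_hom res).
  exists a; split=> [A|A B f]; first by case: (ai A) => b [h k]; exists b.
  by apply/esym; exact: an.
have s2 : nat_iso (susp ⊚ H ⊚ fop (F ⊚ susp) ⊚ fop (femb P))
    (susp ⊚ (G ⊚ fop susp) ⊚ fop (femb P)).
  have := nat_iso_whiskl susp (nat_iso_whiskr (fop (ipsusp Isusp)) HG).
  exact.
have s3 : nat_iso (susp ⊚ (G ⊚ fop susp) ⊚ fop (femb P)) (G ⊚ fop (femb P)).
  exact: (nat_iso_whiskr (fop (femb P)) (nat_iso_sym Gs)).
exact: (nat_iso_trans s1 (nat_iso_trans s2 s3)).
Qed.

Let J := F ⊚ femb P.

Lemma ires_exact_ideal X Y Z (f : X ~> Y) (g : Y ~> Z) :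
  exact_at (fmap F f) (fmap F g) -> ideal_exact_at I f g.
Proof.
exact: (ideal_exact_at_reflect Isusp Cab (proj1 (ires_hom res)) (ires_ker res)).
Qed.

(** Maps from [F Q] to [F A] with [Q] ideal-projective come from [T], so [G] itself gives a family
    on [F A]. It is universal because [G], homological and killing [I], is exact on a presentation
    of [A]. Thus [G A] and [H (F A)] are the same Kan extension value. *)
Lemma ires_extension_comp (D : preaddcat) (Dab : is_abelian D) (G : functor T D)
    (H : functor C D) : homologicalP G -> ideal_exact I G -> right_exact H ->
  nat_iso (H ⊚ F ⊚ femb P) (G ⊚ femb P) -> nat_iso (H ⊚ F) G.
Proof.
move=> Gh GI Hr HG.
have [io [uio nio]] := right_exact_kan Cab dJ Hr HG.
have full (A : T) (Q : fullsub P) (x : J Q ~> F A) :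
    exists t : sval Q ~> A, fmap F t = x.
  exact: (bij_exists (ires_ff res A (svalP Q))).
pose t A Q x := sval (cid (full A Q x)).
have tP A Q x : fmap F (t A Q x) = x := svalP (cid (full A Q x)).
have inj (A : T) (Q : fullsub P) (s s' : sval Q ~> A) : fmap F s = fmap F s' -> s = s'.
  exact: (bij_inj (ires_ff res A (svalP Q))).
apply: (@kan_unique _ _ J D (G ⊚ femb P) T F (H ⊚ F) G (fun A => io (F A))
  (fun A Q x => fmap G (t A Q x))).
  by split=> [A|A B f Q x]; [exact: uio|exact: nio].
split=> [A|A B f Q x]; last first.
  rewrite -[LHS](fmap_comp G f (t A Q x)); congr (fmap G _).
  by apply: inj; rewrite fmap_comp !tP.
have [Q1 [Q0 [d [e [ee de]]]]] := dense_presentation Cab dJ (F A).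
apply: (universal_presentation dJ ee de).
  split=> [Q Q' s x|Q x y].
    rewrite -[RHS](fmap_comp G (t A Q x) s); congr (fmap G _).
    by apply: inj; rewrite fmap_comp !tP.
  by rewrite -[RHS]fmapD; congr (fmap G _); apply: inj; rewrite fmapD !tP.
have e0 : t A Q0 e ∘ (d : @hom T (sval Q1) (sval Q0)) = 0.
  apply: inj; rewrite fmap_comp tP fmap0.
  exact: (exact_at_comp0 de).
have [Z Z0] := has_zero (tri_additive T).
apply: (exact_epi_cokernel Dab).
  apply: (ideal_exact_at_map Isusp Dab Gh GI e0).
  by apply: ires_exact_ideal; rewrite tP.
have : exact_at (fmap G (t A Q0 e)) (fmap G (0 : A ~> Z)).
  apply: (ideal_exact_at_map Isusp Dab Gh GI (comp0l _ _)).
  by apply: ires_exact_ideal; rewrite tP fmap0; apply/exact_at0_epi.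
by rewrite fmap0 => /exact_at0_epi.
Qed.

Lemma ires_extension_exact (D : preaddcat) (Dab : is_abelian D) (G : functor T D)
    (H : functor C D) : homologicalP G -> ideal_exact I G -> right_exact H ->
  nat_iso (H ⊚ F ⊚ femb P) (G ⊚ femb P) -> exact_functor H.
Proof.
move=> Gh GI Hr [a [ai an]]; apply: (right_exact_exact Cab Dab dJ Hr).
move=> Q2 Q1 Q0 f g ex.
have gf : (g : @hom T _ _) ∘ (f : @hom T (sval Q2) (sval Q1)) = 0.
  apply: (bij_inj (ires_ff res (sval Q0) (svalP Q2))).
  by rewrite fmap_comp fmap0; exact: (exact_at_comp0 ex).
have exG := ideal_exact_at_map Isusp Dab Gh GI gf (ires_exact_ideal ex).
have sym := nat_iso_sym (ex_intro _ a (conj ai an)).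
have [b [bi bn]] := sym.
by apply: (exact_at_iso (bi Q2) (bi Q1) (bi Q0)) exG; exact: bn.
Qed.

Lemma ires_universal : universal_exact I F.
Proof.
split; [exact: (ires_hom res)|by move=> A B f /(ires_ker res)|].
move=> C' G [Gh Gs] GI; have C'ab := @stabcatP C'.
have [H [Hr HG]] := right_exact_extension Cab dJ (G ⊚ femb P) (has_cokernel C'ab).
exists H; split.
  split.
  - exact: (ires_extension_exact C'ab Gh GI Hr HG).
  - exact: (stable_extension Hr Gs HG).
  - exact: (ires_extension_comp C'ab Gh GI Hr HG).
move=> H' [[_ Hr'] _ HG']; apply: (right_exact_unique Cab dJ Hr' Hr _ HG).
exact: (nat_iso_whiskr (femb P) HG').
Qed.

End Stability.

(** * Recognising universal functors through equivalences *)

Section Equivalence.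
Variables (C D : preaddcat) (H : functor C D) (K : functor D C).
Hypotheses (KH : nat_iso (K ⊚ H) (fid C)) (HK : nat_iso (H ⊚ K) (fid D)).

Lemma nat_iso_inj (E E' : preaddcat) (L L' : functor E E') A B (f g : A ~> B) :
  nat_iso L L' -> fmap L f = fmap L g -> fmap L' f = fmap L' g.
Proof.
move=> [a [ai an]] E0; apply: (iso_epi (ai A)).
by rewrite -!an E0.
Qed.

Lemma equivalence_inj A B : injective (@fmap C D H A B).
Proof. by move=> f g E; apply: (nat_iso_inj KH); rewrite /= E. Qed.

End Equivalence.

Lemma equivalence_ff (C D : preaddcat) (H : functor C D) (K : functor D C) :
  nat_iso (K ⊚ H) (fid C) -> nat_iso (H ⊚ K) (fid D) ->
  forall A B, bijective (@fmap C D H A B).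
Proof.
move=> KH HK A B; apply: bij_of_inj_surj; first exact: equivalence_inj KH _ _.
move=> g; have [a [ai an]] := KH; have [b [b1 b2]] := ai A.
exists (a B ∘ fmap K g ∘ b); apply: (equivalence_inj HK).
have e := an _ _ (a B ∘ fmap K g ∘ b).
apply: (iso_mono (ai B)); apply: etrans e _.
by rewrite -[LHS]/(a B ∘ fmap K g ∘ b ∘ a A) -(compA (a B ∘ fmap K g)) b1 comp_idr.
Qed.

Lemma right_exact_epi (C D : preaddcat) (Cab : is_abelian C) (H : functor C D)
    (X Y : C) (e : X ~> Y) : right_exact H -> epi e -> epi (fmap H e).
Proof.
move=> Hr ee; have [K [k ek]] := has_kernel Cab e.
exact: (cokernel_epi (Hr _ _ _ _ _ (epi_coker_ker Cab ee ek))).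
Qed.

Lemma projective_retract (C : preaddcat) (P Q : C) (r : P ~> Q) (s : Q ~> P) :
  r ∘ s = idm Q -> projective P -> projective Q.
Proof.
move=> rs hP X Y e f ee; have [g Eg] := hP _ _ e (f ∘ r) ee.
by exists (g ∘ s); rewrite compA Eg -compA rs comp_idr.
Qed.

Lemma projective_iso (C : preaddcat) (P Q : C) (r : P ~> Q) :
  is_iso r -> projective P -> projective Q.
Proof. by case=> s [_ rs]; apply: projective_retract rs. Qed.

Lemma equivalence_projective (C D : preaddcat) (Cab : is_abelian C)
    (H : functor C D) (K : functor D C) (Q : D) : right_exact H ->
  nat_iso (K ⊚ H) (fid C) -> nat_iso (H ⊚ K) (fid D) ->
  projective Q -> projective (K Q).
Proof.
move=> Hr KH HK hQ X Y e f ee.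
have hHKQ : projective (H (K Q)).
  by have [a [ai _]] := nat_iso_sym HK; exact: (projective_iso (ai Q)).
have [g Eg] := hHKQ _ _ _ (fmap H f) (right_exact_epi Cab Hr ee).
have [g' Eg'] := bij_exists (equivalence_ff KH HK _ _) g.
exists g'; apply: (equivalence_inj KH).
by rewrite fmap_comp Eg' Eg.
Qed.

Lemma bijective_nat_iso (C D : preaddcat) (F G : functor C D) A B : nat_iso F G ->
  bijective (@fmap C D F A B) -> bijective (@fmap C D G A B).
Proof.
move=> FG [h h1 h2]; have [a [ai an]] := FG; have [b [b1 b2]] := ai A.
have [c [c1 c2]] := ai B.
exists (fun g => h (c ∘ g ∘ a A)) => [f|g].
  by rewrite -compA -an compA c1 comp_idl h1.
by apply: (iso_epi (ai A)); rewrite -an h2 !compA c2 comp_idl.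
Qed.

Lemma universal_resolving (T : triangulated) (I : ideal T) (C : stabcat)
    (F : functor T C) : homological_ideal I -> enough_ideal_projectives I ->
  universal_exact I F -> ideal_resolving I F.
Proof.
move=> Ihom Ienough [Fh FI Fu].
have [C0 [F0 res]] := ideal_resolving_exists Ihom Ienough.
have [F0h F0I F0u] := ires_universal res.
have [H [[He Hs HF] _]] := Fu _ _ F0h F0I.
have [K [[Ke Ks KF] _]] := F0u _ _ Fh FI.
have stabc (X Y Z : stabcat) (L : functor X Y) (M : functor Y Z) :
    stable_functor L -> stable_functor M -> stable_functor (M ⊚ L).
  move=> sL sM.
  have s1 : nat_iso (M ⊚ L ⊚ susp) (M ⊚ (susp ⊚ L)) by exact: (nat_iso_whiskl M sL).
  have s2 : nat_iso (M ⊚ (susp ⊚ L)) (susp ⊚ (M ⊚ L)) by exact: (nat_iso_whiskr L sM).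
  exact: (nat_iso_trans s1 s2).
have exc (X Y Z : stabcat) (L : functor X Y) (M : functor Y Z) :
    exact_functor L -> exact_functor M -> exact_functor (M ⊚ L).
  by move=> [l r] [l' r']; split; [exact: left_exact_comp|exact: right_exact_comp].
(* The identity and [M] both solve the problem of factoring [L] through itself, so each is
   isomorphic to the solution [N]. This is applied to [K ⊚ H] and [H ⊚ K]. *)
have rigid (X : stabcat) (L : functor T X) (M : functor X X) :
    (forall G : functor T X, stable_homological G -> ideal_exact I G ->
      unique_upto_iso (fun Gb : functor X X =>
          [/\ exact_functor Gb, stable_functor Gb & nat_iso (Gb ⊚ L) G])) ->
    stable_homological L -> ideal_exact I L ->
    exact_functor M -> stable_functor M -> nat_iso (M ⊚ L) L -> nat_iso M (fid X).
  move=> u Lh LI Me Ms ML; have [N [_ uN]] := u L Lh LI.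
  have h1 : nat_iso M N by exact: uN.
  have h2 : nat_iso (fid X) N.
    apply: uN; split; first by split.
      exact: (nat_iso_refl (susp (s := X))).
    exact: (nat_iso_refl L).
  exact: (nat_iso_trans h1 (nat_iso_sym h2)).
have KH : nat_iso (K ⊚ H) (fid C).
  apply: (rigid C F) => //; [exact: Fu|exact: exc|exact: stabc|].
  exact: (nat_iso_trans (nat_iso_whiskl K HF) KF).
have HK : nat_iso (H ⊚ K) (fid C0).
  apply: (rigid C0 F0) => //; [exact: F0u|exact: exc|exact: stabc|].
  exact: (nat_iso_trans (nat_iso_whiskl H KF) HF).
have Cab := @stabcatP C; have C0ab := @stabcatP C0.
have ker : kernel_is F I.
  move=> A B f; split=> [f0|/FI //]; apply/(ires_ker res).
  rewrite -(fmap0 F0); apply: (nat_iso_inj HF).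
  by rewrite /= f0 !fmap0.
have ff A B : ideal_projective I A -> bijective (@fmap T C F A B).
  move=> hA; have b : bijective (@fmap T C0 (H ⊚ F) A B).
    by apply: (bijective_nat_iso (nat_iso_sym HF)); exact: (ires_ff res).
  have [h' h1 h2] := equivalence_ff KH HK (F A) (F B).
  apply: (eq_bij (bij_comp (Bijective h2 h1) b)) => f /=.
  by rewrite h1.
split=> //; split=> [Q Q'|[A hA]|X].
- exact: (ff _ _ (svalP Q)).
- have [a [ai _]] := KF; apply: (projective_iso (ai A)).
  apply: (equivalence_projective Cab (proj2 He) KH HK).
  exact: (@dense_proj _ _ _ (ires_dense res) (exist _ A hA)).
have [Q [e ee]] := dense_cover (ires_dense res) (H X).
have [a [ai _]] := nat_iso_sym KF; have [b [bi _]] := KH.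
exists Q, (b X ∘ fmap K e ∘ a (sval Q)).
apply: epi_comp; last exact/iso_epi/ai.
apply: epi_comp; first exact/iso_epi/bi.
exact: (right_exact_epi C0ab (proj2 Ke) ee).
Qed.

(** * Projective objects and the partial left adjoint *)

Lemma mono_epi_iso (C : preaddcat) (Cab : is_abelian C) (A B : C) (f : A ~> B) :
  mono f -> epi f -> is_iso f.
Proof.
move=> fm fe; have [D [g fg]] := mono_normal Cab fm.
have g0 : g = 0 by apply: (iffLR (epiP _) fe); case: fg.
have [|y Ey] := kernel_lift (x := idm B) fg; first by rewrite g0 comp0l.
by exists y; split=> //; apply: fm; rewrite compA Ey comp_idl comp_idr.
Qed.

Section Augcx.
Variables (C : preaddcat) (A : C).
Implicit Types P Q : augcx A.

Lemma augcx_iso_sym P Q : augcx_iso P Q -> augcx_iso Q P.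
Proof.
move=> [phi [[hd he] hi]].
have /dchoice [psi psiP] : forall n, exists g : Q n ~> P n,
  g ∘ phi n = idm _ /\ phi n ∘ g = idm _ by move=> n; case: (hi n) => g; exists g.
exists psi; split; last by move=> n; exists (phi n); case: (psiP n).
split=> [n|].
  apply: (iso_mono (hi n)); rewrite compA (proj2 (psiP n)) comp_idl.
  by rewrite compA hd -compA (proj2 (psiP n.+1)) comp_idr.
apply: (iso_epi (hi 0%N)).
by rewrite -!compA (proj1 (psiP 0%N)) comp_idr comp_idl -he comp_idl.
Qed.

Lemma augcx_iso_trans P Q R : augcx_iso P Q -> augcx_iso Q R -> augcx_iso P R.
Proof.
move=> [phi [h i]] [psi [k j]]; exists (fun n => psi n ∘ phi n); split.
  by have := chain_map_over_comp k h; rewrite comp_idl.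
by move=> n; exact: iso_comp.
Qed.

Lemma projres_iso P Q : is_abelian C -> augcx_iso P Q -> projres P -> projres Q.
Proof.
move=> Cab [phi [[hd he] hi]] /(projresP Cab) [h1 h2 h3].
rewrite comp_idl in he; apply/(projresP Cab); split=> [n||n].
- exact: (projective_iso (hi n)) (@h1 n).
- by apply: (@epi_left _ _ _ _ _ (phi 0%N)); rewrite -he.
case: n => [|n].
  apply: (exact_at_iso (hi 1%N) (hi 0%N) (iso_id A)) (h3 0%N); first exact: hd.
  by rewrite /= comp_idl.
by apply: (exact_at_iso (hi n.+2) (hi n.+1) (hi n)) (h3 n.+1); exact: hd.
Qed.

End Augcx.

Section Unit.
Variables (T C : preaddcat) (F : functor T C).

Definition ladj_unit (X : fullsub (ladj_dom F)) : sval X ~> F (ladj F X) :=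
  rep (ladj_rep X) (idm _).

Lemma ladj_unit_rep (X : fullsub (ladj_dom F)) B (g : ladj F X ~> B) :
  rep (ladj_rep X) g = fmap F g ∘ ladj_unit X.
Proof. exact: repE. Qed.

Lemma ladj_unit_rep_inv (X : fullsub (ladj_dom F)) B (f : sval X ~> F B) :
  fmap F (rep_inv (ladj_rep X) f) ∘ ladj_unit X = f.
Proof. by rewrite -ladj_unit_rep rep_invK. Qed.

Lemma ladj_unit_nat (X Y : fullsub (ladj_dom F)) (u : X ~> Y) :
  fmap F (fmap (ladj F) u) ∘ ladj_unit X = ladj_unit Y ∘ (u : sval X ~> sval Y).
Proof. exact: ladj_unit_rep_inv. Qed.

Lemma ladj_unit_inj (X : fullsub (ladj_dom F)) B (g g' : ladj F X ~> B) :
  fmap F g ∘ ladj_unit X = fmap F g' ∘ ladj_unit X -> g = g'.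
Proof. by rewrite -!ladj_unit_rep => /rep_inj. Qed.

Lemma ladj_ideal_projective (I : ideal T) (X : fullsub (ladj_dom F)) :
  kernel_is F I -> forall B D (f : B ~> D) (u : ladj F X ~> B),
  ideal_mem I f -> f ∘ u = 0.
Proof.
move=> FI B D f u /FI f0; apply: ladj_unit_inj.
by rewrite fmap_comp f0 fmap0 !comp0l.
Qed.

End Unit.

(** * Projectives, left adjoint and resolutions for a resolving [F] *)

Section Resolving.
Variables (T : triangulated) (I : ideal T) (C : stabcat) (F : functor T C).
Hypothesis Tsplit : idempotents_split T.
Hypothesis res : ideal_resolving I F.

Let Isusp := kernel_susp (proj2 (ires_hom res)) (ires_ker res).
Let dJ := ires_dense res.
Let Cab : is_abelian C := @stabcatP C.
Let Fh : homologicalP F := proj1 (ires_hom res).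

Lemma ires_inj (P B : T) (f g : P ~> B) : ideal_projective I P ->
  fmap F f = fmap F g -> f = g.
Proof. by move=> hP; exact: (bij_inj (ires_ff res B hP)). Qed.

Lemma ires_full (P B : T) (u : F P ~> F B) : ideal_projective I P ->
  exists f, fmap F f = u.
Proof. by move=> hP; exact: (bij_exists (ires_ff res B hP)). Qed.

Lemma ires_projective (P : T) : ideal_projective I P -> projective (F P).
Proof. by move=> hP; exact: (@dense_proj _ _ _ dJ (exist _ P hP)). Qed.

Lemma ires_iso (P Q : T) (u : P ~> Q) : ideal_projective I P -> ideal_projective I Q ->
  is_iso (fmap F u) -> is_iso u.
Proof.
move=> hP hQ [v [vu uv]]; have [w Ew] := ires_full v hQ; subst v.
exists w; split; apply: ires_inj => //; rewrite fmap_comp fmap_id //.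
Qed.

(** A projective [X] is a retract of some [F Q]; the idempotent [s ∘ e] comes from an idempotent of
    [Q], and its splitting in [T] gives [P]. This is where the splitting of idempotents enters. *)
Lemma ires_projective_iso X : projective X -> exists (P : T) (th : X ~> F P),
  ideal_projective I P /\ is_iso th.
Proof.
move=> hX; have [[Q hQ] [e ee]] := dense_cover dJ X; rewrite /= in e ee.
have [s es] := hX _ _ e (idm X) ee.
have [t Et] := ires_full (s ∘ e) hQ.
have [|P [r [i [ri ir]]]] := Tsplit (e := t).
  apply: ires_inj => //.
  by rewrite fmap_comp Et compA -(compA s) es comp_idr.
exists P, (fmap F r ∘ s); split; first exact: ideal_projective_retract ri hQ.
exists (e ∘ fmap F i); split.
  by rewrite compA -(compA e) -fmap_comp ir Et !compA es comp_idl es.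
rewrite compA -(compA (fmap F r)) -Et -!fmap_comp -ir.
by rewrite -compA -(compA i) ri comp_idr ri fmap_id.
Qed.

Lemma ires_ladj_dom_iso X (P : T) (th : X ~> F P) : ideal_projective I P ->
  is_iso th -> ladj_dom F X.
Proof.
move=> hP [th' [h k]].
have full B (f : X ~> F B) : exists g : P ~> B, fmap F g = f ∘ th' by exact: ires_full.
pose ri B f := sval (cid (full B f)).
have riP B f : fmap F (ri B f) = f ∘ th' := svalP (cid (full B f)).
unshelve eexists; last done.
unshelve refine (@Representation T C F X P (fun B g => fmap F g ∘ th) ri _ _ _).
- move=> B g; apply: ires_inj => //.
  by rewrite riP -compA k comp_idr.
- by move=> B f; rewrite riP -compA h comp_idr.
by move=> B B' b g; rewrite fmap_comp compA.
Qed.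

Lemma ires_ladj_dom X : projective X -> ladj_dom F X.
Proof.
by move=> /ires_projective_iso [P [th [hP thi]]]; exact: ires_ladj_dom_iso hP thi.
Qed.

(** The cone of a map lifting a projective presentation of [Y]. *)
Lemma ires_embedding (Y : C) : exists (A : T) (j : Y ~> F A), mono j.
Proof.
have [Q1 [Q0 [d [e [ee de]]]]] := dense_presentation Cab dJ Y.
have [A [c [h t]]] := tri_complete (d : @hom T (sval Q1) (sval Q0)).
have [|j Ej] := cokernel_desc (x := fmap F c) (exact_epi_cokernel Cab de ee).
  by rewrite -[LHS](fmap_comp F c d) (tri_comp0 t) fmap0.
exists A, j; apply: (dense_mono Cab dJ) => Q x jx.
have [x' Ex'] := dense_proj dJ x ee.
(* [F c] kills [x'], so [x'] comes from [F d], and [x = e ∘ x'] vanishes. *)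
have [|v Ev] := projective_lift (y := x') (@dense_proj _ _ _ dJ Q) (Fh t).
  by rewrite -Ej -compA Ex' jx.
by rewrite -Ex' -Ev compA (exact_at_comp0 de) comp0l.
Qed.

Lemma ladj_projective (X : fullsub (ladj_dom F)) : ideal_projective I (ladj F X).
Proof. by apply/ideal_projectiveP; exact: (ladj_ideal_projective (ires_ker res)). Qed.

(** Every map from [X] to some [F B] extends uniquely along the unit [e]. Embedding [X] into some
    [F A], the extension shows that [e] is mono; embedding the target of a [w] with [w ∘ e = 0],
    uniqueness shows [w = 0]. Projectivity of [X] is then a consequence. *)
Lemma ladj_unit_iso (X : fullsub (ladj_dom F)) : is_iso (ladj_unit X).
Proof.
have hP := ladj_projective X; set e := ladj_unit X.
have ext B (y : sval X ~> F B) : exists z, z ∘ e = y.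
  by exists (fmap F (rep_inv (ladj_rep X) y)); exact: ladj_unit_rep_inv.
have uni B (z z' : F (ladj F X) ~> F B) : z ∘ e = z' ∘ e -> z = z'.
  have [u <-] := ires_full z hP; have [u' <-] := ires_full z' hP.
  by move=> /ladj_unit_inj ->.
apply: mono_epi_iso => //.
  have [A [j jm]] := ires_embedding (sval X); have [z Ez] := ext _ j.
  by apply: (@mono_right _ _ _ _ z); rewrite Ez.
apply/epiP => W w we; have [A [j jm]] := ires_embedding W.
by apply: (iffLR (monoP _) jm); apply: uni; rewrite -compA we comp0r comp0l.
Qed.

Lemma ladj_domP X : ladj_dom F X <-> projective X.
Proof.
split=> [hX|]; last exact: ires_ladj_dom.
have [v [h k]] := ladj_unit_iso (exist _ X hX).
exact: (projective_retract h (ires_projective (ladj_projective _))).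
Qed.

Lemma ladj_essential_range A : ideal_projective I A <->
  exists X : fullsub (ladj_dom F), isomorphic (ladj F X) A.
Proof.
split=> [hA|[X [f [g [gf fg]]]]]; last first.
  exact: (ideal_projective_retract fg (ladj_projective X)).
have hX := ires_ladj_dom_iso hA (iso_id (F A)).
pose X : fullsub (ladj_dom F) := exist _ (F A) hX; exists X.
have [v [h k]] := ladj_unit_iso X.
have [u Eu] := ires_full v (ladj_projective X); exists u.
apply: ires_iso => //; first exact: ladj_projective.
by rewrite Eu; exists (ladj_unit X).
Qed.

Lemma ladj_unit_nat_iso (dom : forall X : fullsub (@projective C),
    ladj_dom F (femb (@projective C) X)) :
  nat_iso (F ⊚ ladj F ⊚ fcorestr dom) (femb (@projective C)).
Proof.
apply: nat_iso_sym; exists (fun X => ladj_unit (fcorestr dom X)); split=> [X|X Y f].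
  exact: ladj_unit_iso.
by apply/esym; exact: (ladj_unit_nat (fmap (fcorestr dom) f)).
Qed.

Lemma ires_equivalence : exists (FP : forall A : fullsub (ideal_projective I),
         projective ((F ⊚ femb (ideal_projective I)) A))
     (dom : forall X : fullsub (@projective C),
         ladj_dom F (femb (@projective C) X))
     (LP : forall X : fullsub (@projective C),
         ideal_projective I ((ladj F ⊚ fcorestr dom) X)),
   inverse_equivalences (fcorestr FP) (fcorestr LP).
Proof.
have FP (A : fullsub (ideal_projective I)) :
    projective ((F ⊚ femb (ideal_projective I)) A) by exact: ires_projective (svalP A).
have dom (X : fullsub (@projective C)) : ladj_dom F (femb (@projective C) X).
  exact: ires_ladj_dom (svalP X).
have LP (X : fullsub (@projective C)) :
    ideal_projective I ((ladj F ⊚ fcorestr dom) X) by exact: ladj_projective.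
exists FP, dom, LP.
split; last first.
  have [a [ai an]] := ladj_unit_nat_iso dom.
  exists a; split=> [X|X Y f]; last exact: an.
  by have [b bP] := ai X; exists b.
apply: nat_iso_sym.
pose X_ (A : fullsub (ideal_projective I)) : fullsub (@projective C) :=
  exist _ (F (sval A)) (FP A).
(* The unit at [F A] goes between values of [F], so fullness descends it to a map of [T], natural
   because [F] is faithful on maps out of [A]. *)
have /dchoice [u Eu] : forall A : fullsub (ideal_projective I),
    exists u : sval A ~> ladj F (fcorestr dom (X_ A)),
      fmap F u = ladj_unit (fcorestr dom (X_ A)).
  by move=> A; apply: ires_full; exact: (svalP A).
exists u; split=> [A|A B f].
  have [|v vP] := ires_iso (svalP A) (ladj_projective (fcorestr dom (X_ A))) (u := u A).
    by rewrite Eu; exact: ladj_unit_iso.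
  by exists v.
apply: (ires_inj (svalP A)).
rewrite [LHS]fmap_comp [RHS]fmap_comp !Eu; apply/esym.
exact: (@ladj_unit_nat _ _ F (fcorestr dom (X_ A)) (fcorestr dom (X_ B))
  (fmap F (f : @hom T (sval A) (sval B)))).
Qed.

Lemma ideal_projective_char A : ideal_projective I A <->
  projective (F A) /\ forall B : T, bijective (fun f : A ~> B => fmap F f).
Proof.
split=> [hA|[_ ff]].
  by split; [exact: ires_projective|move=> B; exact: (ires_ff res)].
apply/ideal_projectiveP => X Y f u /(ires_ker res) f0; apply: (bij_inj (ff Y)).
by rewrite fmap_comp f0 comp0l fmap0.
Qed.

Lemma ideal_equivalenceP (A B : T) (f : A ~> B) :
  ideal_equivalence I f <-> is_iso (fmap F f).
Proof.
split=> [[X [g [h [t gI hI]]]]|fi].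
  apply: mono_epi_iso => //.
    have [K ?] := susp_ob_surj X; subst X; have [k Ek] := susp_full (- h).
    have t' : exact_tri k f g by apply/tri_rotate; rewrite Ek opprK.
    have k0 : fmap F k = 0.
      by apply/(ires_ker res)/Isusp; rewrite Ek; apply: idealN.
    apply/monoP => U x fx.
    have [V [e [y [ee Ey]]]] := exact_at_lift Cab (Fh t') fx.
    by apply: (iffLR (epiP _) ee); rewrite -Ey k0 comp0l.
  by have := Fh t; rewrite (iffRL (ires_ker res _) gI) => /exact_at0_epi.
have [X [g [h t]]] := tri_complete f; exists X, g, h; split=> //.
  apply/(ires_ker res); apply: (iffLR (epiP _) (iso_epi fi)).
  by rewrite -fmap_comp (tri_comp0 t) fmap0.
apply/(ires_ker res); have [a [ai an]] := proj2 (ires_hom res).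
apply: (iso_mono (ai A)); apply: (iso_mono (fmap_iso susp fi)).
(* Rotating twice gives [fmap susp f ∘ h = 0] up to sign; by stability [fmap F (fmap susp f)] is an
   isomorphism, so [F] kills [h]. *)
have E := tri_comp0 (iffLR (tri_rotate _ _ _) (iffLR (tri_rotate _ _ _) t)).
have E' : fmap susp f ∘ h = 0.
  by move: E; rewrite compNl => /eqP; rewrite oppr_eq0 => /eqP.
rewrite !comp0r compA -[X in X ∘ _]an -compA -[X in _ ∘ X]fmap_comp.
by rewrite E' fmap0 comp0r.
Qed.

Lemma ires_projectiveP A : projective (F A) <-> exists (P : T) (f : P ~> A),
  ideal_projective I P /\ ideal_equivalence I f.
Proof.
split=> [hA|[P [f [hP /ideal_equivalenceP fi]]]]; last first.
  exact: (projective_iso fi (ires_projective hP)).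
have [P [th [hP [v [h k]]]]] := ires_projective_iso hA.
have [f Ef] := ires_full v hP; exists P, f; split=> //.
by apply/ideal_equivalenceP; rewrite Ef; exists th.
Qed.

Lemma ideal_projres_fmap A (P : augcx A) : ideal_projres I P -> projres (fmap_cx F P).
Proof.
have map := ideal_exact_at_map Isusp Cab Fh
  (fun A B f => iffRL (ires_ker res f)).
move=> [h1 h2 h3 [Z [Z0 h4]]]; split=> [n|n||].
- exact: ires_projective.
- by apply: map => //; exact: cxdd.
- by apply: map => //; exact: cxed.
exists (F Z); split; first exact: fmap_zero.
by have := map _ _ _ _ _ (comp0l _ _) h4; rewrite fmap0.
Qed.

Lemma ideal_projres_reflect A (P : augcx A) :
  (forall n, ideal_projective I (P n)) -> projres (fmap_cx F P) -> ideal_projres I P.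
Proof.
move=> hP /(projresP Cab) [_ h2 h3]; split=> // [n||].
- exact: (ires_exact_ideal res (h3 n.+1)).
- exact: (ires_exact_ideal res (h3 0%N)).
have [Z Z0] := has_zero (tri_additive T); exists Z; split=> //.
by apply: (ires_exact_ideal res); rewrite fmap0; apply/exact_at0_epi.
Qed.

Lemma ladj_cx_unit A (Q : augcx (F A)) (dom : forall n, ladj_dom F (Q n)) :
  augcx_iso Q (fmap_cx F (ladj_cx dom)).
Proof.
pose X n : fullsub (ladj_dom F) := exist _ (Q n) (dom n).
exists (fun n => ladj_unit (X n)); split; last by move=> n; exact: ladj_unit_iso.
split=> [n|].
  by apply/esym; exact: (@ladj_unit_nat _ _ F (X n.+1) (X n) (cxd Q n)).
rewrite comp_idl; apply/esym.
exact: (@ladj_unit_rep_inv _ _ F (X 0%N)).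
Qed.

Lemma ladj_cx_projres A (Q : augcx (F A)) (dom : forall n, ladj_dom F (Q n)) :
  projres Q -> ideal_projres I (ladj_cx dom).
Proof.
move=> hQ; apply: ideal_projres_reflect => [n|]; first exact: ladj_projective.
exact: (projres_iso Cab (ladj_cx_unit dom) hQ).
Qed.

Lemma augcx_iso_fmap A (P P' : augcx A) : augcx_iso P P' ->
  augcx_iso (fmap_cx F P) (fmap_cx F P').
Proof.
move=> [phi [h i]]; exists (fun n => fmap F (phi n)); split.
  by have := chain_map_over_fmap F h; rewrite fmap_id.
by move=> n; exact: (fmap_iso F (i n)).
Qed.

Lemma chain_map_full A B (P : augcx A) (Q : augcx B) (f : A ~> B)
    (phi : forall n, fmap_cx F P n ~> fmap_cx F Q n) :
  (forall n, ideal_projective I (P n)) ->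
  chain_map_over (P := fmap_cx F P) (Q := fmap_cx F Q) (fmap F f) phi ->
  exists psi : forall n, P n ~> Q n,
    chain_map_over f psi /\ forall n, fmap F (psi n) = phi n.
Proof.
move=> hP [h1 h2].
have /dchoice [psi E] : forall n, exists g : P n ~> Q n, fmap F g = phi n.
  by move=> n; exact: ires_full.
exists psi; split=> //; split=> [n|].
  apply: ires_inj => //; rewrite !fmap_comp !E; exact: h1.
by apply: ires_inj => //; rewrite !fmap_comp E.
Qed.

Lemma augcx_iso_reflect A (P Q : augcx A) :
  (forall n, ideal_projective I (P n)) -> (forall n, ideal_projective I (Q n)) ->
  augcx_iso (fmap_cx F P) (fmap_cx F Q) -> augcx_iso P Q.
Proof.
move=> hP hQ [phi [h i]].
have [|psi [k E]] := chain_map_full (f := idm A) hP (phi := phi).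
  by rewrite fmap_id.
exists psi; split=> // n; apply: ires_iso => //.
by rewrite E; exact: (i n).
Qed.

Lemma ladj_cx_iso A (Q Q' : augcx (F A)) (dom : forall n, ladj_dom F (Q n))
    (dom' : forall n, ladj_dom F (Q' n)) :
  augcx_iso Q Q' -> augcx_iso (ladj_cx dom) (ladj_cx dom').
Proof.
move=> QQ; apply: augcx_iso_reflect => [n|n|]; try exact: ladj_projective.
apply: augcx_iso_trans (augcx_iso_sym (ladj_cx_unit dom)) _.
exact: augcx_iso_trans QQ (ladj_cx_unit dom').
Qed.

Lemma ladj_cx_fmap A (P : augcx A) (dom : forall n, ladj_dom F (fmap_cx F P n)) :
  (forall n, ideal_projective I (P n)) -> augcx_iso (ladj_cx dom) P.
Proof.
move=> hP; apply: augcx_iso_reflect => // [n|]; first exact: ladj_projective.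
exact: (augcx_iso_sym (ladj_cx_unit dom)).
Qed.

Lemma ires_projres_class : res_class (@projres C).
Proof. exact: (projres_class Cab (enough_projectives_dense dJ)). Qed.

(** Everything is pulled back from [C]: resolutions by applying the left adjoint to a resolution of
    [F A], lifts and homotopies because [F] is bijective on maps out of ideal-projectives. *)
Lemma ideal_projres_class : res_class (@ideal_projres T I).
Proof.
have rc := ires_projres_class; split.
- move=> A; have [Q hQ] := res_exists rc (F A).
  have dom n : ladj_dom F (Q n) by case: hQ => h _ _ _; exact: ires_ladj_dom.
  by exists (ladj_cx dom); exact: ladj_cx_projres.
- move=> A B P Q rP rQ f; have hP : forall n, ideal_projective I (P n) by case: rP.
  have [phi h] := res_lift rc (ideal_projres_fmap rP) (ideal_projres_fmap rQ) (fmap F f).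
  by have [psi [k _]] := chain_map_full hP h; exists psi.
move=> A B P Q rP rQ f phi psi h k n.
have hP : forall n, ideal_projective I (P n) by case: rP.
have := res_homotopy rc (ideal_projres_fmap rP) (ideal_projres_fmap rQ)
  (chain_map_over_fmap F h) (chain_map_over_fmap F k) n.
move=> [s [t E]].
have [s' Es] : exists s' : P n ~> Q n.+1, fmap F s' = s by exact: ires_full.
(* In degree 0 the map [t] follows a zero differential and may be replaced by 0; in positive degrees
   its source is again some [F (P n)] and it descends too. *)
subst s; case: n t s' E => [|n] t s' E.
  exists s', 0; apply: ires_inj => //.
  move: E; rewrite /= comp0r addr0 comp0r addr0 fmapB fmap_comp; exact.
have [t' Et] : exists t' : P n ~> Q n.+1, fmap F t' = t by exact: ires_full.
subst t; exists s', t'; apply: ires_inj => //.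
by move: E; rewrite fmapB fmapD !fmap_comp.
Qed.

End Resolving.

(** * The description of [F] by its left adjoint *)

Section Characterization.
Variables (T : triangulated) (I : ideal T) (C : stabcat) (F : functor T C).

Definition left_adjoint_conditions :=
  [/\ stable_homological F,
      kernel_is F I,
      enough_projectives C &
      exists dom : forall X : fullsub (@projective C),
          ladj_dom F (femb (@projective C) X),
        nat_iso (F ⊚ ladj F ⊚ fcorestr dom) (femb (@projective C))].

(** If [F F^|- X] is naturally isomorphic to [X] in any way, the unit is an
    isomorphism: composed with that isomorphism it is a natural endomorphism [u]
    of the identity, so the left inverse of [u] also commutes with [u]. *)
Lemma left_adjoint_unit_iso (dom : forall X : fullsub (@projective C),
    ladj_dom F (femb (@projective C) X)) :
  nat_iso (F ⊚ ladj F ⊚ fcorestr dom) (femb (@projective C)) ->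
  forall X, is_iso (ladj_unit (fcorestr dom X)).
Proof.
move=> [th [thi thn]] X; set e := ladj_unit (fcorestr dom X).
have [th' [h k]] := thi X.
have hM : projective (F (ladj F (fcorestr dom X))) := projective_retract h (svalP X).
pose M : fullsub (@projective C) := exist _ _ hM.
pose eM := ladj_unit (fcorestr dom M).
pose ep := rep_inv (ladj_rep (fcorestr dom M)) (idm (sval M)).
have E : fmap F ep ∘ eM = idm _ := ladj_unit_rep_inv (X := fcorestr dom M) (idm _).
pose Lt := fmap F (fmap (ladj F) (th' : fcorestr dom X ~> fcorestr dom M)).
have N : Lt ∘ e = eM ∘ th' := ladj_unit_nat (X := fcorestr dom X)
  (Y := fcorestr dom M) th'.
pose r := th X ∘ fmap F ep ∘ Lt.
have re : r ∘ e = idm _.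
  by rewrite /r -compA N compA -(compA (th X)) E comp_idr.
pose v : @hom C (sval X) (sval X) := r ∘ th'.
pose u : @hom C (sval X) (sval X) := th X ∘ e.
have vu : v ∘ u = idm _ by rewrite /v /u compA -(compA r) h comp_idr.
have uv : u ∘ v = v ∘ u.
  have n1 := thn X X v.
  have n2 : fmap F (fmap (ladj F) (v : fcorestr dom X ~> fcorestr dom X)) ∘ e = e ∘ v :=
    ladj_unit_nat (X := fcorestr dom X) (Y := fcorestr dom X) v.
  by rewrite /u -compA -n2 !compA [X in X ∘ _]n1.
exists (v ∘ th X); split; first by rewrite -compA.
apply: (iso_mono (thi X)).
have E1 : th X ∘ e ∘ v = idm _ by rewrite -vu -uv.
rewrite comp_idr; apply: etrans (compA (th X) e (v ∘ th X)) _.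
apply: etrans (compA (th X ∘ e) v (th X)) _.
exact: (etrans (congr1 (fun t => t ∘ th X) E1) (comp_idl _)).
Qed.

(** The objects [L X] are ideal-projective with [F (L X)] isomorphic to [X], so they have the
    required properties. Any ideal-projective [P] is a retract of some [L X]: an epi from [F (L X)]
    to [F P] comes from an ideal-epic map, which splits. The properties pass to retracts. *)
Lemma conditions_resolving : left_adjoint_conditions -> ideal_resolving I F.
Proof.
move=> [Fsh FI Cproj [dom th]]; have unit := left_adjoint_unit_iso th.
have Cab := @stabcatP C; have [Fh Fs] := Fsh.
pose L (X : fullsub (@projective C)) := ladj F (fcorestr dom X).
have LP X : ideal_projective I (L X).
  by apply/ideal_projectiveP; exact: (ladj_ideal_projective FI).
have Lff X B : bijective (fun f : L X ~> B => fmap F f).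
  have [v [h k]] := unit X.
  exists (fun z => rep_inv (ladj_rep (fcorestr dom X)) (z ∘ ladj_unit _)) => [g|z].
    by apply: ladj_unit_inj; rewrite ladj_unit_rep_inv.
  apply: (iso_epi (unit X)); exact: ladj_unit_rep_inv.
have cover Y : exists X (e : F (L X) ~> Y), epi e.
  have [X [e [hX ee]]] := Cproj Y; pose X' : fullsub (@projective C) := exist _ X hX.
  have [v [h k]] := unit X'; exists X', (e ∘ v); apply: epi_comp => //.
  by apply: iso_epi; exists (ladj_unit (fcorestr dom X')).
have split P : ideal_projective I P -> exists X (p : L X ~> P) s, p ∘ s = idm P.
  move=> hP; have [X [e ee]] := cover (F P).
  have [p Ep] := bij_exists (Lff X P) e.
  have pe : ideal_epic I p by apply/(ideal_epicP Cab p Fh FI); rewrite Ep.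
  by have [s Es] := ideal_epic_lift (idm P) pe hP; exists X, p, s.
have ff P B : ideal_projective I P -> bijective (fun f : P ~> B => fmap F f).
  move=> /split [X [p [s ps]]]; apply: bij_of_inj_surj => [f g E|z].
    rewrite -(comp_idr f) -(comp_idr g) -ps !compA; congr (_ ∘ s).
    by apply: (bij_inj (Lff X B)); rewrite !fmap_comp E.
  have [w Ew] := bij_exists (Lff X B) (z ∘ fmap F p).
  by exists (w ∘ s); rewrite fmap_comp Ew -compA -fmap_comp ps fmap_id comp_idr.
split=> //; split=> [[Q hQ] [Q' hQ']|[Q hQ]|Y].
- exact: ff.
- have [X [p [s ps]]] := split Q hQ.
  have hFL : projective (F (L X)).
    have [v [h k]] := unit X; apply: (projective_retract k).
    exact: (svalP X).
  by apply: (projective_retract (r := fmap F p) (s := fmap F s)) => //=;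
    rewrite -fmap_comp ps fmap_id.
by have [X [e ee]] := cover Y; exists (exist _ (L X) (LP X)), e.
Qed.

Lemma resolving_conditions : idempotents_split T -> ideal_resolving I F ->
  left_adjoint_conditions.
Proof.
move=> Tsplit res; split.
- exact: (ires_hom res).
- exact: (ires_ker res).
- exact: (enough_projectives_dense (ires_dense res)).
exists (fun X => ires_ladj_dom Tsplit res (svalP X)).
exact: ladj_unit_nat_iso res _.
Qed.

End Characterization.

Theorem theorem3p41 (T : triangulated) (Tsplit : idempotents_split T)
    (I : ideal T) (Ihom : homological_ideal I)
    (Ienough : enough_ideal_projectives I)
    (C : stabcat) (F : functor T C) :
  (* the two descriptions of F are equivalent *)
  (universal_exact I F <->
   [/\ stable_homological F,
       kernel_is F I,
       enough_projectives C &
       exists dom : forall X : fullsub (@projective C),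
           ladj_dom F (femb (@projective C) X),
         nat_iso (F ⊚ ladj F ⊚ fcorestr dom) (femb (@projective C))]) /\
  (universal_exact I F ->
  (* (a) *)
  [/\ forall X : C, ladj_dom F X <-> projective X,
      forall A : T, ideal_projective I A <->
        exists X : fullsub (ladj_dom F), isomorphic (ladj F X) A &
      exists (FP : forall A : fullsub (ideal_projective I),
                 projective ((F ⊚ femb (ideal_projective I)) A))
             (dom : forall X : fullsub (@projective C),
                 ladj_dom F (femb (@projective C) X))
             (LP : forall X : fullsub (@projective C),
                 ideal_projective I ((ladj F ⊚ fcorestr dom) X)),
        inverse_equivalences (fcorestr FP) (fcorestr LP)] /\
  (* (b) *)
  (forall A : T, ideal_projective I A <->
     projective (F A) /\
     forall B : T, bijective (fun f : A ~> B => fmap F f)) /\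
  (* (c) *)
  (forall A : T, projective (F A) <->
     exists (P : T) (f : P ~> A),
       ideal_projective I P /\ ideal_equivalence I f) /\
  (* (d) *)
  (forall A : T,
     (forall P : augcx A, ideal_projres I P -> projres (fmap_cx F P)) /\
     (forall Q : augcx (F A), projres Q -> forall n, ladj_dom F (Q n)) /\
     (forall (Q : augcx (F A)) (dom : forall n, ladj_dom F (Q n)),
        projres Q -> ideal_projres I (ladj_cx dom)) /\
     (forall P P' : augcx A, ideal_projres I P -> ideal_projres I P' ->
        augcx_iso P P' -> augcx_iso (fmap_cx F P) (fmap_cx F P')) /\
     (forall (Q Q' : augcx (F A)) (dom : forall n, ladj_dom F (Q n))
         (dom' : forall n, ladj_dom F (Q' n)),
        projres Q -> projres Q' ->
        augcx_iso Q Q' -> augcx_iso (ladj_cx dom) (ladj_cx dom')) /\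
     (forall (P : augcx A) (dom : forall n, ladj_dom F (fmap_cx F P n)),
        ideal_projres I P -> augcx_iso (ladj_cx dom) P) /\
     (forall (Q : augcx (F A)) (dom : forall n, ladj_dom F (Q n)),
        projres Q -> augcx_iso (fmap_cx F (ladj_cx dom)) Q)) /\
  (* (e) *)
  [/\ forall (C' : abcat) (G : functor T C'), homological G ->
        unique_upto_iso (fun Gb : functor C C' =>
          right_exact Gb /\
          nat_iso (Gb ⊚ F ⊚ femb (ideal_projective I))
                  (G ⊚ femb (ideal_projective I))),
      forall (C' : stabcat) (G : functor T C'), stable_homological G ->
        unique_upto_iso (fun Gb : functor C C' =>
          [/\ right_exact Gb, stable_functor Gb &
              nat_iso (Gb ⊚ F ⊚ femb (ideal_projective I))
                      (G ⊚ femb (ideal_projective I))]) &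
      forall (C' : abcat) (G : functor T C') (Gb : functor C C'),
        homological G -> right_exact Gb ->
        nat_iso (Gb ⊚ F ⊚ femb (ideal_projective I))
                (G ⊚ femb (ideal_projective I)) ->
        forall n : nat,
          [/\ exists L : functor T C', is_left_derived (@ideal_projres T I) G n L,
              exists Lb : functor C C', is_left_derived (@projres C) Gb n Lb &
              forall (L : functor T C') (Lb : functor C C'),
                is_left_derived (@ideal_projres T I) G n L ->
                is_left_derived (@projres C) Gb n Lb ->
                nat_iso (Lb ⊚ F) L]] /\
  (* (f) *)
  [/\ forall (C' : abcat) (G : functor (opcat T) C'), cohomological G ->
        unique_upto_iso (fun Gb : functor (opcat C) C' =>
          left_exact Gb /\
          nat_iso (Gb ⊚ fop F ⊚ fop (femb (ideal_projective I)))
                  (G ⊚ fop (femb (ideal_projective I)))),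
      forall (C' : stabcat) (G : functor (opcat T) C'), stable_cohomological G ->
        unique_upto_iso (fun Gb : functor (opcat C) C' =>
          [/\ left_exact Gb, stable_cofunctor Gb &
              nat_iso (Gb ⊚ fop F ⊚ fop (femb (ideal_projective I)))
                      (G ⊚ fop (femb (ideal_projective I)))]),
      forall (C' : abcat) (G : functor (opcat T) C') (Gb : functor (opcat C) C'),
        cohomological G -> left_exact Gb ->
        nat_iso (Gb ⊚ fop F ⊚ fop (femb (ideal_projective I)))
                (G ⊚ fop (femb (ideal_projective I))) ->
        forall n : nat,
          [/\ exists R : functor (opcat T) C',
                is_right_derived (@ideal_projres T I) G n R,
              exists Rb : functor (opcat C) C',
                is_right_derived (@projres C) Gb n Rb &
              forall (R : functor (opcat T) C') (Rb : functor (opcat C) C'),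
                is_right_derived (@ideal_projres T I) G n R ->
                is_right_derived (@projres C) Gb n Rb ->
                nat_iso (Rb ⊚ fop F) R] &
      forall n : nat,
        [/\ exists E : bifunctor T, is_Ext (@ideal_projres T I) n E,
            exists Eb : bifunctor C, is_Ext (@projres C) n Eb &
            forall (E : bifunctor T) (Eb : bifunctor C),
              is_Ext (@ideal_projres T I) n E -> is_Ext (@projres C) n Eb ->
              exists i : forall A B : T, E A B ~> Eb (F A) (F B),
                (forall A B : T, is_iso (i A B)) /\
                (forall (A A' B B' : T) (a : A' ~> A) (b : B ~> B'),
                   i A' B' ∘ bimap E a b =
                   bimap Eb (fmap F a) (fmap F b) ∘ i A B)]]).
Proof.
have equiv : universal_exact I F <-> ideal_resolving I F.
  by split; [exact: universal_resolving|exact: ires_universal].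
split.
  split=> [/equiv res|h]; first exact: resolving_conditions.
  by apply/equiv; exact: conditions_resolving.
move=> /equiv res.
have Cab := @stabcatP C; have dJ := ires_dense res.
have rT := ideal_projres_class Tsplit res; have rC := ires_projres_class res.
have rP (A : T) (P : augcx A) :
  ideal_projres I P -> forall k, ideal_projective I (P k) by case.
have rF (A : T) (P : augcx A) : ideal_projres I P -> projres (fmap_cx F P).
  exact: (ideal_projres_fmap res).
split.
  split=> [X|A|].
  - exact: (ladj_domP Tsplit res X).
  - exact: (ladj_essential_range res A).
  - exact: (ires_equivalence Tsplit res).
split; first by move=> A; exact: (ideal_projective_char res A).
split; first by move=> A; exact: (ires_projectiveP Tsplit res A).
split.
  move=> A; split; first exact: rF.
  split; first by move=> Q [hQ _ _ _] n; exact: (ires_ladj_dom Tsplit res (hQ n)).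
  split; first by move=> Q dom; exact: (ladj_cx_projres res).
  split; first by move=> P P' _ _; exact: augcx_iso_fmap.
  split; first by move=> Q Q' dom dom' _ _; exact: (ladj_cx_iso res).
  split; first by move=> P dom /rP; exact: (ladj_cx_fmap res).
  by move=> Q dom _; apply: augcx_iso_sym; exact: (ladj_cx_unit res).
split.
  split=> [C' G Gh|C' G [Gh Gs]|C' G Gb Gh Gr GG n].
  - have C'ab := abcatP C'.
    have [H [Hr HG]] := right_exact_extension Cab dJ
      (G ⊚ femb (ideal_projective I)) (has_cokernel C'ab).
    exists H; split=> // H' [Hr' HG'].
    exact: (right_exact_unique Cab dJ Hr' Hr HG' HG).
  - have C'ab := @stabcatP C'.
    have [H [Hr HG]] := right_exact_extension Cab dJ
      (G ⊚ femb (ideal_projective I)) (has_cokernel C'ab).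
    exists H; split.
      by split=> //; exact: (stable_extension res Hr Gs HG).
    move=> H' [Hr' _ HG'].
    exact: (right_exact_unique Cab dJ Hr' Hr HG' HG).
  have C'ab := abcatP C'; split.
  - exact: (left_derived_exists rT (has_kernel C'ab) (has_cokernel C'ab)).
  - exact: (left_derived_exists rC (has_kernel C'ab) (has_cokernel C'ab)).
  move=> L Lb hL hLb; apply: (left_derived_along_unique rC).
    exact: (left_derived_fcomp F rC hLb).
  exact: (left_derived_transfer rT rP rF GG hL).
split=> [C' G Gh|C' G [Gh Gs]|C' G Gb Gh Gl GG n|n].
- have C'ab := abcatP C'.
  have [H [Hr HG]] := left_exact_extension Cab dJ
    (G ⊚ fop (femb (ideal_projective I))) (has_kernel C'ab).
  exists H; split=> // H' [Hr' HG'].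
  exact: (left_exact_unique Cab dJ Hr' Hr HG' HG).
- have C'ab := @stabcatP C'.
  have [H [Hr HG]] := left_exact_extension Cab dJ
    (G ⊚ fop (femb (ideal_projective I))) (has_kernel C'ab).
  exists H; split.
    by split=> //; exact: (stable_coextension res Hr Gs HG).
  move=> H' [Hr' _ HG'].
  exact: (left_exact_unique Cab dJ Hr' Hr HG' HG).
- have C'ab := abcatP C'; split.
  + exact: (right_derived_exists rT (has_kernel C'ab) (has_cokernel C'ab)).
  + exact: (right_derived_exists rC (has_kernel C'ab) (has_cokernel C'ab)).
  move=> R Rb hR hRb; apply: (right_derived_along_unique rC).
    exact: (right_derived_fcomp F rC hRb).
  exact: (right_derived_transfer rT rP rF GG hR).
split.
- exact: (Ext_exists rT Ab_has_kernel Ab_has_cokernel).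
- exact: (Ext_exists rC Ab_has_kernel Ab_has_cokernel).
move=> E Eb hE hEb.
have t := Ext_transfer rT rP rF (fun P B hP => ires_ff res B hP) hE.
exact: (Ext_along_unique rC t (Ext_fcomp F rC hEb)).
Qed.
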